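(* Let $(\boldsymbol\Omega_n)_{n\ge1}$ be a sequence of $2$-dimensional real random vectors. Suppose that the moment generating function satisfies $$\mathbb E(e^{\langle\boldsymbol\Omega_n,\boldsymbol s\rangle})=e^{u(\boldsymbol s)\Phi(n)+v(\boldsymbol s)}\big(1+\mathcal O(\kappa_n^{-1})\big),$$ the $\mathcal O$-term being uniform for $\|\boldsymbol s\|\le\tau$, $\boldsymbol s\in\mathbb C^2$, $\tau>0$, where (1) $u(\boldsymbol s)$ and $v(\boldsymbol s)$ are analytic for $\|\boldsymbol s\|\le\tau$ and independent of $n$; (2) $\lim_{n\to\infty}\Phi(n)=\infty$; (3) $\lim_{n\to\infty}\kappa_n=\infty$. Then $$\mathbb E(\boldsymbol\Omega_n)=\Phi(n)\,\mathrm{grad}\,u(\boldsymbol 0)+\mathrm{grad}\,v(\boldsymbol 0)+\mathcal O(\kappa_n^{-1}),$$ $$\mathbb V(\boldsymbol\Omega_n)=\Phi(n)H_u(\boldsymbol 0)+H_v(\boldsymbol 0)+\mathcal O(\kappa_n^{-1}),$$ where $H_u(\boldsymbol s)$ is the Hessian matrix of $u$ (and $H_v$ that of $v$). Let $\Sigma=H_u(\boldsymbol 0)$ and $$\boldsymbol\Omega_n^*=\frac{\boldsymbol\Omega_n-\Phi(n)\,\mathrm{grad}\,u(\boldsymbol 0)}{\sqrt{\Phi(n)}}.$$ If $H_u(\boldsymbol 0)$ is regular, then the standardized random vector $\boldsymbol\Omega_n^*$ is asymptotically jointly normally distributed with variance-covariance matrix $\Sigma$. If $H_u(\boldsymbol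 0)$ has rank $1$, then the limit distribution of $\boldsymbol\Omega_n^*$ is the direct product of a normal distribution and a degenerate distribution (if one of the variances of the two coordinates of $\boldsymbol\Omega_n$ is $\mathcal O(1)$) or (otherwise) a linear transformation of such a direct product. In the first case, the coordinates of $\boldsymbol\Omega_n^*$ are asymptotically independent. In the second case, there is an asymptotically linear relationship between the two coordinates. If $H_u(\boldsymbol 0)$ has rank $0$, then the limit distribution of $\boldsymbol\Omega_n^*$ is degenerate.
   Context: Boldface letters denote vectors, $\boldsymbol s=(s_1,s_2)^t$; $\|\boldsymbol s\|=\max(|s_1|,|s_2|)$ is the maximum norm; $\langle\boldsymbol\Omega_n,\boldsymbol s\rangle=\Omega_{n,1}s_1+\Omega_{n,2}s_2$. $\mathbb V(\boldsymbol\Omega_n)$ is the variance-covariance matrix. A random variable (or vector) is degenerate if it is constant with probability $1$. Limit distributions are in the sense of convergence in distribution. Asymptotically independent coordinates means the limit vector has independent components; an asymptotically linear relationship between the coordinates means the components of the limit vector satisfy, almost surely, a linear relation expressing one as a constant nonzero multiple of the other. *)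

(* Defs.v *)
From HB Require Import structures.
From mathcomp Require Import all_boot all_order all_algebra.
From mathcomp Require Import all_classical all_reals all_analysis.
From mathcomp Require Import complex.

Set Implicit Arguments.
Unset Strict Implicit.
Unset Printing Implicit Defensive.

Import Order.TTheory GRing.Theory Num.Theory.
Import numFieldNormedType.Exports.

Local Open Scope classical_set_scope.
Local Open Scope ring_scope.
Local Open Scope complex_scope.

(* R[i] has no topology of its own in the library; seen as a packed
   numFieldType it carries the norm topology of numFieldNormedType. *)
Notation Cplx R := (Num.NumField.sort (complex R : numFieldType)).

Section ComplexAnalysis.
Variable R : realType.
Local Notation C := (Cplx R).

Definition cexp (z : C) : C :=
  (expR (complex.Re z))%:C *
  (cos (complex.Im z) +i* sin (complex.Im z)).

Definition pseries2 (c : nat -> nat -> C) (z : 'cV[C]_2) (N : nat) : C :=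
  \sum_(j < N) \sum_(k < N) c j k * (z 0 0 ^+ j * z 1 0 ^+ k).

(* The library norm `|_| on 'cV[C]_2 is the maximum norm; it takes its
   (real, nonnegative) values in C. *)
Definition analytic_at (f : 'cV[C]_2 -> C) (a : 'cV[C]_2) : Prop :=
  exists (r : R) (c : nat -> nat -> C), 0 < r /\
    forall s : 'cV[C]_2, `|s - a| < (r%:C : C) ->
      (exists M : R, forall N,
        \sum_(j < N) \sum_(k < N)
          `|c j k * ((s - a) 0 0 ^+ j * (s - a) 1 0 ^+ k)| <= (M%:C : C)) /\
      pseries2 c (s - a) N @[N --> \oo] --> f s.

Definition gradient (f : 'cV[C]_2 -> C) (a : 'cV[C]_2) : 'cV[C]_2 :=
  \col_i 'D_(delta_mx i 0) f a.

Definition hessian (f : 'cV[C]_2 -> C) (a : 'cV[C]_2) : 'M[C]_2 :=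
  \matrix_(i, j) 'D_(delta_mx i 0) ('D_(delta_mx j 0) f) a.

End ComplexAnalysis.

Section RandomVectors.
Context (R : realType) (d : measure_display) (T : measurableType d)
  (P : probability T R).
Local Notation C := (Cplx R).

Definition integrableC (Z : T -> C) : Prop :=
  P.-integrable [set: T] (EFin \o (fun w => complex.Re (Z w))) /\
  P.-integrable [set: T] (EFin \o (fun w => complex.Im (Z w))).

Definition expectationC (Z : T -> C) : C :=
  fine 'E_P[fun w => complex.Re (Z w)]%E +i* fine 'E_P[fun w => complex.Im (Z w)]%E.

(* e^{<X, s>} *)
Definition exp_pairing (X : 'I_2 -> T -> R) (s : 'cV[C]_2) (w : T) : C :=
  cexp (\sum_i (X i w)%:C * s i 0).

Definition mean_vector (X : 'I_2 -> T -> R) : 'cV[R]_2 :=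
  \col_i fine 'E_P[X i]%E.

Definition covariance_matrix (X : 'I_2 -> T -> R) : 'M[R]_2 :=
  \matrix_(i, j) fine (covariance P (X i) (X j)).

Definition standardize (phi : R) (g : 'cV[R]_2) (X : 'I_2 -> T -> R) (w : T) :
    R * R :=
  ((X 0 w - phi * g 0 0) / Num.sqrt phi, (X 1 w - phi * g 1 0) / Num.sqrt phi).

End RandomVectors.

Section LimitLaws.
Variable R : realType.

Definition cvg_in_distribution (d : nat -> measure_display)
    (T : forall n, measurableType (d n)) (P : forall n, probability (T n) R)
    (Y : forall n, T n -> R * R) (mu : probability (R * R)%type R) : Prop :=
  forall f : R * R -> R, continuous f -> [bounded f z | z in [set: R * R]] ->
    'E_(P n)[f \o Y n]%E @[n --> \oo] --> 'E_mu[f]%E.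

Definition normal2_pdf (Sigma : 'M[R]_2) (z : R * R) : R :=
  let x : 'cV[R]_2 := \col_i (if i == 0 then z.1 else z.2) in
  (2 * pi * Num.sqrt (\det Sigma))^-1 *
  expR (- (x^T *m invmx Sigma *m x) 0 0 / 2).

Definition is_normal2 (Sigma : 'M[R]_2) (mu : probability (R * R)%type R) :
    Prop :=
  forall A : set (R * R), measurable A ->
    mu A = (\int[(@lebesgue_measure R \x @lebesgue_measure R)%E]_(z in A)
              (normal2_pdf Sigma z)%:E)%E.

(* sigma != 0: normal_prob m 0 is the uniform law on [0, 1]. *)
Definition is_normal1 (nu : probability R R) : Prop :=
  exists m sigma : R, 0 < sigma /\
    forall A : set R, measurable A -> nu A = normal_prob m sigma A.

Definition degenerate (d : measure_display) (S : measurableType d)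
    (mu : probability S R) : Prop :=
  exists c : S, mu [set c] = 1%E.

Definition normal_times_degenerate (mu : probability (R * R)%type R) : Prop :=
  exists nu1 nu2 : probability R R,
    ((is_normal1 nu1 /\ degenerate nu2) \/
     (degenerate nu1 /\ is_normal1 nu2)) /\
    forall A : set (R * R), measurable A -> mu A = (nu1 \x nu2)%E A.

Definition mulmx2 (M : 'M[R]_2) (z : R * R) : R * R :=
  (M 0 0 * z.1 + M 0 1 * z.2, M 1 0 * z.1 + M 1 1 * z.2).

(* M is invertible: a singular M could collapse the normal factor. *)
Definition linear_image (nu mu : probability (R * R)%type R) : Prop :=
  exists M : 'M[R]_2, M \in unitmx /\
    forall A : set (R * R), measurable A -> mu A = pushforward nu (mulmx2 M) A.

Definition independent_components (mu : probability (R * R)%type R) : Prop :=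
  forall A B : set R, measurable A -> measurable B ->
    mu (A `*` B) = (mu (A `*` setT) * mu (setT `*` B))%E.

Definition linearly_related (mu : probability (R * R)%type R) : Prop :=
  exists a : R, a != 0 /\ mu [set z | z.2 = a * z.1] = 1%E.

End LimitLaws.

(* Main.v *)
(* For a real direction w, both X = <Omega_n, w> and its moment generating
   function z |-> E(e^(z X)) are one-dimensional, and dividing by the value at
   z = 0 makes the error term vanish at the origin without changing its order.
   The function E(e^(z X)) e^(-(Phi U + V)) - 1 is then O(1/kappa_n) on a fixed
   disc, so Cauchy's estimates bound its first two Taylor coefficients, which
   are the errors in the mean and the variance of X; the directions (1,0), (0,1)
   and (1,1) give the mean vector and the covariance matrix by polarization.
   As moments are real and Phi tends to infinity, the gradient and the Hessian
   of u at 0 are real, and the Hessian is positive semidefinite.  At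
   z = i / sqrt(Phi) the same formula shows that the characteristic function of
   the standardized vector tends to exp(-Q/2), Q the quadratic form of the
   Hessian.  A continuous bounded function is approximated by trigonometric
   polynomials up to e + C |x|^2 / K^2, so characteristic functions and bounded
   second moments determine the limit law.  It is Gaussian: with a density if the
   Hessian is regular, carried by a line if it has rank 1, by a point if it is 0.

   No contour or Fourier integral is used: Cauchy's estimates come from
   Parseval's identity on roots of unity, for uniform limits of polynomials, and
   the trigonometric approximation from a discretized Fejer kernel. *)

Require Import Defs.
From HB Require Import structures.
From mathcomp Require Import all_boot all_order all_algebra.
From mathcomp Require Import all_classical all_reals all_analysis.
From mathcomp Require Import complex.
From mathcomp Require Import measurable_realfun.
From mathcomp Require Import ring lra.

Set Implicit Arguments.
Unset Strict Implicit.
Unset Printing Implicit Defensive.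

Import Order.TTheory GRing.Theory Num.Theory.
Import numFieldNormedType.Exports.

Local Open Scope classical_set_scope.
Local Open Scope ring_scope.
Local Open Scope complex_scope.

(** * Complex numbers and Cauchy's estimates *)

(** Three obstacles shape the argument. Analyticity is given only as a local double power series, so
    work on a complex line through the origin rests on two notions: [disc_approx] (uniform
    polynomial approximation on a disc) and [jet2] (Taylor coefficients up to order two, with a
    cubic remainder). The first lets a bound on a disc reach polynomial coefficients, the second
    tells which numbers these coefficients approximate; [cauchy2] ties them together. Next, the
    hypothesis fixes the exponents only through their exponentials, so no logarithm is ever taken:
    the error is isolated by multiplication with an inverse exponential. Finally, a singular Hessian
    gives a limit law without density. All limit laws are therefore described by their real moment
    generating function exp(Q/2), and an identity theorem for power expansions carries it to the
    imaginary axis, so that one convergence argument serves every rank. *)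

Lemma sum_expr_root_of_unity (K : fieldType) (x : K) (N : nat) :
  x ^+ N = 1 -> x != 1 -> \sum_(m < N) x ^+ m = 0.
Proof.
move=> xN x1; apply: (mulfI (x := x - 1)); first by rewrite subr_eq0.
by rewrite -subrX1 xN subrr mulr0.
Qed.

(** Expanding the squared modulus gives a double sum over [k] and [l]. For [k] different from [l]
    the ratio [w ^+ k / w ^+ l] is an [N]-th root of unity other than 1, because both indices are
    below [N]; this is where the size bound enters, and the sum over [m] vanishes. *)
Lemma parseval (K : numClosedFieldType) (N : nat) (w z : K) (q : {poly K}) :
  N.-primitive_root w -> (size q <= N)%N ->
  \sum_(m < N) `|q.[z * w ^+ m]| ^+ 2 =
  N%:R * \sum_(k < N) `|q`_k| ^+ 2 * (`|z| ^+ 2) ^+ k.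
Proof.
move=> wN sq.
have N0 := prim_order_gt0 wN.
have w1 : `|w| = 1.
  apply: (pexpIrn N0); rewrite ?nnegrE ?normr_ge0 ?ler01//.
  by rewrite -normrX (prim_expr_order wN) normr1 expr1n.
have w0 : w != 0 by rewrite -normr_eq0 w1 oner_eq0.
have wc : (w^*)%R = w^-1.
  by apply: (mulfI w0); rewrite -normCK w1 expr1n divff.
under eq_bigr => m _.
  rewrite normCK (horner_coef_wide _ sq) rmorph_sum big_distrlr/=.
  over.
rewrite exchange_big mulr_sumr; apply: eq_bigr => k _.
rewrite exchange_big (bigD1 k)//= [X in _ + X]big1 ?addr0; last first.
  move=> l lk.
  rewrite (eq_bigr (fun m : 'I_N =>
      q`_k * z ^+ k * ((q`_l * z ^+ l)^*)%R * (w ^+ k / w ^+ l) ^+ m)); last first.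
    move=> m _; have cX x n : ((x ^+ n)^* = x^* ^+ n :> K)%R by exact: rmorphXn.
    have cM x y : ((x * y)^* = x^* * y^* :> K)%R by exact: rmorphM.
    rewrite !(cM, cX) wc !exprMn -!exprVn -!exprM.
    by rewrite (mulnC m k) (mulnC m l); ring.
  rewrite -mulr_sumr sum_expr_root_of_unity ?mulr0//.
    by rewrite expr_div_n (exprAC w k) (exprAC w l) (prim_expr_order wN) !expr1n divr1.
  rewrite -(inj_eq (mulIf (expf_neq0 l w0))) divfK ?expf_neq0// mul1r.
  by rewrite (eq_prim_root_expr wN) !modn_small// eq_sym.
rewrite (eq_bigr (fun=> `|q`_k| ^+ 2 * (`|z| ^+ 2) ^+ k)).
  by rewrite sumr_const card_ord mulr_natl.
move=> m _; rewrite -normCK normrM normrX normrM normrX w1 expr1n mulr1.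
by rewrite exprMn -!exprM mulnC.
Qed.

(** The mean of the squared modulus over [N] equally spaced points of the circle of radius [r] is at
    most [B ^+ 2], and by [parseval] it dominates each single term. The choice of [N] as the size of
    [q] prevents aliasing. For [R[i]] the roots of unity are supplied by [prim_root_cis]. *)
Lemma cauchy_coef (K : numClosedFieldType) (q : {poly K}) (r B : K) (k : nat) :
  (forall N, (0 < N)%N -> exists w : K, N.-primitive_root w) ->
  0 <= r -> (forall z, `|z| <= r -> `|q.[z]| <= B) -> `|q`_k| * r ^+ k <= B.
Proof.
move=> root r0 qB.
have B0 : 0 <= B by rewrite (le_trans _ (qB 0 _)) ?normr0.
have [kq|kq] := leqP (size q) k; first by rewrite nth_default// normr0 mul0r.
pose N := size q; have N0 : (0 < N)%N by exact: leq_ltn_trans kq.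
have [w wN] := root N N0.
rewrite -(@ler_pXn2r _ 2)// ?nnegrE ?mulr_ge0 ?exprn_ge0//.
have := @parseval K N w r q wN (leqnn _); rewrite (ger0_norm r0) => pars.
rewrite -(ler_pM2l (_ : 0 < N%:R)) ?ltr0n//.
apply: (@le_trans _ _ (\sum_(m < N) `|q.[r * w ^+ m]| ^+ 2)); last first.
  rewrite mulr_natl -[in leRHS](card_ord N) -sumr_const.
  apply: ler_sum => m _; rewrite ler_pXn2r ?nnegrE//; apply: qB.
  rewrite normrM normrX.
  suff -> : `|w| = 1 by rewrite expr1n mulr1 ger0_norm.
  apply: (pexpIrn N0); rewrite ?nnegrE ?normr_ge0 ?ler01//.
  by rewrite -normrX (prim_expr_order wN) normr1 expr1n.
rewrite pars ler_pM2l ?ltr0n// (bigD1 (Ordinal kq))//= exprMn -exprM mulnC exprM.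
by rewrite lerDl sumr_ge0// => i _; rewrite mulr_ge0 ?exprn_ge0.
Qed.
Section ComplexModulus.
Variable R : realType.
Local Notation C := (Cplx R).
Implicit Types (z w : C) (x : R).

(** The norm of [C] takes its values in [C]; read in [R], it lives in a total order where linear
    arithmetic applies. *)
Definition cabs (z : C) : R := complex.Re `|z|.

Lemma cabsE z : `|z| = (cabs z)%:C.
Proof. by rewrite /cabs normc_def. Qed.

Lemma cabs_ge0 z : 0 <= cabs z.
Proof. by rewrite -ler0c -cabsE normr_ge0. Qed.

Lemma cabsM z w : cabs (z * w) = cabs z * cabs w.
Proof. by apply: complexI; rewrite rmorphM/= -!cabsE normrM. Qed.

Lemma cabsD z w : cabs (z + w) <= cabs z + cabs w.
Proof. by rewrite -lecR rmorphD/= -!cabsE ler_normD. Qed.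

Lemma cabsN z : cabs (- z) = cabs z.
Proof. by apply: complexI; rewrite -!cabsE normrN. Qed.

Lemma cabsB z w : cabs (z - w) <= cabs z + cabs w.
Proof. by rewrite -(cabsN w) cabsD. Qed.

Lemma cabsC z w : cabs (z - w) = cabs (w - z).
Proof. by rewrite -cabsN opprB. Qed.

Lemma cabs_triangle z w v : cabs (z - v) <= cabs (z - w) + cabs (w - v).
Proof. by apply: le_trans (cabsD _ _); rewrite addrA subrK. Qed.

Lemma cabs0 : cabs 0 = 0.
Proof. by apply: complexI; rewrite -!cabsE normr0. Qed.

Lemma cabs1 : cabs 1 = 1.
Proof. by apply: complexI; rewrite -!cabsE normr1. Qed.

Lemma cabsX z n : cabs (z ^+ n) = cabs z ^+ n.
Proof. by apply: complexI; rewrite rmorphXn/= -!cabsE normrX. Qed.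

Lemma cabsV z : cabs z^-1 = (cabs z)^-1.
Proof. by apply: complexI; rewrite -cabsE fmorphV/= -cabsE normfV. Qed.

Lemma cabs_eq0 z : (cabs z == 0) = (z == 0).
Proof. by rewrite -(inj_eq (@complexI R)) -cabsE normr_eq0. Qed.

Lemma cabs_real x : cabs x%:C = `|x|.
Proof. by rewrite /cabs normc_def/= expr0n/= addr0 sqrtr_sqr. Qed.

Lemma cabs_nat n : cabs n%:R = n%:R.
Proof. by rewrite -(rmorph_nat (real_complex R)) cabs_real ger0_norm. Qed.

Lemma cabs_i : cabs 'i = 1.
Proof. by rewrite /cabs normc_def/= expr0n add0r expr1n sqrtr1. Qed.

Lemma Re_le_cabs z : `|complex.Re z| <= cabs z.
Proof. by rewrite -lecR -cabsE normc_ge_Re. Qed.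

Lemma Im_le_cabs z : `|complex.Im z| <= cabs z.
Proof.
rewrite /cabs normc_def/= -sqrtr_sqr ler_wsqrtr// lerDr sqr_ge0 //.
Qed.

Lemma cabs_le z : cabs z <= `|complex.Re z| + `|complex.Im z|.
Proof.
have -> : z = (complex.Re z)%:C + 'i%C * (complex.Im z)%:C by rewrite -complexE.
apply: le_trans (cabsD _ _) _; rewrite cabsM cabs_i mul1r !cabs_real/=.
by rewrite !(mul0r, mulr0, mul1r, subr0, addr0, add0r).
Qed.

Lemma cabs_sum I (r : seq I) (P : pred I) (F : I -> C) :
  cabs (\sum_(i <- r | P i) F i) <= \sum_(i <- r | P i) cabs (F i).
Proof.
elim/big_rec2: _ => [|i y1 y2 _ h]; first by rewrite cabs0.
by apply: le_trans (cabsD _ _) _; rewrite lerD2l.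
Qed.

Lemma ReD z w : complex.Re (z + w) = complex.Re z + complex.Re w.
Proof. by case: z w => [? ?] [? ?]. Qed.

Lemma ImD z w : complex.Im (z + w) = complex.Im z + complex.Im w.
Proof. by case: z w => [? ?] [? ?]. Qed.

Lemma ReB z w : complex.Re (z - w) = complex.Re z - complex.Re w.
Proof. by case: z w => [? ?] [? ?]. Qed.

Lemma ImB z w : complex.Im (z - w) = complex.Im z - complex.Im w.
Proof. by case: z w => [? ?] [? ?]. Qed.

Lemma Re_sum I (r : seq I) (P : pred I) (F : I -> C) :
  complex.Re (\sum_(i <- r | P i) F i) = \sum_(i <- r | P i) complex.Re (F i).
Proof. by elim/big_rec2: _ => // i y1 y2 _ <-; rewrite ReD. Qed.

Lemma Im_sum I (r : seq I) (P : pred I) (F : I -> C) :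
  complex.Im (\sum_(i <- r | P i) F i) = \sum_(i <- r | P i) complex.Im (F i).
Proof. by elim/big_rec2: _ => // i y1 y2 _ <-; rewrite ImD. Qed.

Lemma ReZ x z : complex.Re (x%:C * z) = x * complex.Re z.
Proof. by case: z => [? ?]; rewrite /= mul0r subr0. Qed.

Lemma ImZ x z : complex.Im (x%:C * z) = x * complex.Im z.
Proof. by case: z => [? ?]; rewrite /= mul0r addr0. Qed.

End ComplexModulus.

Section ComplexExponential.
Variable R : realType.
Local Notation C := (Cplx R).
Implicit Types (z w : C) (x : R).

Lemma cexpD z w : cexp (z + w) = cexp z * cexp w.
Proof.
case: z w => [a b] [c d]; rewrite /cexp /= expRD cosD sinD.
by apply/eqP; rewrite eq_complex/=; apply/andP; split; apply/eqP; ring.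
Qed.

Lemma cexp0 : cexp 0 = 1 :> C.
Proof. by rewrite /cexp/= expR0 cos0 sin0 mul1r. Qed.

Lemma cexpN z : cexp (- z) = (cexp z)^-1.
Proof.
have : cexp z * cexp (- z) = 1 by rewrite -cexpD subrr cexp0.
move=> h; have z0 : cexp z != 0.
  by apply/eqP => z0; move: h; rewrite z0 mul0r => /esym/eqP; rewrite oner_eq0.
by apply: (mulfI z0); rewrite h divff.
Qed.

Lemma cexp_real x : cexp x%:C = (expR x)%:C.
Proof. by rewrite /cexp/= cos0 sin0 mulr1. Qed.

Lemma cexp_imag x : cexp ('i * x%:C) = cos x +i* sin x.
Proof.
rewrite /cexp/= !(mul0r, mulr0, mul1r, subr0, addr0, add0r, subrr) oppr0 expR0.
exact: mul1r.
Qed.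

Lemma cabs_cexp z : cabs (cexp z) = expR (complex.Re z).
Proof.
rewrite /cexp cabsM cabs_real ger0_norm ?expR_ge0//.
by rewrite /cabs normc_def/= cos2Dsin2 sqrtr1 mulr1.
Qed.

Lemma cabs_cexp_le z : cabs (cexp z) <= expR (cabs z).
Proof.
rewrite cabs_cexp ler_expR; apply: le_trans (Re_le_cabs z); exact: ler_norm.
Qed.

End ComplexExponential.

Section UnitCircle.
Variable R : realType.
Local Notation C := (Cplx R).
Implicit Types (M : nat) (t : R).

Lemma cabs_sqr (z : C) : cabs z ^+ 2 = complex.Re z ^+ 2 + complex.Im z ^+ 2.
Proof. by apply: complexI; rewrite add_Re2_Im2 cabsE rmorphXn. Qed.

Definition cis t : C := cexp ('i * t%:C).

Lemma cisE t : cis t = cos t +i* sin t.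
Proof. exact: cexp_imag. Qed.

Lemma cisD s t : cis (s + t) = cis s * cis t.
Proof. by rewrite /cis rmorphD mulrDr cexpD. Qed.

Lemma cisX t k : cis t ^+ k = cis (k%:R * t).
Proof.
elim: k => [|k IH]; first by rewrite mul0r /cis mulr0 cexp0.
by rewrite exprS IH -cisD -natr1 mulrDl mul1r addrC.
Qed.

Lemma cabs_cis t : cabs (cis t) = 1.
Proof.
apply/eqP; rewrite -(@eqrXn2 _ 2)// ?cabs_ge0// cabs_sqr cisE/=.
by rewrite cos2Dsin2 expr1n.
Qed.

Lemma cos_lt1 t : 0 < t -> t < pi *+ 2 -> cos t < 1.
Proof.
move=> t0 t2; have [tpi|tpi] := leP t pi.
  by rewrite -[ltRHS]cos0 ltr_cos// in_itv/= ?lexx ?pi_ge0 ?(ltW t0).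
have -> : cos t = cos (pi *+ 2 - t).
  by rewrite -[RHS]cosN opprB -[RHS]cosD2pi subrK.
rewrite -[ltRHS]cos0 ltr_cos ?subr_gt0// in_itv/= ?lexx ?pi_ge0//.
by rewrite subr_ge0 (ltW t2)/= mulr2n lerBlDr lerD2l ltW.
Qed.

(** For [k.+1] below [M] the angle lies strictly between 0 and [pi *+ 2], where the cosine is less
    than 1. *)
Lemma prim_root_cis M : (0 < M)%N -> M.-primitive_root (cis (pi *+ 2 / M%:R)).
Proof.
move=> M0; rewrite /primitive_root_of_unity M0/=; apply/forallP => /= k.
have M0' : (0 : R) < M%:R by rewrite ltr0n.
rewrite unity_rootE cisX; apply/eqP; have [kM|kM] := eqVneq k.+1 M.
  have -> : k.+1%:R * (pi *+ 2 / M%:R) = pi *+ 2 :> R.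
    by rewrite kM mulrC divfK// gt_eqF.
  by rewrite cisE cos2pi sin2pi; exact: eqxx.
apply/negbTE; rewrite cisE eq_complex/= negb_and; apply/orP; left.
rewrite lt_eqF// cos_lt1//.
  by rewrite mulr_gt0 ?ltr0n// divr_gt0// pmulrn_lgt0 ?pi_gt0.
have pi2 : 0 < pi *+ 2 :> R by rewrite pmulrn_lgt0 ?pi_gt0.
rewrite mulrCA gtr_pMr// ltr_pdivrMr// mul1r.
by rewrite ltr_nat ltn_neqAle kM ltn_ord.
Qed.

Lemma poly_coef_le (q : {poly C}) (r B : R) (k : nat) : 0 <= r ->
  (forall z, cabs z <= r -> cabs q.[z] <= B) -> cabs q`_k * r ^+ k <= B.
Proof.
move=> r0 qB; rewrite -lecR rmorphM rmorphXn/= -cabsE.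
apply: (@cauchy_coef R[i]) => [N /prim_root_cis h||z]; first by eexists; exact: h.
  by rewrite ler0c.
by rewrite (cabsE z) lecR => /qB; rewrite -lecR -cabsE.
Qed.

End UnitCircle.

(** * Taylor remainder of the complex exponential *)

Section ExponentialTaylor.
Variable R : realType.
Local Notation C := (Cplx R).

(** Only a real function of a real variable is differentiated, along the ray through [w], so that
    the mean value theorem applies; the factor [c] serves to rotate a complex remainder onto the
    real axis. *)
Lemma is_derive_Re_cexp (c w : C) (t : R) :
  is_derive t (1 : R) (fun t : R => complex.Re (c * cexp (t%:C * w)))
    (complex.Re (c * w * cexp (t%:C * w))).
Proof.
case: c w => [c1 c2] [x y].
have lin (a : R) : is_derive t (1 : R) (fun t : R => t * a) a.
  have := is_derive_poly (a *: 'X) t.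
  rewrite derivZ derivX alg_polyC hornerC.
  rewrite (_ : horner _ = (fun t : R => t * a))//.
  by apply/funext => s; rewrite !hornerE mulrC.
have de := @is_derive1_comp R expR ( *%R^~ x) t _ _ (is_derive_expR (t * x)) (lin x).
have dc := @is_derive1_comp R cos ( *%R^~ y) t _ _ (is_derive_cos (t * y)) (lin y).
have ds := @is_derive1_comp R sin ( *%R^~ y) t _ _ (is_derive_sin (t * y)) (lin y).
have := is_deriveM de (is_deriveB (is_deriveZ c1 dc) (is_deriveZ c2 ds)).
move=> h; rewrite [F in is_derive _ _ F _](_ : _ = ((expR \o *%R^~ x) *
    (c1 \*: (cos \o *%R^~ y) - c2 \*: (sin \o *%R^~ y)))); last first.
  apply/funext => s; rewrite /cexp/= !(mul0r, subr0, addr0).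
  transitivity (expR (s * x) * (c1 * cos (s * y) - c2 * sin (s * y))) => //.
  by ring.
apply: is_derive_eq.
transitivity (expR (t * x) * (c1 * (- sin (t * y) * y) - c2 * (cos (t * y) * y)) +
  (c1 * cos (t * y) - c2 * sin (t * y)) * (expR (t * x) * x)) => //.
by rewrite /cexp/= !(mul0r, subr0, addr0); ring.
Qed.

Definition exp_poly (N : nat) : {poly C} := \poly_(k < N) (k`!%:R^-1).

Lemma exp_polyE N w : (exp_poly N).[w] = \sum_(k < N) w ^+ k / k`!%:R.
Proof. by rewrite horner_poly; apply: eq_bigr => k _; rewrite mulrC. Qed.

Lemma natr_fact_inv (K : numFieldType) n :
  n.+1`!%:R^-1 * n.+1%:R = n`!%:R^-1 :> K.
Proof. by rewrite factS natrM invfM mulrAC mulVf ?pnatr_eq0// mul1r. Qed.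

(** Induction on [N]: along the ray, the derivative of the remainder of order [N.+1] is [w] times
    the remainder of order [N]. After rotation, subtracting the claimed bound times [t ^+ N.+1]
    leaves a real function that starts at 0 and has nonpositive derivative on the unit interval. *)
Lemma cexp_taylor N w :
  cabs (cexp w - (exp_poly N).[w]) <= cabs w ^+ N / N`!%:R * expR (cabs w).
Proof.
elim: N w => [|N IH] w.
  by rewrite exp_polyE big_ord0 subr0 expr0 fact0 divr1 mul1r cabs_cexp_le.
set D := cexp w - _.
have [->|D0] := eqVneq D 0.
  by rewrite cabs0 !mulr_ge0 ?expR_ge0 ?invr_ge0 ?exprn_ge0 ?cabs_ge0.
(* the direction of D makes |D| the real part of c D *)
pose c : C := `|D| / D.
have cD : c * D = (cabs D)%:C by rewrite /c divfK// cabsE.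
have c1 : cabs c = 1.
  by rewrite cabsM cabsV cabsE cabs_real ger0_norm ?cabs_ge0// divff// cabs_eq0.
pose a k := complex.Re (c * w ^+ k / k`!%:R).
pose A := cabs w ^+ N.+1 / N.+1`!%:R * expR (cabs w).
pose p : {poly R} := (\poly_(k < N.+1) a k) + A *: 'X^(N.+1).
have pE t : p.[t] = complex.Re (c * (exp_poly N.+1).[t%:C * w]) + A * t ^+ N.+1.
  rewrite /p hornerD hornerZ hornerXn horner_poly exp_polyE; congr (_ + _).
  rewrite mulr_sumr Re_sum; apply: eq_bigr => k _.
  rewrite [RHS](_ : _ = complex.Re ((t ^+ k)%:C * (c * w ^+ k / k`!%:R))).
    by rewrite ReZ mulrC.
  by rewrite exprMn rmorphXn; congr complex.Re; ring.
have p'E t : p^`().[t] = complex.Re (c * w * (exp_poly N).[t%:C * w])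
    + cabs w ^+ N.+1 / N`!%:R * expR (cabs w) * t ^+ N.
  have -> : p^`() = (\poly_(k < N) (k.+1%:R * a k.+1)) +
      (cabs w ^+ N.+1 / N`!%:R * expR (cabs w)) *: 'X^N.
    rewrite /p derivD derivZ derivXn -scaler_nat scalerA; congr (_ + _ *: _).
      apply/polyP => i; rewrite coef_deriv !coef_poly ltnS.
      by case: ifP => _; rewrite ?mul0rn// mulr_natl.
    by rewrite /A -(natr_fact_inv _ N); ring.
  rewrite hornerD hornerZ hornerXn horner_poly exp_polyE; congr (_ + _).
  rewrite mulr_sumr Re_sum; apply: eq_bigr => k _.
  rewrite [RHS](_ : _ = complex.Re ((k.+1%:R * t ^+ k)%:C *
      (c * w ^+ k.+1 / k.+1`!%:R))).
    by rewrite ReZ mulrAC.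
  rewrite exprMn rmorphM rmorphXn rmorph_nat -(natr_fact_inv _ k) exprS.
  by congr complex.Re; ring.
pose F t := complex.Re (c * cexp (t%:C * w)) - p.[t].
pose dF t := complex.Re (c * w * cexp (t%:C * w)) - p^`().[t].
have dFE t : is_derive t (1 : R) F (dF t).
  exact: (is_deriveB (is_derive_Re_cexp c w t) (is_derive_poly p t)).
(* [F] is 0 at 0 and [cabs D - A] at 1, so it suffices that [dF] is nonpositive at the intermediate
   point; there the induction hypothesis applies. *)
have [|t] := @MVT_segment R F dF 0 1 ler01 (fun t _ => dFE t).
  apply: continuous_subspaceT => t.
  by apply: differentiable_continuous; apply/derivable1_diffP; case: (dFE t).
rewrite in_itv/= => /andP[t0 t1] Fdiff.
have F0 : F 0 = 0.
  rewrite /F pE !mul0r cexp0 mulr1 expr0n mulr0 addr0 exp_polyE.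
  rewrite big_ord_recl/= expr0 fact0 divr1 big1 ?addr0 ?mulr1 ?subrr//.
  by move=> i _; rewrite expr0n mul0r.
have F1 : F 1 = cabs D - A.
  by rewrite /F pE !mul1r expr1n mulr1 opprD addrA -ReB -mulrBr -/D cD.
move: Fdiff; rewrite F0 F1 !subr0 mulr1 => Fdiff.
rewrite -subr_le0 -/A Fdiff /dF p'E.
rewrite opprD addrA -ReB -mulrBr subr_le0.
apply: le_trans (ler_norm _) _; apply: le_trans (Re_le_cabs _) _.
rewrite (cabsM (c * w)) (cabsM c) c1 mul1r.
apply: (@le_trans _ _ (cabs w * ((t * cabs w) ^+ N / N`!%:R * expR (cabs w)))).
  rewrite ler_wpM2l ?cabs_ge0//; apply: le_trans (IH _) _.
  rewrite cabsM cabs_real (ger0_norm t0) ler_wpM2l//.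
    by rewrite mulr_ge0 ?invr_ge0 ?exprn_ge0 ?mulr_ge0 ?cabs_ge0.
  by rewrite ler_expR ler_piMl ?cabs_ge0.
by rewrite exprMn exprS le_eqVlt; apply/orP; left; apply/eqP; ring.
Qed.

End ExponentialTaylor.
Lemma expr_le (R : realDomainType) (x y : R) n :
  0 <= x -> x <= y -> x ^+ n <= y ^+ n.
Proof. by move=> x0 xy; rewrite lerXn2r ?nnegrE// (le_trans x0). Qed.

(** * Uniform polynomial approximation and second-order jets *)

Section DiscApproximation.
Variable R : realType.
Local Notation C := (Cplx R).
Implicit Types (f g : C -> C) (r e B : R).

(* On a disc, uniform limits of polynomials play the role of holomorphic functions. *)
Definition disc_approx r f := forall e, 0 < e -> exists p : {poly C},
  forall z, cabs z <= r -> cabs (f z - p.[z]) <= e.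

Lemma eq_disc_approx r f g : (forall z, cabs z <= r -> f z = g z) ->
  disc_approx r f -> disc_approx r g.
Proof.
by move=> fg fa e /fa[p pf]; exists p => z zr; rewrite -fg// pf.
Qed.

Lemma disc_approx_poly r (p : {poly C}) : disc_approx r (horner p).
Proof. by move=> e e0; exists p => z _; rewrite subrr cabs0 ltW. Qed.

Lemma disc_approx_cst r (c : C) : disc_approx r (fun=> c).
Proof.
apply: eq_disc_approx (disc_approx_poly r c%:P) => z _; exact: hornerC.
Qed.

Lemma cabs_horner_le (p : {poly C}) r z : cabs z <= r ->
  cabs p.[z] <= \sum_(k < size p) cabs p`_k * r ^+ k.
Proof.
move=> zr; rewrite horner_coef; apply: le_trans (cabs_sum _ _ _) _.
apply: ler_sum => k _; rewrite cabsM cabsX ler_wpM2l ?cabs_ge0//.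
exact: expr_le (cabs_ge0 z) zr.
Qed.

Lemma disc_approx_bounded r f : disc_approx r f ->
  exists2 B, 0 < B & forall z, cabs z <= r -> cabs (f z) <= B.
Proof.
move=> /(_ 1 ltr01)[p pf].
exists (`|\sum_(k < size p) cabs p`_k * r ^+ k| + 2).
  by rewrite ltr_wpDl.
move=> z zr; rewrite -[f z](subrK p.[z]); apply: le_trans (cabsD _ _) _.
have := pf _ zr; have := cabs_horner_le p zr.
have := ler_norm (\sum_(k < size p) cabs p`_k * r ^+ k); lra.
Qed.

Lemma disc_approxD r f g : disc_approx r f -> disc_approx r g ->
  disc_approx r (fun z => f z + g z).
Proof.
move=> fa ga e e0; have e20 : 0 < e / 2 by rewrite divr_gt0.
have [p pf] := fa _ e20; have [q qg] := ga _ e20; exists (p + q) => z zr.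
rewrite hornerD opprD addrACA; apply: le_trans (cabsD _ _) _.
by have := pf _ zr; have := qg _ zr; lra.
Qed.

Lemma disc_approxM r f g : disc_approx r f -> disc_approx r g ->
  disc_approx r (fun z => f z * g z).
Proof.
move=> fa ga e e0.
have [Bf Bf0 fB] := disc_approx_bounded fa.
have [Bg Bg0 gB] := disc_approx_bounded ga.
(* The fractions share [e] between [f (g - q)] and [(f - p) q]; the minimum with 1 keeps the
   approximant [q] below [Bg + 1]. *)
have [|p pf] := fa (Num.min 1 (e / (2 * (Bg + 1)))) _.
  by rewrite lt_min ltr01 divr_gt0// mulr_gt0// addr_gt0.
have [|q qg] := ga (Num.min 1 (e / (2 * (Bf + 1)))) _.
  by rewrite lt_min ltr01 divr_gt0// mulr_gt0// addr_gt0.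
exists (p * q) => z zr; rewrite hornerM.
rewrite (_ : _ - _ = f z * (g z - q.[z]) + (f z - p.[z]) * q.[z]); last by ring.
have qB : cabs q.[z] <= Bg + 1.
  rewrite -[q.[z]](subrK (g z)); apply: le_trans (cabsD _ _) _.
  rewrite addrC lerD ?gB// cabsC; apply: le_trans (qg _ zr) _.
  by rewrite ge_min lexx.
apply: le_trans (cabsD _ _) _; rewrite !cabsM.
have -> : e = Bf * (e / (2 * (Bf + 1))) + (e / (2 * (Bf + 1))) + e / (2 * (Bg + 1)) * (Bg + 1).
  by field; rewrite !gt_eqF ?addr_gt0.
apply: lerD; last first.
  apply: ler_pM; rewrite ?cabs_ge0//; apply: le_trans (pf _ zr) _.
  by rewrite ge_min lexx orbT.
apply: (@le_trans _ _ (Bf * (e / (2 * (Bf + 1))))).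
  apply: ler_pM; rewrite ?cabs_ge0 ?fB//; apply: le_trans (qg _ zr) _.
  by rewrite ge_min lexx orbT.
by rewrite lerDl ltW// divr_gt0// mulr_gt0// addr_gt0.
Qed.

Lemma disc_approx_horner r (p : {poly C}) f : disc_approx r f ->
  disc_approx r (fun z => p.[f z]).
Proof.
move=> fa; elim/poly_ind: p => [|p c IH].
  by apply: eq_disc_approx (disc_approx_cst r 0) => z _; rewrite horner0.
apply: eq_disc_approx (disc_approxD (disc_approxM IH fa) (disc_approx_cst r c)).
by move=> z _; rewrite hornerMXaddC.
Qed.

Lemma exp_coeff_small B e : 0 < e -> exists N, B ^+ N / N`!%:R * expR B <= e.
Proof.
move=> e0; have /cvgrPdist_le/(_ (e / expR B) _) := cvg_series_cvg_0 (is_cvg_series_exp_coeff B).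
move=> []; first by rewrite divr_gt0 ?expR_gt0.
move=> N _ /(_ N (leqnn N)); rewrite sub0r normrN => h; exists N.
rewrite -ler_pdivlMr ?expR_gt0//; apply: le_trans h; exact: ler_norm.
Qed.

(** A truncated exponential series is a polynomial in [f], and [cexp_taylor] makes its error uniform
    because [f] is bounded on the disc. *)
Lemma disc_approx_cexp r f : disc_approx r f -> disc_approx r (fun z => cexp (f z)).
Proof.
move=> fa e e0; have e20 : 0 < e / 2 by rewrite divr_gt0.
have [B B0 fB] := disc_approx_bounded fa.
have [N Ne] := exp_coeff_small B e20.
have [p pf] := disc_approx_horner (exp_poly R N) fa e20; exists p => z zr.
apply: le_trans (cabs_triangle _ (exp_poly R N).[f z] _) _.
suff : cabs (cexp (f z) - (exp_poly R N).[f z]) <= e / 2.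
  by have := pf _ zr; lra.
apply: le_trans (cexp_taylor _ _) (le_trans _ Ne).
rewrite ler_pM ?expR_ge0 ?ler_expR ?fB//.
  by rewrite mulr_ge0 ?invr_ge0 ?exprn_ge0 ?cabs_ge0.
by rewrite ler_wpM2r ?invr_ge0// expr_le ?cabs_ge0 ?fB.
Qed.

(** A quantified Taylor expansion at 0 that stands in for complex differentiability. The number [a2]
    is the coefficient of the square, that is, half the second derivative. *)
Definition jet2 f (a0 a1 a2 : C) := exists K rho : R, [/\ 0 <= K, 0 < rho &
  forall z, cabs z <= rho ->
    cabs (f z - (a0 + a1 * z + a2 * z ^+ 2)) <= K * cabs z ^+ 3].

Lemma jet2_cst c : jet2 (fun=> c) c 0 0.
Proof.
by exists 0, 1; split => // z _; rewrite !(mul0r, addr0) subrr cabs0.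
Qed.

Lemma jet2D f g a0 a1 a2 b0 b1 b2 : jet2 f a0 a1 a2 -> jet2 g b0 b1 b2 ->
  jet2 (fun z => f z + g z) (a0 + b0) (a1 + b1) (a2 + b2).
Proof.
move=> [K [rho [K0 rho0 fK]]] [L [sig [L0 sig0 gL]]].
exists (K + L), (Num.min rho sig); split; rewrite ?lt_min ?rho0 ?addr_ge0//.
move=> z; rewrite le_min => /andP[/fK hf /gL hg].
rewrite (_ : _ - _ = (f z - (a0 + a1 * z + a2 * z ^+ 2)) +
  (g z - (b0 + b1 * z + b2 * z ^+ 2))); last by ring.
by apply: le_trans (cabsD _ _) _; rewrite mulrDl lerD.
Qed.

Lemma jet2_near f g a0 a1 a2 L rho : 0 < rho -> 0 <= L -> jet2 f a0 a1 a2 ->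
  (forall z, cabs z <= rho -> cabs (g z - f z) <= L * cabs z ^+ 3) ->
  jet2 g a0 a1 a2.
Proof.
move=> rho0 L0 [K [sig [K0 sig0 fK]]] gL.
exists (L + K), (Num.min rho sig); split; rewrite ?lt_min ?rho0 ?addr_ge0//.
move=> z; rewrite le_min => /andP[/gL hf /fK hg].
by apply: le_trans (cabs_triangle _ (f z) _) _; rewrite mulrDl lerD.
Qed.

Lemma jet2_lip f a0 a1 a2 : jet2 f a0 a1 a2 -> exists B rho : R,
  [/\ 0 <= B, 0 < rho & forall z, cabs z <= rho -> cabs (f z - a0) <= B * cabs z].
Proof.
move=> [K [rho [K0 rho0 fK]]].
exists (K + cabs a1 + cabs a2), (Num.min rho 1); split.
- by rewrite !addr_ge0 ?cabs_ge0.
- by rewrite lt_min rho0 ltr01.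
move=> z; rewrite le_min => /andP[/fK fz z1].
rewrite (_ : _ - _ = f z - (a0 + a1 * z + a2 * z ^+ 2) + (a1 * z + a2 * z ^+ 2)); last by ring.
apply: le_trans (cabsD _ _) _; rewrite -(addrA K) mulrDl; apply: lerD.
  apply: le_trans fz _; rewrite ler_wpM2l// exprS ler_piMr ?cabs_ge0//.
  by rewrite exprn_ile1 ?cabs_ge0.
apply: le_trans (cabsD _ _) _; rewrite (cabsM a1) (cabsM a2) cabsX mulrDl lerD2l.
rewrite ler_wpM2l ?cabs_ge0//.
by rewrite expr2 ler_piMr ?cabs_ge0.
Qed.

Lemma jet2_bound f a0 a1 a2 : jet2 f a0 a1 a2 -> exists B rho : R,
  [/\ 0 <= B, 0 < rho & forall z, cabs z <= rho -> cabs (f z) <= B].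
Proof.
move=> /jet2_lip[B [rho [B0 rho0 fB]]].
exists (B + cabs a0), (Num.min rho 1); split; rewrite ?lt_min ?rho0 ?ltr01 ?addr_ge0 ?cabs_ge0//.
move=> z; rewrite le_min => /andP[/fB fz z1].
rewrite -[f z](subrK a0); apply: le_trans (cabsD _ _) _; rewrite lerD2r.
by apply: le_trans fz _; rewrite ler_piMr.
Qed.

Lemma jet2M f g a0 a1 a2 b0 b1 b2 : jet2 f a0 a1 a2 -> jet2 g b0 b1 b2 ->
  jet2 (fun z => f z * g z) (a0 * b0) (a0 * b1 + a1 * b0)
    (a0 * b2 + a1 * b1 + a2 * b0).
Proof.
move=> fj gj; have [Bf [rf [Bf0 rf0 fB]]] := jet2_bound fj.
move: fj gj => [K [rho [K0 rho0 fK]]] [L [sig [L0 sig0 gL]]].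
pose Q z : C := b0 + b1 * z + b2 * z ^+ 2.
have QB z : cabs z <= 1 -> cabs (Q z) <= cabs b0 + cabs b1 + cabs b2.
  move=> z1; apply: le_trans (cabsD _ _) _; apply: lerD.
    by apply: le_trans (cabsD _ _) _; rewrite lerD2l cabsM ler_piMr ?cabs_ge0.
  by rewrite cabsM cabsX ler_piMr ?cabs_ge0// exprn_ile1 ?cabs_ge0.
set BQ := cabs b0 + _ + _ in QB.
have BQ0 : 0 <= BQ by rewrite !addr_ge0 ?cabs_ge0.
pose D := cabs (a1 * b2 + a2 * b1) + cabs (a2 * b2).
exists (Bf * L + K * BQ + D), (Num.min (Num.min rf rho) (Num.min sig 1)); split.
- by rewrite !addr_ge0 ?mulr_ge0 ?cabs_ge0.
- by rewrite !lt_min rf0 rho0 sig0 ltr01.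
move=> z; rewrite !le_min => /andP[/andP[/fB fz /fK hf] /andP[/gL hg z1]].
(* The last summand is the part of degree 3 and 4 of the product of the two quadratic
   polynomials. *)
rewrite (_ : _ - _ = f z * (g z - Q z) + (f z - (a0 + a1 * z + a2 * z ^+ 2)) * Q z +
   ((a1 * b2 + a2 * b1) + (a2 * b2) * z) * z ^+ 3); last by rewrite /Q; ring.
apply: le_trans (cabsD _ _) _; rewrite (mulrDl _ D) (mulrDl (Bf * L)).
apply: lerD.
  apply: le_trans (cabsD _ _) _; apply: lerD.
    by rewrite cabsM -mulrA ler_pM ?cabs_ge0.
  by rewrite cabsM mulrAC ler_pM ?cabs_ge0 ?QB.
rewrite cabsM cabsX ler_wpM2r ?exprn_ge0 ?cabs_ge0//.
by apply: le_trans (cabsD _ _) _; rewrite lerD2l cabsM ler_piMr ?cabs_ge0.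
Qed.

(** Near 0 the values of [f] are of order [z], so replacing [cexp] by its Taylor polynomial of
    degree 2 costs only a cubic term. *)
Lemma jet2_cexp f a1 a2 : jet2 f 0 a1 a2 ->
  jet2 (fun z => cexp (f z)) 1 a1 (a2 + a1 ^+ 2 / 2).
Proof.
move=> fj; have [B [rho [B0 rho0 fB]]] := jet2_lip fj.
have := jet2D (jet2D (jet2_cst 1) fj) (jet2M (jet2_cst (1 / 2)) (jet2M fj fj)).
rewrite !(mul0r, mulr0, addr0, add0r) => h.
have -> : a2 + a1 ^+ 2 / 2 = a2 + 1 / 2 * (a1 * a1) by field.
apply: (@jet2_near _ _ _ _ _ (B ^+ 3 * expR B) (Num.min rho 1) _ _ h).
- by rewrite lt_min rho0 ltr01.
- by rewrite mulr_ge0 ?exprn_ge0 ?expR_ge0.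
move=> z; rewrite le_min => /andP[/fB fz z1]; rewrite subr0 in fz.
have := cexp_taylor 3 (f z); rewrite exp_polyE !big_ord_recl big_ord0 /=.
have -> : 2`! = 2%N by [].
rewrite /bump/= (_ : 1 + 0 = 1)%N// (_ : 1`! = 1)%N// fact0.
rewrite (_ : _ + (_ + _) = 1 + f z + 1 / 2 * (f z * f z)); last by field.
move=> /le_trans; apply; rewrite (mulrAC (B ^+ 3)) -exprMn.
apply: ler_pM; rewrite ?expR_ge0//.
- by rewrite mulr_ge0 ?exprn_ge0 ?cabs_ge0 ?invr_ge0.
- apply: le_trans (expr_le 3 (cabs_ge0 _) fz).
  by rewrite ler_piMr ?exprn_ge0 ?cabs_ge0// invf_le1 ?ltr0n ?fact_gt0// ler1n fact_gt0.
- by rewrite ler_expR (le_trans fz)// ler_piMr.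
Qed.

(** Let [p] approximate [f] on the large disc within [t ^+ 3]. Cauchy's estimate at radius [r]
    bounds the coefficients of [p]. On the disc of radius [t] the polynomial [p] differs from the
    jet by at most [(1 + K) * t ^+ 3], so Cauchy's estimate at radius [t] shows that their
    coefficients of index [k] differ by order [t ^+ (3 - k)], which vanishes with [t] for [k] at
    most 2. *)
Lemma cauchy2 r f a0 a1 a2 B : 0 < r -> disc_approx r f -> jet2 f a0 a1 a2 ->
  (forall z, cabs z <= r -> cabs (f z) <= B) ->
  cabs a1 * r <= B /\ cabs a2 * r ^+ 2 <= B.
Proof.
move=> r0 fa [K [rho [K0 rho0 fK]]] fB.
pose P : {poly C} := a0%:P + a1 *: 'X + a2 *: 'X^2.
have main (k : 'I_3) (t : R) : 0 < t -> t <= Num.min (Num.min r rho) 1 ->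
    cabs P`_k * r ^+ k <= B + t ^+ 3 + (1 + K) * t ^+ 3 / t ^+ k * r ^+ k.
  move=> t0; rewrite !le_min => /andP[/andP[tr trho] t1].
  have [p pf] := fa (t ^+ 3) (exprn_gt0 _ t0).
  have pk : cabs p`_k * r ^+ k <= B + t ^+ 3.
    apply: poly_coef_le (ltW r0) _ => z zr.
    rewrite -[p.[z]](subrK (f z)); apply: le_trans (cabsD _ _) _.
    by rewrite addrC lerD ?fB// cabsC pf.
  have qk : cabs (P - p)`_k * t ^+ k <= (1 + K) * t ^+ 3.
    apply: poly_coef_le (ltW t0) _ => z zt.
    rewrite hornerD hornerN cabsC.
    have -> : P.[z] = a0 + a1 * z + a2 * z ^+ 2 by rewrite /P !hornerE.
    apply: le_trans (cabs_triangle _ (f z) _) _; rewrite mulrDl mul1r; apply: lerD.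
      by rewrite cabsC pf// (le_trans zt).
    apply: le_trans (fK _ (le_trans zt trho)) _; rewrite ler_wpM2l//.
    by rewrite expr_le ?cabs_ge0.
  rewrite -[P](subrK p) coefD addrC.
  apply: (@le_trans _ _ ((cabs p`_k + cabs (P - p)`_k) * r ^+ k)).
    by rewrite ler_wpM2r ?exprn_ge0 ?(ltW r0)// cabsD.
  rewrite mulrDl lerD// ler_wpM2r ?exprn_ge0 ?(ltW r0)//.
  by rewrite ler_pdivlMr ?exprn_gt0.
(* For [t] at most 1, all error terms of [main] with index 1 or 2 are bounded by [t * M]. *)
pose M := 1 + (1 + K) * (r + r ^+ 2).
have M0 : 0 < M by rewrite /M; nra.
have conclude (x : R) : (forall t, 0 < t -> t <= Num.min (Num.min r rho) 1 ->
    x <= B + t * M) -> x <= B.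
  move=> h; apply/ler_addgt0Pr => e e0.
  have t0 : 0 < Num.min (Num.min (Num.min r rho) 1) (e / M).
    by rewrite !lt_min r0 rho0 ltr01 divr_gt0.
  apply: le_trans (h _ t0 _) _; first by rewrite ge_min lexx.
  by rewrite lerD2l -ler_pdivlMr// ge_min lexx orbT.
have P1 : P`_1 = a1 by rewrite /P !coefD coefC !coefZ coefX coefXn/=; ring.
have P2 : P`_2 = a2 by rewrite /P !coefD coefC !coefZ coefX coefXn/=; ring.
split; apply: conclude => t t0 tm.
  have := main (inord 1) t t0 tm; rewrite inordK// P1 => /le_trans; apply.
  rewrite -addrA lerD2l; have t1 : t <= 1 by move: tm; rewrite !le_min => /andP[].
  rewrite !expr1 (_ : _ / t = (1 + K) * t ^+ 2); last by field; rewrite gt_eqF.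
  rewrite /M; have : t ^+ 2 <= t by rewrite expr2 ler_piMr// ltW.
  have : t ^+ 3 <= t by rewrite exprS ler_piMr ?exprn_ile1// ltW.
  move=> t3 t2; have h1 : (1 + K) * r * t ^+ 2 <= (1 + K) * r * t.
    by rewrite ler_wpM2l// mulr_ge0 ?addr_ge0// ltW.
  have h2 : 0 <= (1 + K) * r ^+ 2 * t.
    by rewrite !mulr_ge0 ?addr_ge0 ?sqr_ge0// ltW.
  by lra.
have := main (inord 2) t t0 tm; rewrite inordK// P2 => /le_trans; apply.
rewrite -addrA lerD2l; have t1 : t <= 1 by move: tm; rewrite !le_min => /andP[].
rewrite (_ : _ / t ^+ 2 = (1 + K) * t); last by field; rewrite gt_eqF.
have t3 : t ^+ 3 <= t by rewrite exprS ler_piMr ?exprn_ile1// ltW.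
have h1 : 0 <= (1 + K) * r * t by rewrite !mulr_ge0 ?addr_ge0// ltW.
by rewrite /M; lra.
Qed.

End DiscApproximation.

(** * Double power series and their derivatives *)

Section DoublePowerSeries.
Variable R : realType.
Local Notation C := (Cplx R).
Implicit Types (c : nat -> nat -> C) (x y : C) (d h rho M : R).

Lemma mx_norm_leP m n (A : 'M[C]_(m, n)) (x : R) : 0 <= x ->
  (`|A| <= x%:C) <-> (forall i j, cabs (A i j) <= x).
Proof.
move=> x0; rewrite {1}/Num.Def.normr/=; split=> [Ax i j|Ax].
  rewrite -lecR -cabsE; apply: le_trans Ax; rewrite mx_normE.
  by rewrite -[leLHS]nngE num_le; exact: (le_bigmax _ _ (i, j)).
have [->|/mx_norm_neq0[ij ->]] := eqVneq (mx_norm A) 0; first by rewrite ler0c.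
by rewrite cabsE lecR.
Qed.

Definition vec2 x y : 'cV[C]_2 := \col_i (if i == 0 then x else y).

Lemma vec2_norm_le x y d : 0 <= d ->
  (`|vec2 x y| <= d%:C) <-> (cabs x <= d /\ cabs y <= d).
Proof.
move=> d0; rewrite mx_norm_leP//; split=> [A|[xd yd] i j].
  by split; [have := A 0 0|have := A 1 0]; rewrite mxE.
by rewrite mxE; case: ifP.
Qed.

Definition psum2 c x y N : C := \sum_(j < N) \sum_(k < N) c j k * (x ^+ j * y ^+ k).

(** Analyticity in the form used by the estimates: absolute summability is recorded at the single
    radius [rho] with an explicit bound [M], from which geometric tail bounds on smaller polydiscs
    follow. *)
Definition power_series2 (g : C -> C -> C) c rho M := [/\ 0 < rho,
  forall N, \sum_(j < N) \sum_(k < N) cabs (c j k) * rho ^+ (j + k) <= M &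
  forall x y, cabs x <= rho -> cabs y <= rho -> forall e : R, 0 < e ->
    exists N0, forall N, (N0 <= N)%N -> cabs (g x y - psum2 c x y N) <= e].

Lemma widen2 (V : nmodType) (a : nat -> nat -> V) n N : (n <= N)%N ->
  (forall j k, ~~ ((j < n) && (k < n))%N -> a j k = 0) ->
  \sum_(j < N) \sum_(k < N) a j k = \sum_(j < n) \sum_(k < n) a j k.
Proof.
move=> nN a0; rewrite [RHS](big_ord_widen N (fun j => \sum_(k < n) a j k))//.
rewrite [RHS]big_mkcond; apply: eq_bigr => j _.
case: ifPn => jn; last by rewrite big1// => k _; rewrite a0// (negbTE jn).
rewrite [RHS](big_ord_widen N (fun k => a j k))// [RHS]big_mkcond.
by apply: eq_bigr => k _; case: ifPn => // kn; rewrite a0// (negbTE kn) andbF.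
Qed.

(** Shrinking the polydisc by [q] multiplies every term of total degree at least [D] by at most
    [q ^+ D]. With [q = 1/2] this yields uniform convergence, with [q] proportional to [d] and
    [D = 3] a cubic remainder. *)
Lemma sum2_tail_le c rho M (b : nat -> nat -> R) (q : R) (D : nat) N :
  0 < rho -> 0 <= q <= 1 ->
  (forall N, \sum_(j < N) \sum_(k < N) cabs (c j k) * rho ^+ (j + k) <= M) ->
  (forall j k, (j + k < D)%N -> b j k = 0) ->
  (forall j k, (D <= j + k)%N -> b j k <= cabs (c j k) * (rho * q) ^+ (j + k)) ->
  \sum_(j < N) \sum_(k < N) b j k <= q ^+ D * M.
Proof.
move=> rho0 /andP[q0 q1] cM b0 bc.
apply: (@le_trans _ _ (q ^+ D * \sum_(j < N) \sum_(k < N) cabs (c j k) * rho ^+ (j + k))).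
  rewrite mulr_sumr; apply: ler_sum => j _; rewrite mulr_sumr; apply: ler_sum => k _.
  have [jk|jk] := ltnP (j + k) D.
    by rewrite b0// !mulr_ge0 ?exprn_ge0 ?cabs_ge0// ltW.
  apply: le_trans (bc _ _ jk) _; rewrite exprMn [leLHS]mulrA [leLHS]mulrC ler_wpM2r//.
    by rewrite mulr_ge0 ?exprn_ge0 ?cabs_ge0// ltW.
  by rewrite ler_wiXn2l.
by rewrite ler_wpM2l ?exprn_ge0.
Qed.

(** The square truncation at [N] contains every monomial of total degree below [N], so two
    truncations differ only in degrees at least [N], where halving the radius gains [2 ^+ N]. *)
Lemma psum2_uniform g c rho M N x y : power_series2 g c rho M ->
  cabs x <= rho / 2 -> cabs y <= rho / 2 -> cabs (g x y - psum2 c x y N) <= M / 2 ^+ N.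
Proof.
move=> [rho0 cM gc] xr yr; apply/ler_addgt0Pr => e e0.
have r2 : rho / 2 <= rho by rewrite ler_piMr// ?(ltW rho0)// invf_le1// ler1n.
have [N0 gN] := gc x y (le_trans xr r2) (le_trans yr r2) e e0.
pose N' := maxn N0 N.
rewrite [leRHS]addrC; apply: le_trans (cabs_triangle _ (psum2 c x y N') _) _; apply: lerD.
  exact/gN/leq_maxl.
pose a j k : C := if ((j < N) && (k < N))%N then c j k * (x ^+ j * y ^+ k) else 0.
have -> : psum2 c x y N = \sum_(j < N') \sum_(k < N') a j k.
  rewrite (@widen2 _ a N N') ?leq_maxr//; last by move=> j k /negbTE; rewrite /a => ->.
  by apply: eq_bigr => j _; apply: eq_bigr => k _; rewrite /a !ltn_ord.
rewrite -sumrB; apply: le_trans (cabs_sum _ _ _) _.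
pose b j k : R := if (j + k < N)%N then 0 else cabs (c j k) * (rho / 2) ^+ (j + k).
apply: (@le_trans _ _ (\sum_(j < N') \sum_(k < N') b j k)).
  apply: ler_sum => j _; rewrite -sumrB; apply: le_trans (cabs_sum _ _ _) _.
  apply: ler_sum => k _; rewrite /a /b; have [jk|jk] := ltnP (j + k) N.
    rewrite (leq_ltn_trans (leq_addr _ _) jk) (leq_ltn_trans (leq_addl _ _) jk).
    by rewrite subrr cabs0.
  case: ifP => _.
    by rewrite subrr cabs0 mulr_ge0 ?cabs_ge0// exprn_ge0// divr_ge0// ltW.
  rewrite subr0 cabsM ler_wpM2l ?cabs_ge0// cabsM !cabsX exprD.
  by rewrite ler_pM ?exprn_ge0 ?cabs_ge0// expr_le ?cabs_ge0.
rewrite mulrC -exprVn; apply: (@sum2_tail_le c rho) => //.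
- by rewrite invr_ge0 ler0n/= invf_le1// ler1n.
- by move=> j k jk; rewrite /b jk.
- by move=> j k jk; rewrite /b ltnNge jk.
Qed.

(** The mean value bound for a power, multiplied through by [d] so that the exponent [n - 1] does
    not occur. *)
Lemma expr_diff_le x x' d h n : cabs x <= d -> cabs x' <= d -> cabs (x - x') <= h ->
  cabs (x ^+ n - x' ^+ n) * d <= n%:R * d ^+ n * h.
Proof.
move=> xd xd' xh; have d0 : 0 <= d := le_trans (cabs_ge0 _) xd.
elim: n => [|n IH]; first by rewrite subrr cabs0 !mul0r.
rewrite !exprS (_ : _ - _ = x * (x ^+ n - x' ^+ n) + (x - x') * x' ^+ n); last by ring.
apply: (@le_trans _ _ ((cabs x * cabs (x ^+ n - x' ^+ n) + cabs (x - x') * cabs x' ^+ n) * d)).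
  by rewrite ler_wpM2r// -cabsX -!cabsM cabsD.
rewrite mulrDl (_ : _ * h = d * (n%:R * d ^+ n * h) + h * d ^+ n * d); last first.
  by rewrite -natr1; ring.
apply: lerD; first by rewrite -mulrA ler_pM ?mulr_ge0 ?cabs_ge0.
by rewrite ler_wpM2r// ler_pM ?exprn_ge0 ?cabs_ge0// expr_le ?cabs_ge0.
Qed.

Lemma monomial_diff_le x y x' y' d h j k :
  cabs x <= d -> cabs y <= d -> cabs x' <= d -> cabs y' <= d ->
  cabs (x - x') <= h -> cabs (y - y') <= h ->
  cabs (x ^+ j * y ^+ k - x' ^+ j * y' ^+ k) * d <= (j + k)%:R * d ^+ (j + k) * h.
Proof.
move=> xd yd xd' yd' xh yh; have d0 : 0 <= d := le_trans (cabs_ge0 _) xd.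
rewrite (_ : _ - _ = (x ^+ j - x' ^+ j) * y ^+ k + x' ^+ j * (y ^+ k - y' ^+ k)); last by ring.
apply: (@le_trans _ _ (cabs (x ^+ j - x' ^+ j) * d * cabs y ^+ k +
    cabs x' ^+ j * (cabs (y ^+ k - y' ^+ k) * d))).
  rewrite mulrAC mulrA -mulrDl ler_wpM2r//.
  by rewrite -!cabsX -!cabsM cabsD.
rewrite natrD exprD (_ : _ * h = (j%:R * d ^+ j * h) * d ^+ k + d ^+ j * (k%:R * d ^+ k * h)); last by ring.
apply: lerD; apply: ler_pM; rewrite ?mulr_ge0 ?exprn_ge0 ?cabs_ge0//.
- exact: expr_diff_le.
- exact: expr_le (cabs_ge0 _) yd.
- exact: expr_le (cabs_ge0 _) xd'.
- exact: expr_diff_le.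
Qed.

Definition quad2 c x y : C :=
  c 0%N 0%N + (c 1%N 0%N * x + c 0%N 1%N * y) +
  (c 2%N 0%N * x ^+ 2 + c 1%N 1%N * (x * y) + c 0%N 2%N * y ^+ 2).

Lemma quad2_psum2 c x y N : (3 <= N)%N -> psum2 c x y N - quad2 c x y =
  \sum_(j < N) \sum_(k < N) (if (j + k < 3)%N then 0 else c j k * (x ^+ j * y ^+ k)).
Proof.
move=> N3.
pose a j k : C := if (j + k < 3)%N then c j k * (x ^+ j * y ^+ k) else 0.
have -> : quad2 c x y = \sum_(j < N) \sum_(k < N) a j k.
  rewrite (@widen2 _ a 3 N)//; last first.
    move=> j k; rewrite /a; case: ifP => // jk.
    by rewrite (leq_ltn_trans (leq_addr _ _) jk) (leq_ltn_trans (leq_addl _ _) jk).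
  by rewrite !big_ord_recl !big_ord0 /a/= /bump/= /quad2; ring.
rewrite -sumrB; apply: eq_bigr => j _; rewrite -sumrB; apply: eq_bigr => k _.
by rewrite /a; case: ifP => _; rewrite ?subrr ?subr0.
Qed.

(** The terms of degree at least 3 have a Lipschitz constant of order [d ^+ 2] on the polydisc of
    radius [d]. Comparison with the origin gives the second-order jet; comparison of two nearby
    points gives derivatives away from the origin. *)
Lemma remainder2_lip g c rho M x y x' y' d h : power_series2 g c rho M ->
  0 < d -> d <= rho / 2 ->
  cabs x <= d -> cabs y <= d -> cabs x' <= d -> cabs y' <= d ->
  cabs (x - x') <= h -> cabs (y - y') <= h ->
  cabs (g x y - quad2 c x y - (g x' y' - quad2 c x' y')) <= 8 * M / rho ^+ 3 * d ^+ 2 * h.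
Proof.
move=> [rho0 cM gc] d0 dr xd yd xd' yd' xh yh; apply/ler_addgt0Pr => e e0.
have h0 : 0 <= h := le_trans (cabs_ge0 _) xh.
have drho : d <= rho by lra.
have e20 : 0 < e / 2 by rewrite divr_gt0.
have [N0 gN] := gc x y (le_trans xd drho) (le_trans yd drho) _ e20.
have [N1 gN'] := gc x' y' (le_trans xd' drho) (le_trans yd' drho) _ e20.
pose N := maxn (maxn N0 N1) 3.
have {}gN := gN N (leq_trans (leq_maxl _ _) (leq_maxl _ _)).
have {}gN' := gN' N (leq_trans (leq_maxr _ _) (leq_maxl _ _)).
have N3 : (3 <= N)%N := leq_maxr _ _.
pose P := psum2 c x y N - quad2 c x y; pose P' := psum2 c x' y' N - quad2 c x' y'.
have PP : cabs (P - P') <= 8 * M / rho ^+ 3 * d ^+ 2 * h.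
  rewrite -(ler_pM2r d0).
  rewrite (_ : 8 * M / rho ^+ 3 * d ^+ 2 * h * d = (2 * d / rho) ^+ 3 * M * h); last first.
    by field; rewrite gt_eqF.
  rewrite /P /P' !quad2_psum2// -sumrB.
  (* The factor [j + k] from the difference of monomials is absorbed by [2 ^+ (j + k)]; this turns
     [d] into [2 * d] and explains the constant 8. *)
  pose b j k : R := if (j + k < 3)%N then 0 else cabs (c j k) * ((j + k)%:R * d ^+ (j + k)).
  apply: (@le_trans _ _ ((\sum_(j < N) \sum_(k < N) b j k) * h)).
    rewrite mulr_suml; apply: (@le_trans _ _ (\sum_(j < N) \sum_(k < N) (cabs (
      (if (j + k < 3)%N then 0 else c j k * (x ^+ j * y ^+ k)) -
      (if (j + k < 3)%N then 0 else c j k * (x' ^+ j * y' ^+ k))) * d))).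
      under [leRHS]eq_bigr do rewrite -mulr_suml.
      rewrite -mulr_suml ler_wpM2r ?(ltW d0)//; apply: le_trans (cabs_sum _ _ _) _.
      apply: ler_sum => j _; rewrite -sumrB; exact: cabs_sum.
    apply: ler_sum => j _; rewrite mulr_suml; apply: ler_sum => k _; rewrite /b.
    case: ifP => _; first by rewrite subrr cabs0 !mul0r.
    rewrite -mulrBr cabsM -!mulrA ler_wpM2l ?cabs_ge0// mulrA.
    exact: monomial_diff_le.
  rewrite ler_wpM2r//; apply: (@sum2_tail_le c rho) => //.
  - rewrite divr_ge0 ?mulr_ge0 ?(ltW rho0) ?(ltW d0)//= ler_pdivrMr//.
    by move: dr; clear; lra.
  - by move=> j k jk; rewrite /b jk.
  - move=> j k jk; rewrite /b ltnNge jk/= ler_wpM2l ?cabs_ge0//.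
    rewrite [rho * _](_ : _ = 2 * d); last by field; rewrite gt_eqF.
    rewrite exprMn ler_wpM2r ?exprn_ge0 ?(ltW d0)//.
    by rewrite -natrX ler_nat ltnW// ltn_expl.
rewrite (_ : _ - _ = (P - P') + ((g x y - psum2 c x y N) - (g x' y' - psum2 c x' y' N))); last first.
  by rewrite /P /P'; ring.
apply: le_trans (cabsD _ _) _; apply: lerD => //.
by rewrite [e]splitr; apply: le_trans (cabsB _ _) (lerD gN gN').
Qed.

(** The definition controls the open polydisc of radius [r]; the absolute bound at the corner with
    both coordinates [r / 2] gives summability at that radius. *)
Lemma analytic_power_series (f : 'cV[C]_2 -> C) a : analytic_at f a ->
  exists c rho M, power_series2 (fun x y => f (vec2 x y + a)) c rho M.
Proof.
move=> [r [c [r0 fc]]]; exists c, (r / 2).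
have r20 : 0 < r / 2 by rewrite divr_gt0.
have rr : ((r / 2)%:C < r%:C :> R[i]) by rewrite ltcR; lra.
have [|[M cM] _] := fc (vec2 (r / 2)%:C (r / 2)%:C + a).
  rewrite addrK; apply: le_lt_trans rr; apply/vec2_norm_le; first exact: ltW.
  by rewrite cabs_real ger0_norm ?lexx// ltW.
exists M; split => //.
  move=> N; rewrite -lecR rmorph_sum; apply: le_trans (cM N); rewrite le_eqVlt.
  apply/orP; left; apply/eqP; apply: eq_bigr => j _; rewrite rmorph_sum.
  apply: eq_bigr => k _; rewrite addrK !mxE/= cabsE -exprD cabsM cabsX cabs_real.
  by rewrite ger0_norm ?ltW.
move=> x y xr yr e e0; have [|_] := fc (vec2 x y + a).
  by rewrite addrK; apply: le_lt_trans rr; apply/vec2_norm_le => //; exact: ltW.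
have e0' : 0 < e%:C :> R[i] by rewrite -[0]/(0%:C) ltcR.
move=> /cvgrPdist_le/(_ e%:C e0')[N0 _ fN]; exists N0 => N N0N.
have := fN N N0N; rewrite cabsE lecR addrK /pseries2 /psum2.
by rewrite !mxE/=.
Qed.

End DoublePowerSeries.

Section AnalyticDerivatives.
Variable R : realType.
Local Notation C := (Cplx R).
Implicit Types (c : nat -> nat -> C) (x y p q : C) (f : 'cV[C]_2 -> C) (a : 'cV[C]_2).

Lemma derive_eq_of_bound f a v (l : C) (K rho : R) : 0 < rho -> 0 <= K ->
  (forall h : C, cabs h <= rho ->
    cabs (f (h *: v + a) - f a - h * l) <= K * cabs h ^+ 2) ->
  'D_v f a = l.
Proof.
move=> rho0 K0 fK; rewrite /derive; apply: cvg_lim; first exact: norm_hausdorff.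
apply/cvgrPdist_le => /= e e0.
have [e1 e1E] : exists e1 : R, e = e1%:C.
  by case: e e0 => e1 e2; rewrite ltcE/= => /andP[/eqP-> _]; exists e1.
have e10 : 0 < e1 by move: e0; rewrite e1E ltcE/= => /andP[].
rewrite {}e1E {e0}.
pose d := Num.min rho (e1 / (K + 1)).
have d0 : 0 < d by rewrite lt_min rho0 divr_gt0// ltr_wpDl.
near=> h.
have h0 : h != 0 by near: h; exact: withinT.
have hd : cabs h <= d.
  rewrite -lecR -cabsE; apply: ltW; near: h.
  apply: (@dnbhs0_lt (complex R : numFieldType) (Cplx R : normedModType (complex R : numFieldType))).
  by rewrite ltcE/= eqxx.
move: hd; rewrite le_min => /andP[hrho he].
rewrite cabsE lecR cabsC -[_ *: _]/(h^-1 * _) /=.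
rewrite (_ : _ - l = h^-1 * (f (h *: v + a) - f a - h * l)); last first.
  by rewrite [RHS]mulrBr mulKf.
rewrite cabsM cabsV mulrC ler_pdivrMr ?lt_def ?cabs_ge0 ?cabs_eq0 ?h0//.
apply: le_trans (fK h hrho) _; rewrite expr2 mulrA ler_wpM2r ?cabs_ge0//.
move: he; rewrite ler_pdivlMr ?ltr_wpDl//; apply: le_trans.
by rewrite mulrDr mulr1 mulrC lerDl cabs_ge0.
Unshelve. all: by end_near. Qed.

Lemma vec2Z (h : C) p q : h *: vec2 p q = vec2 (h * p) (h * q).
Proof. by apply/colP => i; rewrite !mxE; case: ifP. Qed.

Lemma vec2D x y x' y' : vec2 x y + vec2 x' y' = vec2 (x + x') (y + y').
Proof. by apply/colP => i; rewrite !mxE; case: ifP. Qed.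

Lemma vec20 : vec2 0 0 = 0 :> 'cV[C]_2.
Proof. by apply/colP => i; rewrite !mxE; case: ifP. Qed.

(** One estimate for the increment of step [t] in direction [(p', q')] from the point displaced by
    [h] along [(p, q)]. Its main part is the gradient form plus [h] times the Hessian form. Of the
    errors, the first comes from the cubic remainder, the second from the quadratic form on
    [(p', q')]. First derivatives use [h = 0]; second derivatives let [t] tend to 0 at fixed [h]. *)
Lemma power_series_lip f a c rho M : power_series2 (fun x y => f (vec2 x y + a)) c rho M ->
  exists2 K, 0 <= K & forall p q p' q' h t : C,
    cabs p <= 1 -> cabs q <= 1 -> cabs p' <= 1 -> cabs q' <= 1 ->
    cabs h + cabs t <= rho / 2 ->
    cabs (f (t *: vec2 p' q' + (h *: vec2 p q + a)) - f (h *: vec2 p q + a) -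
      t * ((c 1%N 0%N * p' + c 0%N 1%N * q') +
       h * (2 * c 2%N 0%N * p * p' + c 1%N 1%N * (p * q' + q * p')
         + 2 * c 0%N 2%N * q * q')))
    <= K * (cabs h + cabs t) ^+ 2 * cabs t + K * cabs t ^+ 2.
Proof.
move=> ps; have [rho0 cM _] := ps.
have M0 : 0 <= M by have := cM 0%N; rewrite big_ord0.
pose Q p q := c 2%N 0%N * p ^+ 2 + c 1%N 1%N * (p * q) + c 0%N 2%N * q ^+ 2.
pose K0 := cabs (c 2%N 0%N) + cabs (c 1%N 1%N) + cabs (c 0%N 2%N).
pose K1 := 8 * M / rho ^+ 3.
have K00 : 0 <= K0 by rewrite !addr_ge0 ?cabs_ge0.
have K10 : 0 <= K1 by rewrite divr_ge0 ?(exprn_ge0 _ (ltW rho0))// mulr_ge0.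
have QK p q : cabs p <= 1 -> cabs q <= 1 -> cabs (Q p q) <= K0.
  move=> p1 q1; apply: le_trans (cabsD _ _) _; apply: lerD.
    apply: le_trans (cabsD _ _) _; apply: lerD; rewrite cabsM ler_piMr ?cabs_ge0//.
      by rewrite cabsX exprn_ile1 ?cabs_ge0.
    by rewrite cabsM mulr_ile1 ?cabs_ge0.
  by rewrite cabsM ler_piMr ?cabs_ge0// cabsX exprn_ile1 ?cabs_ge0.
exists (K0 + K1); first exact: addr_ge0.
move=> p q p' q' h t p1 q1 p1' q1' htr.
have [->|t0] := eqVneq t 0.
  by rewrite scale0r add0r subrr mul0r subrr cabs0 mulr0 expr0n mulr0 addr0.
have ct0 : 0 < cabs t by rewrite lt_def cabs_eq0 t0 cabs_ge0.
have d0 : 0 < cabs h + cabs t by rewrite ltr_wpDl ?cabs_ge0.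
have le1 (z w : C) : cabs w <= 1 -> cabs (z * w) <= cabs z.
  by move=> w1; rewrite cabsM ler_piMr ?cabs_ge0.
have hle (w : C) : cabs w <= 1 -> cabs (h * w) <= cabs h + cabs t.
  by move=> /(le1 h)/le_trans; apply; rewrite lerDl cabs_ge0.
have tle (w w' : C) : cabs w <= 1 -> cabs w' <= 1 ->
    cabs (t * w' + h * w) <= cabs h + cabs t.
  move=> w1 w1'; apply: le_trans (cabsD _ _) _; rewrite addrC.
  by apply: lerD; exact: le1.
have dle (w w' : C) : cabs w' <= 1 -> cabs (t * w' + h * w - h * w) <= cabs t.
  by rewrite addrK; exact: le1.
have := remainder2_lip ps d0 htr (tle _ _ p1 p1') (tle _ _ q1 q1') (hle _ p1)
  (hle _ q1) (dle p _ p1') (dle q _ q1').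
rewrite -!vec2D -!vec2Z -(addrA (t *: _)) => rem.
rewrite (_ : _ - _ = f (t *: vec2 p' q' + (h *: vec2 p q + a)) -
   quad2 c (t * p' + h * p) (t * q' + h * q) - (f (h *: vec2 p q + a) -
   quad2 c (h * p) (h * q)) + t ^+ 2 * Q p' q'); last by rewrite /Q /quad2; ring.
apply: le_trans (cabsD _ _) _; apply: lerD.
  apply: le_trans rem _; rewrite ler_wpM2r ?cabs_ge0// ler_wpM2r ?sqr_ge0//.
  by rewrite /K1 lerDr.
rewrite cabsM cabsX mulrC ler_wpM2r ?sqr_ge0//.
by apply: le_trans (QK _ _ p1' q1') _; rewrite lerDl.
Qed.

Lemma derive_power_series f a c rho M p q :
  power_series2 (fun x y => f (vec2 x y + a)) c rho M ->
  cabs p <= 1 -> cabs q <= 1 ->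
  'D_(vec2 p q) f a = c 1%N 0%N * p + c 0%N 1%N * q.
Proof.
move=> ps p1 q1; have [rho0 _ _] := ps; have [K K0 fK] := power_series_lip ps.
apply: (@derive_eq_of_bound _ _ _ _ (K * (rho / 2) + K) (rho / 2)).
- by rewrite divr_gt0.
- by rewrite addr_ge0 ?mulr_ge0 ?invr_ge0// ltW.
move=> h hr; have := fK 0 0 p q 0 h; rewrite cabs0 !add0r => /(_ ler01 ler01 p1 q1 hr).
rewrite scale0r add0r mul0r addr0 => /le_trans; apply.
by rewrite mulrDl lerD2r mulrAC ler_wpM2r ?sqr_ge0// ler_wpM2l.
Qed.

(** This is meant for displaced base points: the constants depend on [b] without control, which is
    harmless as [t] tends to 0 first. *)
Lemma analytic_derive f b p q : analytic_at f b -> cabs p <= 1 -> cabs q <= 1 ->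
  exists K rho : R, [/\ 0 <= K, 0 < rho & forall t, cabs t <= rho ->
    cabs (f (t *: vec2 p q + b) - f b - t * 'D_(vec2 p q) f b) <= K * cabs t ^+ 2].
Proof.
move=> /analytic_power_series[c [rho [M ps]]] p1 q1.
rewrite (derive_power_series ps p1 q1).
have [rho0 _ _] := ps; have [K K0 fK] := power_series_lip ps.
exists (K * (rho / 2) + K), (rho / 2); split.
- by rewrite addr_ge0 ?mulr_ge0 ?invr_ge0// ltW.
- by rewrite divr_gt0.
move=> h hr; have := fK 0 0 p q 0 h; rewrite cabs0 !add0r => /(_ ler01 ler01 p1 q1 hr).
rewrite scale0r add0r mul0r addr0 => /le_trans; apply.
by rewrite mulrDl lerD2r mulrAC ler_wpM2r ?sqr_ge0// ler_wpM2l.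
Qed.

(** The inner derivative [D] at a displaced point is known only through analyticity there. Two
    expansions of the same increment are compared: the one around that point, and [power_series_lip]
    around [a]. Dividing by the step and letting it tend to 0 leaves [K * cabs h ^+ 2] as the error
    of [D], as [derive_eq_of_bound] requires. *)
Lemma derive2_power_series f a c rho M tau p q p' q' :
  power_series2 (fun x y => f (vec2 x y + a)) c rho M -> 0 < tau ->
  cabs p <= 1 -> cabs q <= 1 -> cabs p' <= 1 -> cabs q' <= 1 ->
  (forall h, cabs h <= tau -> analytic_at f (h *: vec2 p q + a)) ->
  'D_(vec2 p q) ('D_(vec2 p' q') f) a =
  2 * c 2%N 0%N * p * p' + c 1%N 1%N * (p * q' + q * p') + 2 * c 0%N 2%N * q * q'.
Proof.
move=> ps tau0 p1 q1 p1' q1' fan; have [rho0 _ _] := ps.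
have [K K0 fK] := power_series_lip ps.
apply: (@derive_eq_of_bound _ _ _ _ K (Num.min tau (rho / 4))) => //.
  by rewrite lt_min tau0 divr_gt0.
move=> h; rewrite le_min => /andP[htau hrho].
rewrite (derive_power_series ps p1' q1').
set B := 2 * _ * p * p' + _ + _.
have [L [sig [L0 sig0 fL]]] := analytic_derive (fan h htau) p1' q1'.
set D := 'D_(vec2 p' q') f (h *: vec2 p q + a) in fL *.
set l := c 1%N 0%N * p' + c 0%N 1%N * q'.
pose N := L + K + K * (2 * cabs h + 1).
have N0 : 0 < N + 1.
  by rewrite ltr_wpDl// !addr_ge0// mulr_ge0// addr_ge0// mulr_ge0 ?cabs_ge0.
apply/ler_addgt0Pr => e e0.
(* The bound [rho / 4], shared with [h], keeps both displacements together within [rho / 2]; the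
   last bound makes the terms that vanish with [s] at most [e]. *)
pose s := Num.min (Num.min sig 1) (Num.min (rho / 4) (e / (N + 1))).
have s0 : 0 < s by rewrite !lt_min sig0 ltr01 !divr_gt0.
have := lexx s; rewrite {2}/s !le_min => /andP[/andP[ssig s1] /andP[srho se]].
have cs : cabs s%:C = s by rewrite cabs_real ger0_norm// ltW.
have hs : cabs h + cabs s%:C <= rho / 2 by rewrite cs; lra.
have := fK p q p' q' h s%:C p1 q1 p1' q1' hs; rewrite -/B -/l cs => h1.
have := fL s%:C; rewrite cs => /(_ ssig) h2.
rewrite -(ler_pM2r s0).
apply: (@le_trans _ _ (K * (cabs h + s) ^+ 2 * s + K * s ^+ 2 + L * s ^+ 2)).
  rewrite -{1}cs -cabsM.
  rewrite (_ : _ * s%:C = (f (s%:C *: vec2 p' q' + (h *: vec2 p q + a)) -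
      f (h *: vec2 p q + a) - s%:C * (l + h * B)) -
     (f (s%:C *: vec2 p' q' + (h *: vec2 p q + a)) - f (h *: vec2 p q + a) - s%:C * D));
    last by ring.
  by apply: le_trans (cabsB _ _) _; exact: lerD.
have -> : K * (cabs h + s) ^+ 2 * s + K * s ^+ 2 + L * s ^+ 2 =
  (K * cabs h ^+ 2 + s * (L + K + K * (2 * cabs h + s))) * s by ring.
rewrite ler_wpM2r ?(ltW s0)// lerD2l.
apply: (@le_trans _ _ (s * (N + 1))); last by rewrite -ler_pdivlMr.
rewrite ler_wpM2l ?(ltW s0)// /N -[leRHS]addrA lerD2l.
apply: (@le_trans _ _ (K * (2 * cabs h + 1))); last by rewrite lerDl.
by rewrite ler_wpM2l// lerD2l.
Qed.

Lemma delta_vec2 (k : 'I_2) :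
  delta_mx k 0 = vec2 (k == 0)%:R (k != 0)%:R :> 'cV[C]_2.
Proof.
apply/colP => l; rewrite !mxE andbT eq_sym; case: ifPn => [/eqP->//|l0].
by congr _%:R; case: k l l0 => -[|[|//]] ? [[|[|//]] ?].
Qed.

Lemma gradient_power_series f c rho M :
  power_series2 (fun x y => f (vec2 x y + 0)) c rho M ->
  gradient f 0 = vec2 (c 1%N 0%N) (c 0%N 1%N).
Proof.
move=> ps; apply/colP => i; rewrite !mxE.
rewrite delta_vec2.
have le1 (b : bool) : cabs (b%:R : C) <= 1 by case: b; rewrite ?cabs1 ?cabs0 ?ler01.
rewrite (derive_power_series ps)//; case: eqVneq => i0 /=; by ring.
Qed.

Lemma hessian_power_series f c rho M tau :
  power_series2 (fun x y => f (vec2 x y + 0)) c rho M -> 0 < tau ->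
  (forall s : 'cV[C]_2, `|s| <= tau%:C -> analytic_at f s) ->
  hessian f 0 = \matrix_(i, j) (if i == 0 then if j == 0 then 2 * c 2%N 0%N else c 1%N 1%N
     else if j == 0 then c 1%N 1%N else 2 * c 0%N 2%N).
Proof.
move=> ps tau0 fan; apply/matrixP => i j; rewrite !mxE.
have le1 (b : bool) : cabs (b%:R : C) <= 1 by case: b; rewrite ?cabs1 ?cabs0 ?ler01.
rewrite !delta_vec2 (derive2_power_series ps tau0)//; last first.
  move=> h hr; apply: fan; rewrite addr0 vec2Z vec2_norm_le ?(ltW tau0)//.
  by split; rewrite cabsM (le_trans _ hr)// ler_piMr ?cabs_ge0.
by case: (eqVneq i 0) => _; case: (eqVneq j 0) => _ /=; ring.
Qed.

(** On a complex line the square partial sums are polynomials in [z]; the factor 1/2 in the radius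
    is what [psum2_uniform] needs. *)
Lemma disc_approx_line f c rho M p q r : 0 <= r ->
  power_series2 (fun x y => f (vec2 x y + 0)) c rho M ->
  r * cabs p <= rho / 2 -> r * cabs q <= rho / 2 ->
  disc_approx r (fun z => f (z *: vec2 p q)).
Proof.
move=> r0 ps pr qr e e0.
have [N Ne] : exists N, M / 2 ^+ N <= e.
  have half : `|2^-1 : R| < 1 by rewrite ger0_norm ?invr_ge0// invf_lt1 ?ltr1n.
  have /cvgrPdist_le/(_ _ e0)[N _ /(_ N (leqnn N))] := @cvg_geometric R M 2^-1 half.
  by rewrite sub0r normrN /geometric/= exprVn => /(le_trans (ler_norm _)); exists N.
exists (\sum_(j < N) \sum_(k < N) (c j k * (p ^+ j * q ^+ k)) *: 'X^(j + k)) => z zr.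
have zp : cabs (z * p) <= rho / 2.
  by rewrite cabsM (le_trans _ pr)// ler_wpM2r ?cabs_ge0.
have zq : cabs (z * q) <= rho / 2.
  by rewrite cabsM (le_trans _ qr)// ler_wpM2r ?cabs_ge0.
have := psum2_uniform N ps zp zq; rewrite addr0 -vec2Z => /le_trans/(_ Ne).
rewrite /psum2 horner_sum; congr (cabs (_ - _) <= _); apply: eq_bigr => j _.
rewrite horner_sum; apply: eq_bigr => k _; rewrite hornerZ hornerXn !exprMn exprD.
by ring.
Qed.

Lemma jet2_line f c rho M p q :
  power_series2 (fun x y => f (vec2 x y + 0)) c rho M ->
  jet2 (fun z => f (z *: vec2 p q)) (f 0) (c 1%N 0%N * p + c 0%N 1%N * q)
    (c 2%N 0%N * p ^+ 2 + c 1%N 1%N * (p * q) + c 0%N 2%N * q ^+ 2).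
Proof.
move=> ps; have [rho0 cM _] := ps.
have M0 : 0 <= M by have := cM 0%N; rewrite big_ord0.
(* The summand 1 keeps [m] positive when the direction is zero. *)
pose m := cabs p + cabs q + 1.
have m0 : 0 < m by rewrite ltr_wpDl ?addr_ge0 ?cabs_ge0.
exists (8 * M / rho ^+ 3 * m ^+ 3), (rho / 2 / m); split.
- rewrite mulr_ge0 ?(exprn_ge0 _ (ltW m0))//.
  by rewrite divr_ge0 ?(exprn_ge0 _ (ltW rho0))// mulr_ge0.
- by rewrite !divr_gt0.
move=> z zr.
have [->|z0] := eqVneq z 0.
  by rewrite scale0r (expr0n _ 2) cabs0 (expr0n _ 3) !mulr0 !addr0 subrr cabs0.
have cz0 : 0 < cabs z by rewrite lt_def cabs_eq0 z0 cabs_ge0.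
pose d := cabs z * m; have d0 : 0 < d by rewrite mulr_gt0.
have pd : cabs (z * p) <= d.
  rewrite cabsM ler_wpM2l ?cabs_ge0// /m -addrA lerDl.
  by rewrite addr_ge0 ?cabs_ge0.
have qd : cabs (z * q) <= d.
  rewrite cabsM ler_wpM2l ?cabs_ge0// /m addrAC lerDr.
  by rewrite addr_ge0 ?cabs_ge0.
have dr : d <= rho / 2 by rewrite -ler_pdivlMr.
have z00 : cabs 0 <= d by rewrite cabs0 ltW.
have := remainder2_lip (h := d) ps d0 dr pd qd z00 z00.
rewrite !subr0 => /(_ pd qd); rewrite vec20 !addr0 -vec2Z.
rewrite (_ : 8 * M / rho ^+ 3 * d ^+ 2 * d = 8 * M / rho ^+ 3 * m ^+ 3 * cabs z ^+ 3); last first.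
  by rewrite /d; ring.
have f0 : f 0 = c 0%N 0%N.
  have [_ _ /(_ 0 0)] := ps; rewrite vec20 addr0 cabs0 => /(_ (ltW rho0) (ltW rho0)) fN.
  apply/eqP; rewrite -subr_eq0 -cabs_eq0 eq_le cabs_ge0 andbT.
  apply/ler_addgt0Pr => e e0; have [N /(_ N.+1 (leqnSn N))] := fN e e0.
  rewrite add0r /psum2 big_ord_recl big_ord_recl/= !expr0 !mulr1.
  rewrite [X in _ + X + _]big1 ?addr0; last by move=> i _; rewrite expr0n !mulr0.
  rewrite big1 ?addr0// => i _.
  by rewrite big1// => j _; rewrite expr0n mul0r mulr0.
by congr (cabs _ <= _); rewrite /quad2 f0; ring.
Qed.

End AnalyticDerivatives.

(** * Expectations and exponential moments *)

Section RealExpectation.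
Context (R : realType) (d : measure_display) (T : measurableType d)
  (P : probability T R).
Implicit Types (f g : T -> R).

Definition integrableR f := P.-integrable [set: T] (EFin \o f).

(** The value is 0 when the integral is infinite, which is why the algebraic rules carry
    integrability assumptions. *)
Definition meanR f : R := (\int[P]_x f x)%R.

Lemma meanRE f : fine 'E_P[f]%E = meanR f.
Proof. by rewrite unlock. Qed.

Lemma expectationE f : integrableR f -> 'E_P[f]%E = (meanR f)%:E.
Proof.
by move=> fi; rewrite -meanRE fineK// unlock integrable_fin_num.
Qed.

Lemma eq_integrableR f g : f =1 g -> integrableR f -> integrableR g.
Proof. by move=> /funext->. Qed.

Lemma eq_meanR f g : f =1 g -> meanR f = meanR g.
Proof. by move=> /funext->. Qed.

Lemma integrableRD f g : integrableR f -> integrableR g ->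
  integrableR (fun x => f x + g x).
Proof. by move=> fi gi; apply: eq_integrable (integrableD _ fi gi). Qed.

Lemma integrableRZ (k : R) f : integrableR f -> integrableR (fun x => k * f x).
Proof. by move=> fi; apply: eq_integrable (integrableZl _ k fi). Qed.

Lemma integrableR_cst (k : R) : integrableR (fun=> k).
Proof. exact: finite_measure_integrable_cst. Qed.

Lemma le_integrableR f g : measurable_fun setT f -> (forall x, `|f x| <= g x) ->
  integrableR g -> integrableR f.
Proof.
move=> mf fg gi; apply: le_integrable gi => //; first exact/measurable_EFinP.
by move=> x _; rewrite lee_fin (le_trans (fg x))// ler_norm.
Qed.

Lemma integrableR_norm f : integrableR f -> integrableR (fun x => `|f x|).
Proof.
by move=> fi; exact: integrable_norm.
Qed.

Lemma meanRD f g : integrableR f -> integrableR g ->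
  meanR (fun x => f x + g x) = meanR f + meanR g.
Proof. by move=> fi gi; rewrite /meanR RintegralD. Qed.

Lemma meanRZ (k : R) f : integrableR f -> meanR (fun x => k * f x) = k * meanR f.
Proof. by move=> fi; rewrite /meanR RintegralZl. Qed.

Lemma meanR_cst (k : R) : meanR (fun=> k) = k.
Proof. by rewrite -meanRE (expectation_cst P k). Qed.

Lemma le_meanR f g : integrableR f -> integrableR g -> (forall x, f x <= g x) ->
  meanR f <= meanR g.
Proof. by move=> fi gi fg; apply: le_Rintegral. Qed.

Lemma meanR_ge0 f : (forall x, 0 <= f x) -> 0 <= meanR f.
Proof. by move=> f0; apply: Rintegral_ge0. Qed.

Lemma normr_meanR_le f g : integrableR f -> integrableR g ->
  (forall x, `|f x| <= g x) -> `|meanR f| <= meanR g.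
Proof.
move=> fi gi fg; apply: le_trans (le_normr_Rintegral _ fi) _ => //.
by apply: le_meanR => //; exact: integrableR_norm.
Qed.

End RealExpectation.

Section ComplexExpectation.
Context (R : realType) (d : measure_display) (T : measurableType d)
  (P : probability T R).
Local Notation C := (Cplx R).
Implicit Types (Z W : T -> C).

Lemma expectationCE Z : expectationC P Z =
  (meanR P (fun w => complex.Re (Z w)))%:C + 'i * (meanR P (fun w => complex.Im (Z w)))%:C.
Proof. by rewrite /expectationC !meanRE [LHS]complexE. Qed.

Lemma eq_expectationC Z W : Z =1 W -> expectationC P Z = expectationC P W.
Proof. by move=> /funext->. Qed.

Lemma integrableCD Z W : integrableC P Z -> integrableC P W ->
  integrableC P (fun w => Z w + W w).
Proof.
move=> [Zr Zi] [Wr Wi]; split.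
- by apply: eq_integrableR (integrableRD Zr Wr) => x; rewrite ReD.
- by apply: eq_integrableR (integrableRD Zi Wi) => x; rewrite ImD.
Qed.

Lemma expectationCD Z W : integrableC P Z -> integrableC P W ->
  expectationC P (fun w => Z w + W w) = expectationC P Z + expectationC P W.
Proof.
move=> [Zr Zi] [Wr Wi]; rewrite !expectationCE.
rewrite (eq_meanR _ (fun x => ReD (Z x) (W x))) (eq_meanR _ (fun x => ImD (Z x) (W x))).
by rewrite !meanRD// !rmorphD/=; ring.
Qed.

Lemma integrableCZ (c : C) Z : integrableC P Z -> integrableC P (fun w => c * Z w).
Proof.
move=> [Zr Zi]; split.
- apply: eq_integrableR (integrableRD (integrableRZ (complex.Re c) Zr)
    (integrableRZ (- complex.Im c) Zi)) => x.
  by case: c (Z x) => [a b] [e f]/=; ring.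
- apply: eq_integrableR (integrableRD (integrableRZ (complex.Im c) Zr)
    (integrableRZ (complex.Re c) Zi)) => x.
  by case: c (Z x) => [a b] [e f]/=; ring.
Qed.

Lemma expectationCZ (c : C) Z : integrableC P Z ->
  expectationC P (fun w => c * Z w) = c * expectationC P Z.
Proof.
move=> [Zr Zi]; rewrite !expectationCE.
have -> : meanR P (fun w => complex.Re (c * Z w)) =
   complex.Re c * meanR P (fun w => complex.Re (Z w)) +
   - complex.Im c * meanR P (fun w => complex.Im (Z w)).
  rewrite -!meanRZ// -meanRD; [|exact: integrableRZ..].
  by apply: eq_meanR => x; case: c (Z x) => [a b] [e f]/=; ring.
have -> : meanR P (fun w => complex.Im (c * Z w)) =
   complex.Im c * meanR P (fun w => complex.Re (Z w)) +
   complex.Re c * meanR P (fun w => complex.Im (Z w)).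
  rewrite -!meanRZ// -meanRD; [|exact: integrableRZ..].
  by apply: eq_meanR => x; case: c (Z x) => [a b] [e f]/=; ring.
rewrite [in RHS](complexE c).
set a := complex.Re c; set b := complex.Im c; set x := meanR _ _; set y := meanR _ _.
by apply/eqP; rewrite eq_complex/=; apply/andP; split; apply/eqP; ring.
Qed.

Lemma integrableC_real (f : T -> R) : integrableR P f ->
  integrableC P (fun w => (f w)%:C).
Proof. by move=> fi; split => //; exact: integrableR_cst. Qed.

Lemma expectationC_real (f : T -> R) : expectationC P (fun w => (f w)%:C) = (meanR P f)%:C.
Proof. by rewrite expectationCE/= meanR_cst mulr0 addr0. Qed.

Lemma expectationC_sum n (F : 'I_n -> T -> C) : (forall i, integrableC P (F i)) ->
  integrableC P (fun x => \sum_i F i x) /\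
  expectationC P (fun x => \sum_i F i x) = \sum_i expectationC P (F i).
Proof.
move=> Fi; elim: n F Fi => [|n IH] F Fi.
  rewrite (_ : (fun x => \sum_i F i x) = fun=> 0%:C); last first.
    by apply/funext => x; rewrite big_ord0.
  rewrite big_ord0 expectationC_real meanR_cst; split => //.
  exact/integrableC_real/integrableR_cst.
have [IH1 IH2] := IH _ (fun i => Fi (lift ord0 i)).
rewrite (_ : (fun x => \sum_i F i x) = fun x => F ord0 x + \sum_(i < n) F (lift ord0 i) x); last first.
  by apply/funext => x; rewrite big_ord_recl.
by split; [exact: integrableCD | rewrite expectationCD// big_ord_recl IH2].
Qed.

(** Real and imaginary parts are estimated separately, hence the factor 2. *)
Lemma cabs_expectationC_le Z (g : T -> R) : integrableC P Z -> integrableR P g ->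
  (forall w, cabs (Z w) <= g w) -> cabs (expectationC P Z) <= 2 * meanR P g.
Proof.
move=> [Zr Zi] gi Zg; apply: le_trans (cabs_le _) _; rewrite mulr2n mulrDl !mul1r.
rewrite /expectationC/= !meanRE; apply: lerD; apply: normr_meanR_le => // w.
- exact: le_trans (Re_le_cabs _) _.
- exact: le_trans (Im_le_cabs _) _.
Qed.

Lemma expectationC_dist Z W (g : T -> R) : integrableC P Z -> integrableC P W ->
  integrableR P g -> (forall w, cabs (Z w - W w) <= g w) ->
  cabs (expectationC P Z - expectationC P W) <= 2 * meanR P g.
Proof.
move=> Zi Wi gi ZW; have mWi := integrableCZ (-1) Wi.
have -> : expectationC P Z - expectationC P W = expectationC P (fun w => Z w + -1 * W w).
  by rewrite expectationCD// expectationCZ// mulN1r.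
apply: cabs_expectationC_le => //; first exact: integrableCD.
by move=> w; rewrite mulN1r.
Qed.

End ComplexExpectation.

(** * Power expansions in one variable and their uniqueness *)

Section PowerExpansion.
Variable R : realType.
Local Notation C := (Cplx R).
Implicit Types (f g : C -> C) (a b : nat -> C) (r A B : R).

(** A single geometric remainder bound for all orders at once. It provides polynomial approximation
    on the half disc, the jet at 0, and an identity theorem, with no convergence theory for
    series. *)
Definition expands f a r A := [/\ 0 < r, 0 <= A & forall K z, cabs z <= r ->
  cabs (f z - \sum_(k < K) a k * z ^+ k) <= A * (cabs z / r) ^+ K].

Lemma expands_disc_approx f a r A : expands f a r A -> disc_approx (r / 2) f.
Proof.
move=> [r0 A0 fa] e e0.
have half : `|2^-1 : R| < 1 by rewrite ger0_norm ?invr_ge0// invf_lt1 ?ltr1n.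
have /cvgrPdist_le/(_ _ e0)[N _ /(_ N (leqnn N))] := @cvg_geometric R A 2^-1 half.
rewrite sub0r normrN /geometric/= => /(le_trans (ler_norm _)) Ne.
exists (\poly_(k < N) a k) => z zr; rewrite horner_poly.
have zr' : cabs z <= r by apply: le_trans zr _; rewrite ler_pdivrMr// ler_peMr ?ler1n// ltW.
apply: le_trans (fa N z zr') (le_trans _ Ne); rewrite ler_wpM2l// expr_le//.
  by rewrite divr_ge0 ?cabs_ge0// ltW.
by rewrite ler_pdivrMr// mulrC.
Qed.

Lemma expands_jet2 f a r A : expands f a r A -> jet2 f (a 0%N) (a 1%N) (a 2%N).
Proof.
move=> [r0 A0 fa]; exists (A / r ^+ 3), r; split => //.
  by rewrite divr_ge0// exprn_ge0// ltW.
move=> z zr; have := fa 3%N z zr; rewrite !big_ord_recl big_ord0/= /bump/=.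
rewrite (_ : _ + (_ + _) = a 0%N + a 1%N * z + a 2%N * z ^+ 2); last by ring.
move=> /le_trans; apply; rewrite expr_div_n mulrCA mulrC mulrA [leLHS]mulrC.
by rewrite mulrC mulrA.
Qed.

(** Agreement on the real axis determines the coefficients, and the coefficients determine the
    function on the half disc. This is the analytic continuation from real to imaginary
    arguments. *)
Lemma expands_inj f g a b r A B : expands f a r A -> expands g b r B ->
  (forall t : R, f t%:C = g t%:C) -> forall z, cabs z <= r / 2 -> f z = g z.
Proof.
move=> [r0 A0 fa] [_ B0 gb] fg.
have ab k : a k = b k.
  have [n] := ubnP k; elim: n k => // n IH k; rewrite ltnS => kn.
  apply/eqP; rewrite -subr_eq0 -cabs_eq0 eq_le cabs_ge0 andbT.
  apply/ler_addgt0Pr => e e0; rewrite add0r.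
  (* Lower coefficients agree, so at a small real [t] the two expansions of order [k.+1] differ by
     [(a k - b k) * t ^+ k], which is bounded by a multiple of [t ^+ k.+1]; [M] exceeds that
     multiple. *)
  pose M := (A + B) / r ^+ k.+1 + 1.
  have M0 : 0 < M by rewrite ltr_wpDl// divr_ge0 ?addr_ge0// exprn_ge0// ltW.
  pose t := Num.min r (e / M).
  have t0 : 0 < t by rewrite lt_min r0 divr_gt0.
  have := lexx t; rewrite {2}/t le_min => /andP[tr te].
  have ct : cabs t%:C = t by rewrite cabs_real ger0_norm// ltW.
  have := fa k.+1 t%:C; have := gb k.+1 t%:C; rewrite ct => /(_ tr) h1 /(_ tr) h2.
  have : cabs (a k - b k) * t ^+ k <= (A + B) * (t / r) ^+ k.+1.
    rewrite -{1}ct -cabsX -cabsM [leRHS]mulrDl.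
    have -> : (a k - b k) * t%:C ^+ k = (g t%:C - \sum_(i < k.+1) b i * t%:C ^+ i) -
        (f t%:C - \sum_(i < k.+1) a i * t%:C ^+ i).
      rewrite fg !big_ord_recr/= (eq_bigr (fun i : 'I_k => a i * t%:C ^+ i)); last first.
        by move=> i _; rewrite IH// (leq_trans (ltn_ord i)).
      by ring.
    by apply: le_trans (cabsB _ _) _; rewrite addrC; exact: lerD.
  rewrite (_ : _ * (t / r) ^+ k.+1 = (A + B) / r ^+ k.+1 * t * t ^+ k); last first.
    by rewrite expr_div_n (exprS t); ring.
  rewrite ler_pM2r ?exprn_gt0// => /le_trans; apply.
  apply: le_trans (_ : t * M <= _); last by rewrite -ler_pdivlMr.
  by rewrite mulrC ler_wpM2l ?(ltW t0)// lerDl.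
move=> z zr; apply/eqP; rewrite -subr_eq0 -cabs_eq0 eq_le cabs_ge0 andbT.
have zr' : cabs z <= r by apply: le_trans zr _; rewrite ler_pdivrMr// ler_peMr ?ler1n// ltW.
apply/ler_addgt0Pr => e e0; rewrite add0r.
have half : `|2^-1 : R| < 1 by rewrite ger0_norm ?invr_ge0// invf_lt1 ?ltr1n.
have /cvgrPdist_le/(_ _ e0)[N _ /(_ N (leqnn N))] := @cvg_geometric R (A + B) 2^-1 half.
rewrite sub0r normrN /geometric/= => /(le_trans (ler_norm _)); apply: le_trans.
apply: (@le_trans _ _ ((A + B) * (cabs z / r) ^+ N)); last first.
  rewrite ler_wpM2l ?addr_ge0// expr_le ?divr_ge0 ?cabs_ge0 ?(ltW r0)//.
  by rewrite ler_pdivrMr// mulrC.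
have := fa N z zr'; have := gb N z zr'.
rewrite (eq_bigr (fun i : 'I_N => a i * z ^+ i)) => [h1 h2|i _]; last by rewrite ab.
rewrite (_ : f z - g z = (f z - \sum_(i < N) a i * z ^+ i) - (g z - \sum_(i < N) a i * z ^+ i)); last by ring.
by apply: le_trans (cabsB _ _) _; rewrite mulrDl; exact: lerD.
Qed.

End PowerExpansion.

Section ExponentialMoments.
Context (R : realType) (d : measure_display) (T : measurableType d)
  (P : probability T R).
Local Notation C := (Cplx R).
Implicit Types (X : T -> R) (z : C) (r : R).

Lemma expr_fact_le_expR (x : R) n : 0 <= x -> x ^+ n / n`!%:R <= expR x.
Proof.
case: n => [|n] x0; first by rewrite expr0 fact0 divr1 -[leLHS]expR0 ler_expR.
by have := expR_ge1Dxn n x0; lra.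
Qed.

Lemma measurable_Re_cexp X z : measurable_fun setT X ->
  measurable_fun setT (fun w => complex.Re (cexp (z * (X w)%:C))).
Proof.
move=> mX; case: z => a b.
rewrite (_ : (fun w => _) = fun w => expR (a * X w) * cos (b * X w)); last first.
  by apply/funext => w; rewrite /cexp/= !(mulr0, mul0r, subr0, addr0, add0r).
apply: measurable_funM; apply: measurableT_comp => //; try exact: measurable_funM.
by apply: continuous_measurable_fun; exact: continuous_cos.
Qed.

Lemma measurable_Im_cexp X z : measurable_fun setT X ->
  measurable_fun setT (fun w => complex.Im (cexp (z * (X w)%:C))).
Proof.
move=> mX; case: z => a b.
rewrite (_ : (fun w => _) = fun w => expR (a * X w) * sin (b * X w)); last first.
  by apply/funext => w; rewrite /cexp/= !(mulr0, mul0r, subr0, addr0, add0r).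
apply: measurable_funM; apply: measurableT_comp => //; try exact: measurable_funM.
by apply: continuous_measurable_fun; exact: continuous_sin.
Qed.

Lemma integrableC_cexp X z (g : T -> R) : measurable_fun setT X -> integrableR P g ->
  (forall w, expR (cabs z * `|X w|) <= g w) -> integrableC P (fun w => cexp (z * (X w)%:C)).
Proof.
move=> mX gi zg.
have le w : cabs (cexp (z * (X w)%:C)) <= g w.
  by apply: le_trans (cabs_cexp_le _) _; rewrite cabsM cabs_real.
split; apply: le_integrableR gi.
- exact: measurable_Re_cexp.
- by move=> w; apply: le_trans (Re_le_cabs _) (le w).
- exact: measurable_Im_cexp.
- by move=> w; apply: le_trans (Im_le_cabs _) (le w).
Qed.

Lemma integrableR_pow X r k : measurable_fun setT X -> 0 < r ->
  integrableR P (fun w => expR (r * `|X w|)) -> integrableR P (fun w => X w ^+ k).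
Proof.
move=> mX r0 Xi.
have rk0 : 0 < r ^+ k by rewrite exprn_gt0.
have fk0 : (0 : R) < k`!%:R by rewrite ltr0n fact_gt0.
apply: le_integrableR (integrableRZ (k`!%:R / r ^+ k) Xi).
  exact: measurable_funX.
move=> w; rewrite normrX.
have := expr_fact_le_expR k (mulr_ge0 (ltW r0) (normr_ge0 (X w))).
rewrite exprMn -(ler_pM2l (divr_gt0 fk0 rk0)); apply: le_trans.
rewrite le_eqVlt; apply/orP; left; apply/eqP.
by field; rewrite !gt_eqF.
Qed.

(** In the Taylor remainder of [cexp], write the modulus of [z X] as [cabs z / r] times [r] times
    the modulus of [X]. The power of the latter over the factorial is at most one factor [expR], the
    remainder contributes a second one; hence the moment with [2 * r]. The outer 2 stems from
    [expectationC_dist]. *)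
Lemma mgf_expansion X r : measurable_fun setT X -> 0 < r ->
  integrableR P (fun w => expR (2 * r * `|X w|)) ->
  expands (fun z => expectationC P (fun w => cexp (z * (X w)%:C)))
    (fun k => (meanR P (fun w => X w ^+ k) / k`!%:R)%:C) r
    (2 * meanR P (fun w => expR (2 * r * `|X w|))).
Proof.
move=> mX r0 Xi; have r20 : 0 < 2 * r by rewrite mulr_gt0.
have Xk k := integrableR_pow k mX r20 Xi.
split => //.
  by rewrite mulr_ge0// meanR_ge0// => w; exact: expR_ge0.
move=> K z zr.
pose F (k : 'I_K) w : C := z ^+ k / k`!%:R * (X w ^+ k)%:C.
have Fi k : integrableC P (F k) by exact/integrableCZ/integrableC_real.
have [Si SE] := expectationC_sum Fi.
have -> : \sum_(k < K) (meanR P (fun w => X w ^+ k) / k`!%:R)%:C * z ^+ k =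
    expectationC P (fun x => \sum_i F i x).
  rewrite SE; apply: eq_bigr => k _; rewrite expectationCZ; last exact: integrableC_real.
  by rewrite expectationC_real rmorphM fmorphV rmorph_nat; ring.
have zr0 : 0 <= cabs z / r by rewrite divr_ge0 ?cabs_ge0// ltW.
rewrite mulrAC -mulrA -meanRZ//.
apply: expectationC_dist => //.
- apply: integrableC_cexp Xi _ => // w; rewrite ler_expR ler_wpM2r//.
  by apply: le_trans zr _; rewrite ler_peMl ?ler1n// ltW.
- exact: integrableRZ.
- move=> w; have := cexp_taylor K (z * (X w)%:C); rewrite exp_polyE.
  rewrite (eq_bigr (fun k => F k w)); last first.
    by move=> k _; rewrite /F exprMn rmorphXn; ring.
  move=> /le_trans; apply; rewrite cabsM cabs_real.
  have rX0 : 0 <= r * `|X w| by rewrite mulr_ge0// ltW.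
  rewrite (_ : expR (2 * r * `|X w|) = expR (r * `|X w|) * expR (r * `|X w|)); last first.
    by rewrite -expRD; congr expR; ring.
  rewrite (_ : cabs z * `|X w| = (cabs z / r) * (r * `|X w|)); last first.
    by field; rewrite gt_eqF.
  rewrite exprMn -!mulrA ler_wpM2l ?exprn_ge0// mulrA.
  apply: ler_pM; rewrite ?expR_ge0//.
  + by rewrite mulr_ge0 ?exprn_ge0 ?invr_ge0.
  + exact: expr_fact_le_expR.
  + by rewrite ler_expR mulrA ler_piMl// ler_pdivrMr// mul1r.
Qed.

(** Truncation at order [K] in [z] is truncation of the exponential series after [uphalf K] terms.
    With [v = q / 2 * r ^+ 2] both the power over the factorial and the exponential are at most
    [expR v], so the constant is the exponential of [2 v]. *)
Lemma expands_gauss (q r : R) : 0 <= q -> 0 < r ->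
  expands (fun z : C => cexp ((q / 2)%:C * z ^+ 2))
    (fun k => if odd k then 0 else ((q / 2) ^+ k./2 / (k./2)`!%:R)%:C) r
    (expR (q * r ^+ 2)).
Proof.
move=> q0 r0; split; rewrite ?expR_ge0// => K z zr.
pose w := (q / 2)%:C * z ^+ 2; pose m := uphalf K.
pose b (k : nat) : C := if odd k then 0 else ((q / 2) ^+ k./2 / (k./2)`!%:R)%:C.
rewrite -[X in _ - X]/(\sum_(k < K) b k * z ^+ k).
have zr0 : 0 <= cabs z / r by rewrite divr_ge0 ?cabs_ge0// ltW.
have zr1 : cabs z / r <= 1 by rewrite ler_pdivrMr// mul1r.
have -> : \sum_(k < K) b k * z ^+ k = (exp_poly R m).[w].
  have sumE n : \sum_(k < n.*2) b k * z ^+ k = (exp_poly R n).[w] /\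
     \sum_(k < n.*2.+1) b k * z ^+ k = (exp_poly R n.+1).[w].
    elim: n => [|n [IH1 IH2]].
      rewrite !exp_polyE !big_ord_recl !big_ord0 /b/= !expr0 !fact0 !divr1.
      by rewrite !mulr1 !addr0.
    have e1 : \sum_(k < n.+1.*2) b k * z ^+ k = (exp_poly R n.+1).[w].
      by rewrite doubleS big_ord_recr/= IH2 /b/= odd_double/= mul0r addr0.
    split => //; rewrite big_ord_recr/= e1 [RHS]exp_polyE big_ord_recr/= -exp_polyE.
    have -> : w ^+ n.+1 = (q / 2)%:C ^+ n.+1 * z ^+ n.+1.*2.
      by rewrite /w [LHS]exprMn -exprM mul2n.
    congr (_ + _); rewrite /b odd_double doubleK.
    by rewrite rmorphM fmorphV rmorphXn rmorph_nat/=; ring.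
  have [s1 s2] := sumE K./2; rewrite /m uphalf_half.
  have := odd_double_half K; case: (odd K) => /= KE; rewrite ?add1n ?add0n in KE *.
    by rewrite -s2 KE.
  by rewrite -s1 KE.
apply: le_trans (cexp_taylor _ _) _.
pose v := q / 2 * r ^+ 2; have v0 : 0 <= v by rewrite mulr_ge0 ?divr_ge0 ?sqr_ge0.
have wE : cabs w = (cabs z / r) ^+ 2 * v.
  rewrite /w cabsM cabsX cabs_real ger0_norm ?divr_ge0// /v.
  by field; rewrite gt_eqF.
rewrite wE; move: (cabs z / r) zr0 zr1 => y zr0 zr1.
rewrite exprMn -exprM mulrC -!mulrA.
rewrite (_ : q * r ^+ 2 = v + v); last by rewrite /v; field.
rewrite expRD; apply: (@le_trans _ _ (expR v * (v ^+ m / m`!%:R * y ^+ K))).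
  apply: ler_pM; rewrite ?expR_ge0 ?mulr_ge0 ?exprn_ge0 ?invr_ge0//.
    by rewrite ler_expR mulrA ler_piMl// mulr_ile1.
  rewrite mulrC ler_wpM2l ?mulr_ge0 ?exprn_ge0 ?invr_ge0//.
  rewrite ler_wiXn2l// /m mul2n; have := odd_double_half K.
  by rewrite uphalf_half doubleD => {1}<-; rewrite leq_add2r; case: odd.
rewrite -[leRHS]mulrA ler_wpM2l ?expR_ge0// ler_wpM2r ?exprn_ge0//.
exact: expr_fact_le_expR.
Qed.

(** The expansions of both sides have the same values at real points, so [expands_inj] applies; the
    radius [r] is chosen afterwards for the given [z]. *)
Lemma gauss_cmgf X (q : R) : measurable_fun setT X -> 0 <= q ->
  (forall t : R, integrableR P (fun w => expR (t * X w))) ->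
  (forall t : R, meanR P (fun w => expR (t * X w)) = expR (q * t ^+ 2 / 2)) ->
  forall z : C, expectationC P (fun w => cexp (z * (X w)%:C)) = cexp ((q / 2)%:C * z ^+ 2).
Proof.
move=> mX q0 Xi XE z.
pose r := 2 * cabs z + 1.
have r0 : 0 < r by rewrite ltr_wpDl// mulr_ge0 ?cabs_ge0.
have abs_i t : 0 <= t -> integrableR P (fun w => expR (t * `|X w|)).
  move=> t0; apply: le_integrableR (integrableRD (Xi t) (Xi (- t))).
    by apply: measurableT_comp => //; apply: measurable_funM => //; exact: measurableT_comp.
  move=> w; rewrite ger0_norm ?expR_ge0//.
  case: (ger0P (X w)) => _; rewrite ?mulrN ?mulNr.
    by rewrite lerDl expR_ge0.
  by rewrite lerDr expR_ge0.
have := expands_inj (mgf_expansion mX r0 (abs_i (2 * r) _)) (expands_gauss q0 r0).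
apply.
- by rewrite mulr_ge0// ltW.
- move=> t; rewrite (eq_expectationC P (W := fun w => (expR (t * X w))%:C)); last first.
    by move=> w; rewrite -rmorphM cexp_real.
  rewrite expectationC_real XE -rmorphXn -rmorphM cexp_real; congr (expR _)%:C.
  by rewrite mulrAC.
- by rewrite /r; lra.
Qed.

End ExponentialMoments.

(** * Quasi-powers in one dimension *)

Section QuasiPowers.
Variable R : realType.
Local Notation C := (Cplx R).

Section MomentEstimates.
Context (d : measure_display) (T : measurableType d) (P : probability T R).
Variables (X : T -> R) (r eps phi : R) (U V err : C -> C).
Hypotheses (mX : measurable_fun setT X) (r0 : 0 < r)
  (Xi : integrableR P (fun w => expR (4 * r * `|X w|)))
  (ME : forall z, cabs z <= r -> expectationC P (fun w => cexp (z * (X w)%:C)) =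
    cexp (phi%:C * U z + V z) * (1 + err z))
  (errE : forall z, cabs z <= r -> cabs (err z) <= eps).

(** The first coefficient of [D] is exactly the error of the mean. The second is half the error of
    the variance up to half the square of the first, which accounts for the term
    [(eps / r) ^+ 2]. *)
Lemma quasi_power_moments (u1 u2 v1 v2 : C) :
  disc_approx r U -> disc_approx r V -> jet2 U 0 u1 u2 -> jet2 V 0 v1 v2 ->
  let m1 := meanR P X in let m2 := meanR P (fun w => X w ^+ 2) in
  cabs (m1%:C - (phi%:C * u1 + v1)) <= eps / r /\
  cabs ((m2 - m1 ^+ 2)%:C - (phi%:C * (2 * u2) + 2 * v2)) <= 2 * (eps / r ^+ 2) + (eps / r) ^+ 2.
Proof.
move=> Ua Va Uj Vj m1 m2.
pose M z := expectationC P (fun w => cexp (z * (X w)%:C)).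
(* The factor 4 in the moment hypothesis: [mgf_expansion] doubles the radius, and
   [expands_disc_approx] halves the disc, so the expansion is taken at [2 * r]. *)
have Xi' : integrableR P (fun w => expR (2 * (2 * r) * `|X w|)).
  by apply: eq_integrableR Xi => w; rewrite mulrA -natrM.
have r20 : 0 < 2 * r by rewrite mulr_gt0.
have Mexp := mgf_expansion mX r20 Xi'.
have Ma : disc_approx r M.
  by have := expands_disc_approx Mexp; rewrite mulrAC divff ?mul1r.
have Mj : jet2 M 1 m1%:C (m2 / 2)%:C.
  have := expands_jet2 Mexp; rewrite fact0 !divr1.
  rewrite (eq_meanR P (fun w => expr0 (X w))) meanR_cst.
  by rewrite (eq_meanR P (fun w => expr1 (X w))).
pose a := phi%:C * u1 + v1; pose b := phi%:C * u2 + v2.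
pose E z := cexp (-1 * (phi%:C * U z + V z)).
have Ea : disc_approx r E.
  apply: disc_approx_cexp; apply: disc_approxM; first exact: disc_approx_cst.
  by apply: disc_approxD => //; apply: disc_approxM => //; exact: disc_approx_cst.
have Ej : jet2 E 1 (- a) (- b + (- a) ^+ 2 / 2).
  apply: jet2_cexp; have := jet2M (jet2_cst (-1)) (jet2D (jet2M (jet2_cst phi%:C) Uj) Vj).
  by rewrite !(mul0r, mulr0, addr0, add0r) !mulN1r.
pose D z := M z * E z + -1.
have Da : disc_approx r D by apply: disc_approxD (disc_approxM Ma Ea) (disc_approx_cst _ _).
have Dj := jet2D (jet2M Mj Ej) (jet2_cst (-1)).
have DB z : cabs z <= r -> cabs (D z) <= eps.
  move=> zr; rewrite (_ : D z = err z) ?errE// /D /M ME// /E mulN1r cexpN.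
  rewrite mulrAC divff ?mul1r; first by ring.
  by rewrite -cabs_eq0 cabs_cexp gt_eqF ?expR_gt0.
have [] := cauchy2 r0 Da Dj DB.
set c1 := (X in cabs X * r); set c2 := (X in cabs X * r ^+ 2).
have -> : c1 = m1%:C - a by rewrite /c1; ring.
have -> : c2 = ((m2 - m1 ^+ 2)%:C - 2 * b + (m1%:C - a) ^+ 2) / 2.
  by rewrite /c2 rmorphB rmorphXn rmorphM fmorphV rmorph_nat; field.
rewrite -!ler_pdivlMr ?exprn_gt0// => h1 h2; split => //.
have -> : phi%:C * (2 * u2) + 2 * v2 = 2 * b by rewrite /b; ring.
rewrite (_ : _ - 2 * b = 2 * (((m2 - m1 ^+ 2)%:C - 2 * b + (m1%:C - a) ^+ 2) / 2)
  - (m1%:C - a) ^+ 2); last by field.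
apply: le_trans (cabsB _ _) _; apply: lerD.
  by rewrite (cabsM 2) (cabs_nat _ 2) ler_wpM2l.
by rewrite cabsX expr_le ?cabs_ge0.
Qed.

End MomentEstimates.

(** With [s] the inverse root of [phi] and [z = 'i * s], the linear part of [phi U] cancels the
    centring, the quadratic part is exactly [- u2], and the cubic remainder together with [V] is of
    order [s]. The thresholds [L] and [eps0] depend only on [U], [V], [r] and [e], so one choice
    serves a whole sequence of probability spaces. *)
Lemma quasi_power_charfun (U V : C -> C) (g r e : R) (u2 v1 v2 : C) : 0 < r ->
  jet2 U 0 g%:C u2 -> jet2 V 0 v1 v2 -> 0 < e ->
  exists L eps0 : R, [/\ 0 < L, 0 < eps0 &
    forall (d : measure_display) (T : measurableType d) (P : probability T R)
      (X : T -> R) (eps phi : R) (err : C -> C), measurable_fun setT X ->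
    (forall z, cabs z <= r -> expectationC P (fun w => cexp (z * (X w)%:C)) =
      cexp (phi%:C * U z + V z) * (1 + err z)) ->
    (forall z, cabs z <= r -> cabs (err z) <= eps) ->
    L <= phi -> eps <= eps0 ->
    cabs (expectationC P (fun w => cexp ('i * ((X w - phi * g) / Num.sqrt phi)%:C)) -
      cexp (- u2)) <= e].
Proof.
move=> r0 [KU [rU [KU0 rU0 hU]]] Vj e0.
have [BV [rV [BV0 rV0 hV]]] := jet2_lip Vj.
pose E0 := cabs (cexp (- u2) : C) + 1.
have E00 : 0 < E0 by rewrite ltr_wpDl ?cabs_ge0.
pose D := 2 * expR 1 * (KU + BV) + 1.
have D0 : 0 < D by rewrite ltr_wpDl// !mulr_ge0 ?expR_ge0 ?addr_ge0.
(* The first bounds keep [z] where all expansions hold; the next makes the exponent error [dl] at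
   most 1; the last makes its contribution at most half of [e]. *)
pose s0 := Num.min (Num.min (Num.min r rU) (Num.min rV (1 / (KU + BV + 1)))) (e / (2 * E0 * D)).
have s00 : 0 < s0.
  by rewrite !lt_min r0 rU0 rV0 !divr_gt0 ?mulr_gt0// ltr_wpDl ?addr_ge0.
exists (s0 ^- 2), (Num.min 1 (e / (2 * E0))); split.
- by rewrite invr_gt0 exprn_gt0.
- by rewrite lt_min ltr01 divr_gt0// mulr_gt0.
move=> d T P X eps phi err mX ME errE Lphi; rewrite le_min => /andP[eps1 epse].
have phi0 : 0 < phi by apply: lt_le_trans Lphi; rewrite invr_gt0 exprn_gt0.
have q0 : 0 < Num.sqrt phi by rewrite sqrtr_gt0.
pose s := (Num.sqrt phi)^-1.
have sp : 0 < s by rewrite invr_gt0.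
have ss0 : s <= s0.
  rewrite -(@ler_pXn2r _ 2)// ?nnegrE ?(ltW sp) ?(ltW s00)//.
  rewrite exprVn sqr_sqrtr ?(ltW phi0)//.
  by rewrite -[leRHS]invrK lef_pV2// posrE invr_gt0 exprn_gt0.
have phis : phi * s ^+ 2 = 1.
  by rewrite exprVn sqr_sqrtr ?(ltW phi0)// divff// gt_eqF.
move: ss0; rewrite !le_min => /andP[/andP[/andP[sr srU] /andP[srV sK]] se].
pose z : C := 'i * s%:C.
have zs : cabs z = s by rewrite cabsM cabs_i mul1r cabs_real ger0_norm// ltW.
have z2 : z ^+ 2 = - (s ^+ 2)%:C by rewrite exprMn sqr_i mulN1r rmorphXn.
pose dl : C := phi%:C * (U z - (0 + g%:C * z + u2 * z ^+ 2)) + V z.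
have dls : cabs dl <= (KU + BV) * s.
  apply: le_trans (cabsD _ _) _; rewrite mulrDl; apply: lerD; last first.
    by have := hV z; rewrite subr0 zs; exact.
  rewrite cabsM cabs_real ger0_norm ?(ltW phi0)//.
  apply: (@le_trans _ _ (phi * (KU * s ^+ 3))).
    by rewrite ler_wpM2l ?(ltW phi0)// -zs hU// zs.
  rewrite (_ : phi * (KU * s ^+ 3) = phi * s ^+ 2 * (KU * s)); last by ring.
  by rewrite phis mul1r.
have dl1 : cabs dl <= 1.
  apply: le_trans dls _; move: sK; rewrite ler_pdivlMr ?ltr_wpDl ?addr_ge0//.
  by apply: le_trans; rewrite mulrC ler_wpM2l ?(ltW sp)// lerDl.
have expdl : cabs (cexp dl - 1) <= expR 1 * ((KU + BV) * s).
  have := cexp_taylor 1 dl; rewrite exp_polyE big_ord_recl big_ord0 addr0 expr0 fact0 divr1.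
  move=> /le_trans; apply; rewrite expr1 (_ : 1`! = 1)%N// divr1 mulrC.
  by apply: ler_pM; rewrite ?expR_ge0 ?cabs_ge0 ?ler_expR.
have -> : expectationC P (fun w => cexp ('i * ((X w - phi * g) / Num.sqrt phi)%:C)) =
    cexp (- u2) * (cexp dl * (1 + err z)).
  have zr : cabs z <= r by rewrite zs.
  transitivity (cexp (- (phi * g)%:C * z) * expectationC P (fun w => cexp (z * (X w)%:C))).
    rewrite -expectationCZ; last first.
      split.
        apply: le_integrableR (integrableR_cst P 1); first exact: measurable_Re_cexp.
        move=> w; apply: le_trans (Re_le_cabs _) _; rewrite cabs_cexp.
        by rewrite (_ : complex.Re _ = 0) ?expR0// /z/=; ring.
      apply: le_integrableR (integrableR_cst P 1); first exact: measurable_Im_cexp.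
      move=> w; apply: le_trans (Im_le_cabs _) _; rewrite cabs_cexp.
      by rewrite (_ : complex.Re _ = 0) ?expR0// /z/=; ring.
    apply: eq_expectationC => w; rewrite -cexpD; congr cexp.
    by rewrite /z rmorphM rmorphB/= -/s; ring.
  rewrite ME// mulrA -cexpD mulrA -cexpD; congr (cexp _ * _).
  rewrite /dl z2 rmorphM.
  have -> : - u2 = phi%:C * (- u2 * (s ^+ 2)%:C).
    by rewrite mulrCA -rmorphM phis mulr1.
  by ring.
rewrite -[X in _ - X]mulr1 -mulrBr cabsM.
have -> : cexp dl * (1 + err z) - 1 = (cexp dl - 1) * (1 + err z) + err z by ring.
have errz : cabs (err z) <= eps by apply: errE; rewrite zs.
apply: (@le_trans _ _ (E0 * (expR 1 * ((KU + BV) * s) * 2 + eps))).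
  apply: ler_pM; rewrite ?cabs_ge0 ?lerDl//.
  apply: le_trans (cabsD _ _) _; apply: lerD => //.
  rewrite cabsM; apply: ler_pM; rewrite ?cabs_ge0//.
  apply: le_trans (cabsD _ _) _; rewrite cabs1 (_ : 2 = 1 + 1)// lerD2l.
  exact: le_trans errz eps1.
rewrite mulrC -ler_pdivlMr//.
have -> : e / E0 = e / (2 * E0 * D) * D + e / (2 * E0).
  by field; rewrite !gt_eqF.
apply: lerD => //; apply: (@le_trans _ _ (s * D)); last by rewrite ler_wpM2r// ltW.
rewrite (_ : expR 1 * ((KU + BV) * s) * 2 = s * (2 * expR 1 * (KU + BV))); last by ring.
by rewrite ler_wpM2l ?(ltW sp)// lerDl.
Qed.

End QuasiPowers.

(** * Convergence in distribution from characteristic functions *)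

Section FejerKernel.
Variable R : realType.
Local Notation C := (Cplx R).
Implicit Types (M : nat) (t : R).

(* The Fejer kernel, normalized so that its values at [M] equally spaced points sum to 1. *)
Definition fejer M t : R :=
  (\sum_(k < M) \sum_(l < M) cos ((k%:R - l%:R) * t)) / M%:R ^+ 2.

(** For [m] below [M] these are equally spaced points of one period, placed in [(-pi, pi]]. *)
Definition fejer_node M (m : nat) : R := pi - pi *+ 2 / M%:R * m%:R.

Lemma fejerE M t : fejer M t = cabs (\sum_(k < M) cis t ^+ k) ^+ 2 / M%:R ^+ 2.
Proof.
congr (_ / _); rewrite cabs_sqr Re_sum Im_sum.
under [X in X ^+ 2 + _]eq_bigr do rewrite cisX cisE/=.
under [X in _ + X ^+ 2]eq_bigr do rewrite cisX cisE/=.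
rewrite !expr2 !big_distrlr/= -big_split; apply: eq_bigr => k _.
by rewrite -big_split; apply: eq_bigr => l _; rewrite mulrBl cosB.
Qed.

Lemma fejer_ge0 M t : 0 <= fejer M t.
Proof. by rewrite fejerE divr_ge0 ?sqr_ge0. Qed.

(** This is [parseval] for the polynomial with [M] coefficients equal to 1, read on the unit circle:
    an exact partition of unity at finitely many nodes. *)
Lemma fejer_sum M t : (0 < M)%N -> \sum_(m < M) fejer M (t - fejer_node M m) = 1.
Proof.
move=> M0; have M0' : (M%:R : R) != 0 by rewrite pnatr_eq0 -lt0n.
pose q : {poly R[i]} := \poly_(k < M) 1.
have qE (z : R[i]) : q.[z] = \sum_(k < M) z ^+ k.
  by rewrite horner_poly; apply: eq_bigr => k _; rewrite mul1r.
have := parseval (cis (t - pi)) (prim_root_cis R M0) (size_poly M (fun=> 1 : R[i])).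
rewrite [RHS](_ : _ = (M%:R ^+ 2)%:C :> R[i]); last first.
  rewrite (eq_bigr (fun=> 1 : R[i])); last first.
    move=> k _; rewrite coef_poly ltn_ord normr1 expr1n mul1r.
    by rewrite (cabsE (cis _)) cabs_cis !expr1n.
  by rewrite sumr_const card_ord rmorphXn rmorph_nat expr2.
rewrite (_ : \sum_(m < M) _ = (\sum_(m < M) fejer M (t - fejer_node M m) * M%:R ^+ 2)%:C); last first.
  rewrite rmorph_sum; apply: eq_bigr => m _; rewrite fejerE divfK ?sqrf_eq0//.
  rewrite -[poly _ _]/q qE (cabsE (\sum_(k < M) _)) rmorphXn; congr ((cabs _)%:C ^+ 2).
  apply: eq_bigr => k _; congr (_ ^+ k).
  by rewrite cisX -cisD /fejer_node; congr cis; ring.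
move/complexI; rewrite -mulr_suml => h.
by apply: (mulIf (expf_neq0 2 M0')); rewrite h mul1r.
Qed.

(** Multiplied by [cis t - 1], the geometric sum telescopes to a number of modulus at most 2, while
    [1 - cos t] is half the squared modulus of [cis t - 1]. *)
Lemma fejer_concentration M t : fejer M t * (1 - cos t) <= 2 / M%:R ^+ 2.
Proof.
rewrite fejerE mulrAC ler_wpM2r ?invr_ge0 ?sqr_ge0//.
have -> : 1 - cos t = cabs (cis t - 1) ^+ 2 / 2.
  rewrite cabs_sqr cisE/= subr0.
  rewrite [X in _ = X / 2](_ : _ = (cos t ^+ 2 + sin t ^+ 2) + 1 - 2 * cos t).
    by rewrite cos2Dsin2; field.
  by ring.
rewrite mulrA -exprMn -cabsM mulrC [X in _ * cabs X ^+ 2]mulrC -subrX1 mulrC.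
rewrite ler_pdivrMr// -natrM; apply: (@le_trans _ _ (2 ^+ 2)).
  apply: expr_le (cabs_ge0 _) _; apply: le_trans (cabsB _ _) _.
  by rewrite cabsX cabs_cis expr1n cabs1.
by rewrite -natrX.
Qed.

Lemma fejer_concentration_sum M t : (0 < M)%N ->
  \sum_(m < M) fejer M (t - fejer_node M m) * (1 - cos (t - fejer_node M m)) <= 2 / M%:R.
Proof.
move=> M0; apply: (@le_trans _ _ (\sum_(m < M) 2 / M%:R ^+ 2)).
  by apply: ler_sum => m _; exact: fejer_concentration.
rewrite sumr_const card_ord -mulr_natr le_eqVlt; apply/orP; left; apply/eqP.
by field; rewrite pnatr_eq0 -lt0n.
Qed.

Lemma fejer_node_le M m : (m < M)%N -> `|fejer_node M m| <= pi.
Proof.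
move=> mM; have M0 : (0 : R) < M%:R by rewrite ltr0n (leq_ltn_trans _ mM).
have mM1 : 0 <= (m%:R : R) / M%:R <= 1.
  by rewrite divr_ge0//= ler_pdivrMr// mul1r ler_nat ltnW.
rewrite (_ : fejer_node M m = pi * (1 - 2 * (m%:R / M%:R))).
  rewrite normrM ger0_norm ?pi_ge0// ler_piMr ?pi_ge0// ler_norml.
  by move: mM1; set x := _ / _ => /andP[x0 x1]; apply/andP; split; lra.
by rewrite /fejer_node -mulr_natr; field; rewrite gt_eqF.
Qed.

(** Up to [pi] the cosine decreases; from there to [3 / 2 * pi] it is nonpositive. The upper limit
    is the largest distance between a point within [pi / 2] of the origin and a node, and staying
    away from [2 pi] excludes wrap-around. *)
Lemma one_sub_cos_ge (del t : R) : 0 < del -> del <= pi / 2 ->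
  del <= `|t| -> `|t| <= 3 / 2 * pi -> 1 - cos del <= 1 - cos t.
Proof.
move=> d0 d2 dt t3; rewrite -(cos_norm t) lerD2l lerN2; move: `|t| dt t3 => {}t dt t3.
have dpi : del <= pi by lra.
have [tpi|tpi] := leP t pi.
  have [->//|] := eqVneq del t.
  move=> dnt; rewrite ltW// ltr_cos ?lt_neqAle ?dnt// in_itv/= ?(ltW d0)//.
  by rewrite tpi (le_trans (ltW d0) dt).
apply: (@le_trans _ _ 0).
  rewrite (_ : t = (t - pi) + pi); last by rewrite subrK.
  rewrite cosDpi oppr_le0 cos_ge0_pihalf//; apply/andP; split; lra.
by rewrite cos_ge0_pihalf//; apply/andP; split; lra.
Qed.

End FejerKernel.

Section FejerApproximation.
Variable R : realType.
Implicit Types (f : R * R -> R) (x y : R * R).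

(** A weighted mean of sampled values of [f]; in [x] it is a trigonometric polynomial of period
    [2 * pi / a] in each coordinate. *)
Definition fejer2 M (a : R) f x : R := \sum_(m < M) \sum_(l < M)
  f (fejer_node R M m / a, fejer_node R M l / a) *
  (fejer M (a * x.1 - fejer_node R M m) * fejer M (a * x.2 - fejer_node R M l)).

Lemma fejer2_weights M a x : (0 < M)%N -> \sum_(m < M) \sum_(l < M)
  (fejer M (a * x.1 - fejer_node R M m) * fejer M (a * x.2 - fejer_node R M l)) = 1.
Proof. by move=> M0; rewrite -big_distrlr/= !fejer_sum// mulr1. Qed.

Lemma fejer2_bound M a f x B : (0 < M)%N -> (forall y, `|f y| <= B) -> `|fejer2 M a f x| <= B.
Proof.
move=> M0 fB; apply: le_trans (ler_norm_sum _ _ _) _.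
rewrite -[leRHS]mulr1 -(fejer2_weights a x M0) mulr_sumr; apply: ler_sum => m _.
apply: le_trans (ler_norm_sum _ _ _) _; rewrite mulr_sumr; apply: ler_sum => l _.
have w0 := mulr_ge0 (fejer_ge0 M (a * x.1 - fejer_node R M m))
  (fejer_ge0 M (a * x.2 - fejer_node R M l)).
by rewrite normrM (ger0_norm w0) ler_wpM2r.
Qed.

(** Only [x] is confined to the box, because the nodes compared with it may lie outside; compactness
    is therefore applied to a property quantified over all [y]. *)
Lemma unif_continuous_box f (K e : R) : continuous f -> 0 < e ->
  exists2 del : R, 0 < del & forall x y, `|x.1| <= K -> `|x.2| <= K ->
    `|x.1 - y.1| < del -> `|x.2 - y.2| < del -> `|f x - f y| <= e.
Proof.
move=> fc e0.
have cpt : compact (`[- K, K] `*` `[- K, K] : set (R * R)).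
  by apply: compact_setX; exact: segment_compact.
pose Q (del : R) x := forall y, `|x.1 - y.1| < del -> `|x.2 - y.2| < del -> `|f x - f y| <= e.
have /compact_near_coveringP/(_ R (0 : R)^'+ Q _) := cpt.
have near_Q x : \forall x' \near x & i \near (0 : R)^'+, Q i x'.
  have /cvgrPdist_le/(_ (e / 2)) := fc x; rewrite divr_gt0// => /(_ isT).
  move=> /nbhs_ballP[eta /= eta0 fe].
  have eta20 : 0 < eta / 2 by rewrite divr_gt0.
  exists (ball x (eta / 2), [set i | 0 < i < eta / 2]).
    split => /=; first exact: nbhsx_ballx.
    by near=> i; apply/andP; split; near: i; [exact: nbhs_right_gt | exact: nbhs_right_lt].
  move=> [x' i] /= [[b1 b2] /andP[i0 ie]] y d1 d2.
  have h1 : `|f x - f x'| <= e / 2.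
    by apply: fe; split; apply: le_ball b1 || apply: le_ball b2; rewrite ler_pdivrMr// ler_peMr ?ler1n// ltW.
  have h2 : `|f x - f y| <= e / 2.
    apply: fe; split; rewrite /ball/=.
      rewrite -(subrKA x'.1) [eta]splitr (le_lt_trans (ler_normD _ _))// ltrD//.
      exact: lt_trans d1 ie.
    rewrite -(subrKA x'.2) [eta]splitr (le_lt_trans (ler_normD _ _))// ltrD//.
    exact: lt_trans d2 ie.
  rewrite -(subrKA (f x)) [e]splitr (le_trans (ler_normD _ _))// lerD//.
  by rewrite distrC.
move=> /(_ (fun x _ => near_Q x)) => near_del.
have : \forall del \near (0 : R)^'+, 0 < del /\ `[- K, K] `*` `[- K, K] `<=` Q del.
  near=> del; split; first by near: del; exact: nbhs_right_gt.
  by near: del; exact: near_del.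
move=> /filter_ex[del [del0 Kdel]]; exists del => // x y x1 x2; apply: Kdel.
by split; rewrite /= in_itv/= -ler_norml.
Unshelve. all: by end_near. Qed.

(** In the box, a node is either close to [x], where uniform continuity applies, or far in one
    coordinate, where [1 - cos] is bounded below and dominates the crude bound [2 * B]. Averaging,
    [fejer_concentration_sum] makes the far contribution small. Outside the box the error is at most
    [2 * B], and the quadratic term exceeds this. *)
Lemma fejer2_approx f (B K e : R) : continuous f -> (forall y, `|f y| <= B) ->
  0 < K -> 0 < e -> exists M a, (0 < M)%N /\
  forall x, `|f x - fejer2 M a f x| <= e + 2 * B * ((x.1 ^+ 2 + x.2 ^+ 2) / K ^+ 2).
Proof.
move=> fc fB K0 e0; have B0 : 0 <= B := le_trans (normr_ge0 _) (fB 0).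
have e20 : 0 < e / 2 by rewrite divr_gt0.
have [del del0 fdel] := unif_continuous_box K fc e20.
have pi0 := pi_gt0 R.
(* This scale sends the box to [[-pi/2, pi/2]] in each coordinate, half of a period, as
   [one_sub_cos_ge] requires. *)
pose a : R := pi / (2 * K); have a0 : 0 < a by rewrite divr_gt0// mulr_gt0.
pose th := Num.min (a * del) (pi / 2).
have th0 : 0 < th by rewrite lt_min mulr_gt0//= divr_gt0.
have th2 : th <= pi / 2 by rewrite ge_min lexx orbT.
have thdel : th <= a * del by rewrite ge_min lexx.
pose c := 1 - cos th.
have c0 : 0 < c by rewrite subr_gt0 cos_lt1//; lra.
pose D := 2 * B / c; have D0 : 0 <= D by rewrite divr_ge0 ?mulr_ge0// ltW.
(* Each coordinate contributes [2 / M] to the concentration sum, so [D * (4 / M)] must be at most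
   [e / 2]. *)
pose M := (Num.truncn (8 * D / e)).+1.
have M0 : (0 < M)%N by [].
have MD : D * (4 / M%:R) <= e / 2.
  have : 8 * D / e < M%:R by exact: truncnS_gt.
  rewrite ltr_pdivrMr// => h; rewrite [leLHS]mulrA ler_pdivrMr//.
  by move: h; move: (M%:R : R) (D : R) => m D'; lra.
exists M, a; split => // x.
have [/andP[x1 x2]|out] := boolP ((`|x.1| <= K) && (`|x.2| <= K)); last first.
  apply: (@le_trans _ _ (2 * B)).
    rewrite mulr2n mulrDl !mul1r (le_trans (ler_normB _ _))// lerD//.
    exact: fejer2_bound.
  rewrite ler_wpDl ?(ltW e0)// ler_peMr ?mulr_ge0// ler_pdivlMr ?exprn_gt0// mul1r.
  move: out; rewrite negb_and -!ltNge => /orP[] /ltW xK.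
    by rewrite ler_wpDr ?sqr_ge0// -(real_normK (num_real x.1)) expr_le// ltW.
  by rewrite ler_wpDl ?sqr_ge0// -(real_normK (num_real x.2)) expr_le// ltW.
rewrite ler_wpDr ?mulr_ge0 ?addr_ge0 ?invr_ge0 ?sqr_ge0//.
pose n1 (m : 'I_M) := a * x.1 - fejer_node R M m.
pose n2 (m : 'I_M) := a * x.2 - fejer_node R M m.
have local (m l : 'I_M) : `|f x - f (fejer_node R M m / a, fejer_node R M l / a)| <=
    e / 2 + D * ((1 - cos (n1 m)) + (1 - cos (n2 l))).
  have cos0' (t : R) : 0 <= 1 - cos t by rewrite subr_ge0 cos_le1.
  have node_bound (t : R) (k : 'I_M) : `|t| <= K -> `|a * t - fejer_node R M k| <= 3 / 2 * pi.
    move=> tK; apply: le_trans (ler_normB _ _) _.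
    have := fejer_node_le R (ltn_ord k); rewrite normrM (gtr0_norm a0).
    have : a * `|t| <= pi / 2.
      rewrite (_ : pi / 2 = a * K) ?ler_wpM2l// ?(ltW a0)//.
      by rewrite /a; field; rewrite gt_eqF.
    lra.
  have far (t : R) (k : 'I_M) : `|t| <= K -> del <= `|t - fejer_node R M k / a| ->
      2 * B <= D * (1 - cos (a * t - fejer_node R M k)).
    move=> tK tdel; rewrite /D -mulrA ler_peMr ?mulr_ge0// mulrC ler_pdivlMr// mul1r.
    apply: one_sub_cos_ge => //; last exact: node_bound.
    rewrite (_ : a * t - _ = a * (t - fejer_node R M k / a)); last first.
      by field; rewrite gt_eqF.
    by rewrite normrM (gtr0_norm a0) (le_trans thdel)// ler_wpM2l// ltW.
  have bnd : `|f x - f (fejer_node R M m / a, fejer_node R M l / a)| <= 2 * B.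
    rewrite (_ : 2 * B = B + B); last by ring.
    by rewrite (le_trans (ler_normB _ _))// lerD.
  have [h1|h1] := leP del `|x.1 - fejer_node R M m / a|.
    apply: le_trans bnd _; apply: le_trans (far _ _ x1 h1) _.
    by apply: ler_wpDl; rewrite ?(ltW e20)// ler_wpM2l// lerDl cos0'.
  have [h2|h2] := leP del `|x.2 - fejer_node R M l / a|.
    apply: le_trans bnd _; apply: le_trans (far _ _ x2 h2) _.
    by apply: ler_wpDl; rewrite ?(ltW e20)// ler_wpM2l// lerDr cos0'.
  apply: le_trans (fdel x (_, _) x1 x2 h1 h2) _.
  by rewrite lerDl mulr_ge0// addr_ge0 ?cos0'.
rewrite -[f x]mulr1 -(fejer2_weights a x M0) mulr_sumr -sumrB.
apply: le_trans (ler_norm_sum _ _ _) _.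
apply: (@le_trans _ _ (\sum_(m < M) \sum_(l < M)
  (e / 2 + D * ((1 - cos (n1 m)) + (1 - cos (n2 l)))) * (fejer M (n1 m) * fejer M (n2 l)))).
  apply: ler_sum => m _; rewrite mulr_sumr -sumrB.
  apply: le_trans (ler_norm_sum _ _ _) _; apply: ler_sum => l _.
  rewrite -mulrBl normrM (ger0_norm (mulr_ge0 (fejer_ge0 _ _) (fejer_ge0 _ _))).
  by apply: ler_wpM2r; [exact: (mulr_ge0 (fejer_ge0 _ _) (fejer_ge0 _ _))|exact: local].
have -> : \sum_(m < M) \sum_(l < M)
  (e / 2 + D * ((1 - cos (n1 m)) + (1 - cos (n2 l)))) * (fejer M (n1 m) * fejer M (n2 l)) =
  e / 2 * \sum_(m < M) \sum_(l < M) (fejer M (n1 m) * fejer M (n2 l)) +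
  D * ((\sum_(m < M) fejer M (n1 m) * (1 - cos (n1 m))) * (\sum_(l < M) fejer M (n2 l)) +
   (\sum_(m < M) fejer M (n1 m)) * (\sum_(l < M) fejer M (n2 l) * (1 - cos (n2 l)))).
  rewrite !big_distrlr/= -big_split/= !mulr_sumr -big_split/=.
  apply: eq_bigr => m _; rewrite -big_split/= !mulr_sumr -big_split/=.
  by apply: eq_bigr => l _; ring.
rewrite fejer2_weights// !fejer_sum// !mulr1 mul1r [leRHS]splitr lerD2l.
apply: le_trans MD; rewrite ler_wpM2l// (_ : 4 / _ = 2 / M%:R + 2 / M%:R); last by rewrite -mulrDl -natrD.
by apply: lerD; exact: fejer_concentration_sum.
Qed.

End FejerApproximation.

Section ConvergenceInDistribution.
Variables (R : realType) (d : nat -> measure_display)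
  (T : forall n, measurableType (d n)) (P : forall n, probability (T n) R)
  (Y : forall n, T n -> R * R) (mu : probability (R * R)%type R).
Implicit Types (f g : R * R -> R).
Hypothesis mY : forall n, measurable_fun setT (@Y n).

(** A class of test functions closed under linear combinations; once it contains the shifted
    cosines, it contains all trigonometric polynomials. *)
Definition mean_cvg g := [/\ measurable_fun setT g, exists B, forall x, `|g x| <= B &
  meanR (P n) (g \o @Y n) @[n --> \oo] --> meanR mu g].

Lemma bounded_integrableR (d' : measure_display) (S : measurableType d')
  (nu : probability S R) (g : S -> R) (B : R) :
  measurable_fun setT g -> (forall x, `|g x| <= B) -> integrableR nu g.
Proof. by move=> mg gB; apply: le_integrableR (integrableR_cst nu B). Qed.

Lemma mean_cvg_integrable g : mean_cvg g ->
  integrableR mu g /\ forall n, integrableR (P n) (g \o @Y n).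
Proof.
move=> [mg [B gB] _]; split; first exact: bounded_integrableR gB.
move=> n; apply: (@bounded_integrableR _ _ _ _ B) => [|x]; last exact: gB.
exact: measurableT_comp.
Qed.

Lemma mean_cvgD f g : mean_cvg f -> mean_cvg g -> mean_cvg (fun x => f x + g x).
Proof.
move=> fm gm; have [fi fPi] := mean_cvg_integrable fm.
have [gi gPi] := mean_cvg_integrable gm.
move: fm gm => [mf [Bf fB] fc] [mg [Bg gB] gc]; split.
- exact: measurable_funD.
- by exists (Bf + Bg) => x; rewrite (le_trans (ler_normD _ _))// lerD.
- rewrite meanRD//; under eq_fun do rewrite (meanRD (fPi _) (gPi _)).
  exact: cvgD.
Qed.

Lemma mean_cvgZ (k : R) f : mean_cvg f -> mean_cvg (fun x => k * f x).
Proof.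
move=> fm; have [fi fPi] := mean_cvg_integrable fm.
move: fm => [mf [Bf fB] fc]; split.
- exact: measurable_funM.
- by exists (`|k| * Bf) => x; rewrite normrM ler_wpM2l.
- rewrite meanRZ//; under eq_fun do rewrite (meanRZ _ (fPi _)).
  exact: cvgMr.
Qed.

Lemma mean_cvg_sum n (F : 'I_n -> R * R -> R) : (forall i, mean_cvg (F i)) ->
  mean_cvg (fun x => \sum_i F i x).
Proof.
move=> Fi; elim: n F Fi => [|n IH] F Fi.
  rewrite (_ : (fun x => _) = fun=> 0); last by apply/funext => x; rewrite big_ord0.
  split; [exact: measurable_cst | by exists 0 => x; rewrite normr0 |].
  rewrite meanR_cst; under eq_fun do rewrite (meanR_cst _ 0); exact: cvg_cst.
rewrite (_ : (fun x => _) = fun x => F ord0 x + \sum_(i < n) F (lift ord0 i) x); last first.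
  by apply/funext => x; rewrite big_ord_recl.
by apply: mean_cvgD => //; apply: IH.
Qed.

Hypothesis charfun_cvg : forall t1 t2 e : R, 0 < e -> \forall n \near \oo,
  cabs (expectationC (P n) (fun w => cis (t1 * (@Y n w).1 + t2 * (@Y n w).2)) -
    expectationC mu (fun x => cis (t1 * x.1 + t2 * x.2))) <= e.

Lemma mean_cvg_cos (t1 t2 c : R) : mean_cvg (fun x => cos (t1 * x.1 + t2 * x.2 + c)).
Proof.
have mlin : measurable_fun setT (fun x : R * R => t1 * x.1 + t2 * x.2).
  by apply: measurable_funD; apply: measurable_funM.
have mcos : measurable_fun setT (@cos R).
  by apply: continuous_measurable_fun; exact: continuous_cos.
have msin : measurable_fun setT (@sin R).
  by apply: continuous_measurable_fun; exact: continuous_sin.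
have intC d' (S : measurableType d') (nu : probability S R) (g : S -> R) :
    measurable_fun setT g -> integrableC nu (fun x => cis (g x)).
  move=> mg; split.
    apply: (@bounded_integrableR _ _ _ _ 1).
      by under eq_fun do rewrite cisE/=; exact: measurableT_comp.
    by move=> x; apply: le_trans (Re_le_cabs _) _; rewrite cabs_cis.
  apply: (@bounded_integrableR _ _ _ _ 1).
    by under eq_fun do rewrite cisE/=; exact: measurableT_comp.
  by move=> x; apply: le_trans (Im_le_cabs _) _; rewrite cabs_cis.
have cosE d' (S : measurableType d') (nu : probability S R) (g : S -> R) :
    measurable_fun setT g -> meanR nu (fun x => cos (g x + c)) =
    complex.Re (cis c * expectationC nu (fun x => cis (g x))).
  move=> mg; rewrite -expectationCZ; last exact: intC.
  transitivity (meanR nu (fun x => complex.Re (cis c * cis (g x)))); last first.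
    by rewrite -meanRE.
  by apply: eq_meanR => x; rewrite -cisD cisE addrC.
split.
- apply: measurableT_comp => //; exact: measurable_funD.
- by exists 1 => x; exact: cos_max.
rewrite cosE//; under eq_fun => n.
  rewrite [g in meanR _ g](_ : _ = fun w => cos (t1 * (@Y n w).1 + t2 * (@Y n w).2 + c))//.
  rewrite (cosE _ _ (P n) (fun w => t1 * (@Y n w).1 + t2 * (@Y n w).2)); last first.
    by apply: (measurableT_comp mlin).
  over.
apply/cvgrPdist_le => e e0; near=> n.
rewrite -ReB -mulrBr; apply: le_trans (Re_le_cabs _) _.
rewrite cabsM cabs_cis mul1r cabsC; near: n; exact: charfun_cvg.
Unshelve. all: by end_near. Qed.

Lemma mean_cvg_fejer2 M (a : R) f : mean_cvg (fejer2 M a f).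
Proof.
(* Products of cosines in the two coordinates become cosines of joint linear forms, which
   characteristic functions on the plane control. *)
have prod (u v : R) : fejer M u * fejer M v =
    \sum_(k < M) \sum_(l < M) \sum_(k' < M) \sum_(l' < M)
      (M%:R ^- 4 / 2 * cos ((k%:R - l%:R) * u + (k'%:R - l'%:R) * v) +
       M%:R ^- 4 / 2 * cos ((k%:R - l%:R) * u - (k'%:R - l'%:R) * v)).
  rewrite /fejer mulf_div -exprD mulrC mulr_suml mulr_sumr; apply: eq_bigr => k _.
  rewrite mulr_suml mulr_sumr; apply: eq_bigr => l _.
  rewrite !mulr_sumr; apply: eq_bigr => k' _.
  rewrite !mulr_sumr; apply: eq_bigr => l' _.
  by rewrite cosD cosB; field; rewrite pnatr_eq0 -lt0n; case: (M) k => [[]|].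
rewrite (_ : fejer2 M a f = fun x => \sum_(m < M) \sum_(l < M)
  f (fejer_node R M m / a, fejer_node R M l / a) *
  (fejer M (a * x.1 - fejer_node R M m) * fejer M (a * x.2 - fejer_node R M l)))//.
apply: mean_cvg_sum => m; apply: mean_cvg_sum => l; apply: mean_cvgZ.
set nm := fejer_node R M m; set nl := fejer_node R M l.
under eq_fun do rewrite prod.
apply: mean_cvg_sum => k; apply: mean_cvg_sum => k'; apply: mean_cvg_sum => j.
apply: mean_cvg_sum => j'; apply: mean_cvgD; apply: mean_cvgZ.
  rewrite [X in mean_cvg X](_ : _ = fun x => cos ((k%:R - k'%:R) * a * x.1 + (j%:R - j'%:R) * a * x.2 +
    - ((k%:R - k'%:R) * nm + (j%:R - j'%:R) * nl))); first exact: mean_cvg_cos.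
  by apply/funext => x; congr cos; ring.
rewrite [X in mean_cvg X](_ : _ = fun x => cos ((k%:R - k'%:R) * a * x.1 + (- (j%:R - j'%:R) * a) * x.2 +
  - ((k%:R - k'%:R) * nm - (j%:R - j'%:R) * nl))); first exact: mean_cvg_cos.
by apply/funext => x; congr cos; ring.
Qed.

(** Taking [e] as the inverse of [n.+1] and [K] as [n.+1] exhibits [f] as a pointwise limit of
    trigonometric polynomials, which are measurable for the product sigma-algebra. *)
Lemma measurable_of_fejer2 f (B : R) : continuous f -> (forall y, `|f y| <= B) ->
  measurable_fun setT f.
Proof.
move=> fc fB; have B0 : 0 <= B := le_trans (normr_ge0 _) (fB 0).
have /choice[F FP] : forall n, exists g : R * R -> R, measurable_fun setT g /\
    forall x, `|f x - g x| <= n.+1%:R^-1 + 2 * B * ((x.1 ^+ 2 + x.2 ^+ 2) / n.+1%:R ^+ 2).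
  move=> n; have n0 : 0 < n.+1%:R^-1 :> R by rewrite invr_gt0.
  have [M [a [M0 h]]] := fejer2_approx fc fB (ltr0Sn R n) n0.
  by exists (fejer2 M a f); split => //; case: (mean_cvg_fejer2 M a f).
apply: (@measurable_fun_cvg _ _ _ _ F) => [n|x _]; first by case: (FP n).
pose D := 1 + 2 * B * (x.1 ^+ 2 + x.2 ^+ 2).
have FD n : `|f x - F n x| <= D * n.+1%:R^-1.
  have [_ /(_ x)] := FP n; move/le_trans; apply.
  rewrite [leRHS]mulrDl mul1r lerD2l -!mulrA ler_wpM2l// ler_wpM2l//.
  rewrite ler_wpM2l ?addr_ge0 ?sqr_ge0// lef_pV2 ?posrE ?exprn_gt0//.
  by rewrite expr2 ler_peMr// ler1n.
apply/cvgrPdist_le => e e0.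
have : D * n.+1%:R^-1 @[n --> \oo] --> D * (0 : R).
  by apply: cvgMr; exact: cvg_harmonic.
rewrite mulr0 => /cvgrPdist_le/(_ e e0); apply: filterS => n.
rewrite sub0r normrN => h; exact: le_trans (FD n) (le_trans (ler_norm _) h).
Qed.

Hypothesis second_moments : exists C : R,
  (\forall n \near \oo, integrableR (P n) (fun w => (@Y n w).1 ^+ 2 + (@Y n w).2 ^+ 2) /\
     meanR (P n) (fun w => (@Y n w).1 ^+ 2 + (@Y n w).2 ^+ 2) <= C) /\
  integrableR mu (fun x => x.1 ^+ 2 + x.2 ^+ 2) /\
  meanR mu (fun x => x.1 ^+ 2 + x.2 ^+ 2) <= C.

(** The bounded second moments act as tightness: integrated, the quadratic error of [fejer2_approx]
    is small for large [K], uniformly in [n]. Approximation and tail cost [e / 5] each under both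
    laws; convergence for the trigonometric polynomial costs the fifth share. *)
Lemma cvg_in_distribution_of_charfun : cvg_in_distribution P Y mu.
Proof.
move=> f fc fb.
have [B fB] : exists B, forall x, `|f x| <= B.
  have [N [_ /(_ (N + 1))]] := fb; rewrite ltrDl ltr01 => /(_ isT) h.
  by exists (N + 1) => x; exact: h.
have B0 : 0 <= B := le_trans (normr_ge0 _) (fB 0).
have mf := measurable_of_fejer2 fc fB.
have fi : integrableR mu f by exact: bounded_integrableR fB.
have fPi n : integrableR (P n) (f \o @Y n).
  apply: (@bounded_integrableR _ _ _ _ B) => [|x]; last exact: fB.
  exact: measurableT_comp.
rewrite expectationE//; under eq_fun do rewrite (expectationE (fPi _)).
apply/fine_cvgP; split; first by near=> n.
rewrite [X in X @ _](_ : _ = fun n => meanR (P n) (f \o @Y n)); last exact/funext.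
have [C [CP [C1 C2]]] := second_moments.
have C0 : 0 <= C.
  by apply: le_trans C2; apply: meanR_ge0 => x; rewrite addr_ge0 ?sqr_ge0.
apply/cvgrPdist_le => e e0.
have e50 : 0 < e / 5 by rewrite divr_gt0.
pose K := Num.sqrt (2 * B * C / (e / 5)) + 1.
have K0 : 0 < K by rewrite ltr_wpDl// sqrtr_ge0.
have KC : 2 * B * (C / K ^+ 2) <= e / 5.
  rewrite mulrA ler_pdivrMr ?exprn_gt0// [leRHS]mulrC -ler_pdivrMr//.
  have h0 : 0 <= 2 * B * C / (e / 5) by rewrite divr_ge0 ?mulr_ge0// ltW.
  rewrite -{1}(sqr_sqrtr h0) expr_le ?sqrtr_ge0//.
  by rewrite /K lerDl.
have [M [a [M0 fM]]] := fejer2_approx fc fB K0 e50.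
pose G := fejer2 M a f; have Gm : mean_cvg G := mean_cvg_fejer2 M a f.
have [Gi GPi] := mean_cvg_integrable Gm.
have approx d' (S : measurableType d') (nu : probability S R) (X : S -> R * R) :
    integrableR nu (f \o X) -> integrableR nu (G \o X) ->
    integrableR nu (fun w => (X w).1 ^+ 2 + (X w).2 ^+ 2) ->
    meanR nu (fun w => (X w).1 ^+ 2 + (X w).2 ^+ 2) <= C ->
    `|meanR nu (f \o X) - meanR nu (G \o X)| <= e / 5 + e / 5.
  move=> i1 i2 i3 XC.
  have -> : meanR nu (f \o X) - meanR nu (G \o X) =
      meanR nu (fun w => f (X w) + -1 * G (X w)).
    by rewrite meanRD ?meanRZ ?mulN1r//; exact: integrableRZ.
  have i4 := integrableRZ (2 * B / K ^+ 2) i3.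
  apply: (@le_trans _ _ (meanR nu (fun w => e / 5 + 2 * B / K ^+ 2 * ((X w).1 ^+ 2 + (X w).2 ^+ 2)))).
    apply: normr_meanR_le.
    - by apply: integrableRD => //; exact: integrableRZ.
    - by apply: integrableRD => //; exact: integrableR_cst.
    - move=> w; rewrite mulN1r; apply: le_trans (fM (X w)) _.
      by rewrite lerD2l le_eqVlt; apply/orP; left; apply/eqP; ring.
  rewrite meanRD//; last exact: integrableR_cst.
  rewrite meanR_cst meanRZ// lerD2l; apply: le_trans KC.
  rewrite (mulrC C) [leRHS]mulrA; apply: ler_wpM2l XC.
  by rewrite !mulr_ge0// invr_ge0 sqr_ge0.
have [_ _ /cvgrPdist_le/(_ _ e50) Gc] := Gm.
near=> n.
have [CP1 CP2] : integrableR (P n) (fun w => (@Y n w).1 ^+ 2 + (@Y n w).2 ^+ 2) /\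
     meanR (P n) (fun w => (@Y n w).1 ^+ 2 + (@Y n w).2 ^+ 2) <= C by near: n.
have h1 := approx _ _ _ _ (fPi n) (GPi n) CP1 CP2.
have h2 := approx _ _ mu id fi Gi C1 C2.
have h3 : `|meanR mu G - meanR (P n) (G \o @Y n)| <= e / 5 by near: n.
rewrite -(subrKA (meanR mu G)) -(subrKA (meanR (P n) (G \o @Y n)) (meanR mu G)).
rewrite (_ : e = (e / 5 + e / 5) + (e / 5 + (e / 5 + e / 5))); last by field.
apply: le_trans (ler_normD _ _) _; apply: lerD => //.
apply: le_trans (ler_normD _ _) _; apply: lerD => //.
by rewrite distrC.
Unshelve. all: by end_near. Qed.

End ConvergenceInDistribution.

(** * Gaussian laws on the plane *)

Section Density.
Local Open Scope ereal_scope.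
Context (R : realType) (d : measure_display) (T : measurableType d).

Import HBNNSimple.

(** For indicators this is the hypothesis on [nu]; linearity covers simple functions, and monotone
    convergence on both sides covers the rest. *)
Lemma ge0_integral_density (m nu : {measure set T -> \bar R}) (g : T -> R)
    (f : T -> \bar R) : measurable_fun setT g -> (forall x, (0 <= g x)%R) ->
  (forall A, measurable A -> nu A = \int[m]_(x in A) (g x)%:E) ->
  measurable_fun setT f -> (forall x, 0 <= f x) ->
  \int[nu]_x f x = \int[m]_x (f x * (g x)%:E).
Proof.
move=> mg g0 nuE mf f0; pose h := nnsfun_approx measurableT mf.
have -> : \int[nu]_x f x = lim (\int[nu]_x (h n x)%:E @[n --> \oo]).
  rewrite -monotone_convergence//=.
  - apply: eq_integral => x _; apply/esym/cvg_lim => //.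
    exact: cvg_nnsfun_approx.
  - by move=> n; exact/measurable_EFinP.
  - by move=> n x _; rewrite lee_fin.
  - by move=> x _ a b ab; rewrite lee_fin; exact/lefP/nd_nnsfun_approx.
have -> : \int[m]_x (f x * (g x)%:E) = lim (\int[m]_x ((h n x)%:E * (g x)%:E) @[n --> \oo]).
  rewrite -monotone_convergence//=.
  - apply: eq_integral => x _; apply/esym/cvg_lim => //.
    by apply: cvgeZr => //; exact: cvg_nnsfun_approx.
  - by move=> n; apply: emeasurable_funM => //; exact/measurable_EFinP.
  - by move=> n x _; rewrite mule_ge0 ?lee_fin.
  - by move=> x _ a b ab; rewrite lee_wpmul2r ?lee_fin//; exact/lefP/nd_nnsfun_approx.
apply: congr_lim; apply/funext => n /=.
under [LHS]eq_integral do rewrite fimfunE -fsumEFin//.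
rewrite [LHS]ge0_integral_fsum//; last 2 first.
- by move=> r; exact/measurable_EFinP/measurableT_comp.
- by move=> r x _; rewrite EFinM nnfun_muleindic_ge0.
under [RHS]eq_integral => x _.
  rewrite fimfunE -fsumEFin// ge0_mule_fsuml; last by move=> r; rewrite EFinM nnfun_muleindic_ge0.
  over.
rewrite [RHS]ge0_integral_fsum//; last 2 first.
- by move=> r; apply: emeasurable_funM => //; apply/measurable_EFinP/measurableT_comp.
- by move=> r x _; apply: mule_ge0; [rewrite EFinM nnfun_muleindic_ge0 | rewrite lee_fin].
apply: eq_fsbigr => r rh; rewrite integralZl_indic_nnsfun//.
rewrite integral_indic// setIT nuE//.
under [RHS]eq_integral do rewrite EFinM -muleA.
rewrite ge0_integralZl//.
- congr *%E; rewrite integral_mkcond; apply: eq_integral => x _.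
  by rewrite epatch_indic muleC.
- by apply: emeasurable_funM => //; exact/measurable_EFinP.
- by move=> x _; rewrite mule_ge0 ?lee_fin.
- by move: rh; rewrite inE => -[x _ <-]; rewrite lee_fin.
Qed.

Lemma ge0_integral_meanR (P : probability T R) (f : T -> R) (c : R) :
  measurable_fun setT f -> (forall x, (0 <= f x)%R) -> \int[P]_x (f x)%:E = c%:E ->
  integrableR P f /\ meanR P f = c.
Proof.
move=> mf f0 fc; split; last by rewrite /meanR /Rintegral fc.
apply/integrableP; split; first exact/measurable_EFinP.
under eq_integral do rewrite /= ger0_norm//.
by rewrite fc ltry.
Qed.

Lemma meanR_ge0_integral (P : probability T R) (f : T -> R) :
  integrableR P f -> \int[P]_x (f x)%:E = (meanR P f)%:E.
Proof. by move=> fi; rewrite /meanR /Rintegral fineK// integrable_fin_num. Qed.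

End Density.

Section NormalMgf.
Context (R : realType).
Implicit Types (m s t a : R).

(** Completing the square: an exponential tilt shifts the mean by [s ^+ 2 * t], so the moment
    generating function needs only the total mass of the shifted density. *)
Lemma normal_pdf_tilt m s t x : s != 0 ->
  expR (t * x) * normal_pdf m s x =
  expR (m * t + s ^+ 2 * t ^+ 2 / 2) * normal_pdf (m + s ^+ 2 * t) s x.
Proof.
move=> s0; rewrite !normal_pdfE// /normal_fun mulrCA [RHS]mulrCA -!expRD.
by congr (_ * expR _); field.
Qed.

Lemma integral_normal_mgf m s t : s != 0 ->
  (\int[lebesgue_measure]_x (expR (t * x) * normal_pdf m s x)%:E =
   (expR (m * t + s ^+ 2 * t ^+ 2 / 2))%:E)%E.
Proof.
move=> s0; under eq_integral do rewrite normal_pdf_tilt// EFinM.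
rewrite ge0_integralZl//.
- by rewrite integral_normal_pdf mule1.
- by apply/measurable_EFinP; exact: measurable_normal_pdf.
- by move=> x _; rewrite lee_fin normal_pdf_ge0.
Qed.

Lemma normal_mgf m s t : s != 0 ->
  integrableR (normal_prob m s) (fun x => expR (t * x)) /\
  meanR (normal_prob m s) (fun x => expR (t * x)) = expR (m * t + s ^+ 2 * t ^+ 2 / 2).
Proof.
move=> s0; have mt : measurable_fun [set: R] (fun x => expR (t * x)).
  by apply: measurableT_comp => //; exact: measurable_funM.
apply: ge0_integral_meanR => //.
rewrite (@ge0_integral_density _ _ _ lebesgue_measure _ (normal_pdf m s))//.
- exact: integral_normal_mgf.
- exact: measurable_normal_pdf.
- by move=> x; exact: normal_pdf_ge0.
- exact/measurable_EFinP.
Qed.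

End NormalMgf.

Section Matrix2.
Context (F : fieldType).
Implicit Types (S : 'M[F]_2).

Lemma ord2P (k : 'I_2) : k = 0 \/ k = 1.
Proof. by case: k => [[|[|//]] k2]; [left | right]; apply/val_inj. Qed.

Lemma matrix2P S S' : S 0 0 = S' 0 0 -> S 0 1 = S' 0 1 -> S 1 0 = S' 1 0 ->
  S 1 1 = S' 1 1 -> S = S'.
Proof.
move=> e00 e01 e10 e11; apply/matrixP => i j.
by case: (ord2P i) => ->; case: (ord2P j) => ->.
Qed.

Lemma det2 S : \det S = S 0 0 * S 1 1 - S 0 1 * S 1 0.
Proof.
rewrite (expand_det_row _ 0) !big_ord_recl big_ord0 addr0 /cofactor !det_mx11 !mxE/=.
rewrite expr0 mul1r expr1 mulN1r mulrN.
rewrite (_ : lift 0 0 = 1 :> 'I_2); last exact/val_inj.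
by rewrite (_ : lift 1 0 = 0 :> 'I_2); last exact/val_inj.
Qed.

Lemma quad_invmx2 S (x : 'cV[F]_2) : \det S != 0 ->
  (x^T *m invmx S *m x) 0 0 =
  (S 1 1 * x 0 0 ^+ 2 - (S 0 1 + S 1 0) * (x 0 0 * x 1 0) + S 0 0 * x 1 0 ^+ 2) / \det S.
Proof.
move=> D0; have uS : S \in unitmx by rewrite unitmxE unitfE.
(* The adjugate of [S]. *)
pose B : 'M[F]_2 := \matrix_(i, j) if i == j then (if i == 0 then S 1 1 else S 0 0) else - S i j.
have -> : invmx S = (\det S)^-1 *: B.
  have SB : S *m B = (\det S)%:M.
    by apply: matrix2P; rewrite !mxE !big_ord_recl big_ord0 !mxE/= addr0 ?mulr1n ?mulr0n ?det2;
      rewrite (_ : lift 0 0 = 1 :> 'I_2) ?(_ : lift 1 0 = 0 :> 'I_2); try exact/val_inj; ring.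
  by rewrite -[RHS](mulKmx uS) -scalemxAr SB scale_scalar_mx mulVf// mulmx1.
rewrite -scalemxAr -scalemxAl !mxE !big_ord_recl !big_ord0 !mxE !big_ord_recl !big_ord0 !mxE/= !addr0.
rewrite (_ : lift 0 0 = 1 :> 'I_2); last exact/val_inj.
by rewrite mulrC; congr (_ / _); ring.
Qed.

End Matrix2.

Section GaussianPlane.
Context (R : realType).
Local Notation C := (Cplx R).
Implicit Types (mu : probability (R * R)%type R) (S : 'M[R]_2) (s t : R).

Definition quad_form S s t := S 0 0 * s ^+ 2 + 2 * S 0 1 * (s * t) + S 1 1 * t ^+ 2.

(** The common interface of the limit laws: a law with density, a law on a line and a point mass all
    satisfy it, for a matrix [S] of rank 2, 1 and 0. *)
Definition gaussian_mgf S mu := forall s t,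
  integrableR mu (fun x => expR (s * x.1 + t * x.2)) /\
  meanR mu (fun x => expR (s * x.1 + t * x.2)) = expR (quad_form S s t / 2).

Lemma measurable_lin s t : measurable_fun setT (fun x : R * R => s * x.1 + t * x.2).
Proof. by apply: measurable_funD; apply: measurable_funM. Qed.

(** The linear form [s x.1 + t x.2] reduces the claim to [gauss_cmgf] in one dimension, evaluated at
    ['i]. *)
Lemma gaussian_charfun S mu s t : gaussian_mgf S mu -> 0 <= quad_form S s t ->
  expectationC mu (fun x => cis (s * x.1 + t * x.2)) = cexp (- (quad_form S s t / 2)%:C).
Proof.
move=> muS q0.
have muE a := muS (a * s) (a * t).
have linE a x : a * s * x.1 + a * t * x.2 = a * (s * x.1 + t * x.2) :> R by ring.
have := @gauss_cmgf _ _ _ mu (fun x => s * x.1 + t * x.2) (quad_form S s t)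
  (measurable_lin s t) q0 _ _ 'i.
rewrite sqr_i mulrN1; apply=> a.
- by have [h _] := muE a; apply: eq_integrableR h => x; rewrite linE.
- have [_ h] := muE a; rewrite (eq_meanR _ (g := fun x => expR (a * s * x.1 + a * t * x.2))); last first.
    by move=> x; rewrite linE.
  by rewrite h /quad_form; congr expR; ring.
Qed.

Lemma gaussian_second_moment S mu : gaussian_mgf S mu ->
  integrableR mu (fun x => x.1 ^+ 2 + x.2 ^+ 2).
Proof.
move=> muS.
have sq (X : R * R -> R) : measurable_fun setT X ->
    integrableR mu (fun x => expR (X x)) -> integrableR mu (fun x => expR (- X x)) ->
    integrableR mu (fun x => X x ^+ 2).
  move=> mX i1 i2; apply: (integrableR_pow 2 mX (ltr01)).
  apply: le_integrableR (integrableRD i1 i2).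
    by apply: measurableT_comp => //; apply: measurable_funM => //; exact: measurableT_comp.
  move=> x; rewrite mul1r ger0_norm ?expR_ge0//.
  case: (ger0P (X x)) => _; first by rewrite lerDl expR_ge0.
  by rewrite lerDr expR_ge0.
apply: integrableRD; apply: sq => //.
- by have [h _] := muS 1 0; apply: eq_integrableR h => x; rewrite mul1r mul0r addr0.
- by have [h _] := muS (-1) 0; apply: eq_integrableR h => x; rewrite mulN1r mul0r addr0.
- by have [h _] := muS 0 1; apply: eq_integrableR h => x; rewrite mul1r mul0r add0r.
- by have [h _] := muS 0 (-1); apply: eq_integrableR h => x; rewrite mulN1r mul0r add0r.
Qed.

Section LineNormal.
Variables (sigma a b : R).
Hypothesis sigma0 : sigma != 0.

(* [normal_prob] lives on [measurableTypeR R], whose display differs from that of [R]. *)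
Definition line_map (x : measurableTypeR R) : R * R := (a * x, b * x).

Lemma measurable_line_map : measurable_fun setT line_map.
Proof.
by apply: measurable_fun_pair; apply: measurable_funM.
Qed.

Definition line_rv : {RV (normal_prob 0 sigma) >-> (R * R)%type} :=
  HB.pack line_map (isMeasurableFun.Build _ _ _ _ line_map measurable_line_map).

Definition line_normal : probability (R * R)%type R :=
  distribution (normal_prob 0 sigma) line_rv.

Lemma line_normalE (A : set (R * R)) : line_normal A = normal_prob 0 sigma (line_map @^-1` A).
Proof. by []. Qed.

Lemma line_normal_mgf S : S 0 0 = sigma ^+ 2 * a ^+ 2 -> S 0 1 = sigma ^+ 2 * (a * b) ->
  S 1 1 = sigma ^+ 2 * b ^+ 2 -> gaussian_mgf S line_normal.
Proof.
move=> S00 S01 S11 s t.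
have [i1 e1] := normal_mgf 0 (s * a + t * b) sigma0.
have mE : measurable_fun setT (fun x : R * R => expR (s * x.1 + t * x.2)).
  by apply: measurableT_comp => //; exact: measurable_lin.
apply: ge0_integral_meanR => //.
rewrite ge0_integral_distribution//; last exact/measurable_EFinP.
transitivity (\int[normal_prob 0 sigma]_x (expR ((s * a + t * b) * x))%:E)%E.
  by apply: eq_integral => x _ /=; congr (expR _)%:E; ring.
rewrite meanR_ge0_integral// e1; congr (expR _)%:E.
by rewrite /quad_form S00 S01 S11; field.
Qed.

End LineNormal.

Lemma measurable_idTypeR : measurable_fun [set: measurableTypeR R] (fun x => x : R).
Proof. by move=> _ Y mY; rewrite setTI preimage_id. Qed.

Definition id_rv m sigma : {RV (normal_prob m sigma) >-> R} :=
  HB.pack (fun x : measurableTypeR R => x : R)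
    (isMeasurableFun.Build _ _ _ _ _ measurable_idTypeR).

Definition normal1 m sigma : probability R R :=
  distribution (normal_prob m sigma) (id_rv m sigma).

Lemma is_normal1_normal1 m sigma : 0 < sigma -> is_normal1 (normal1 m sigma).
Proof. by move=> s0; exists m, sigma. Qed.

Lemma degenerate_dirac (c : R) : degenerate (\d_c : probability R R).
Proof. by exists c; rewrite /= diracE in_set1 eqxx. Qed.

Lemma line_normal10 sigma (A B : set R) : measurable A -> measurable B ->
  line_normal sigma 1 0 (A `*` B) = (normal1 0 sigma A * \d_(0%R : R) B)%E.
Proof.
move=> mA mB; rewrite line_normalE diracE.
have -> : line_map 1 0 @^-1` (A `*` B) = if 0 \in B then A else set0.
  apply/seteqP; split => x; rewrite /line_map/= mul1r mul0r.
    by move=> [Ax /mem_set ->].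
  by case: ifPn => // /set_mem.
by case: (0 \in B); rewrite ?measure0 ?mule1 ?mule0.
Qed.

Lemma line_normal01 sigma (A B : set R) : measurable A -> measurable B ->
  line_normal sigma 0 1 (A `*` B) = (\d_(0%R : R) A * normal1 0 sigma B)%E.
Proof.
move=> mA mB; rewrite line_normalE diracE.
have -> : line_map 0 1 @^-1` (A `*` B) = if 0 \in A then B else set0.
  apply/seteqP; split => x; rewrite /line_map/= mul1r mul0r.
    by move=> [/mem_set -> Bx].
  by case: ifPn => // /set_mem.
by case: (0 \in A); rewrite ?measure0 ?mul1e ?mul0e.
Qed.

Lemma independent_of_product mu (nu1 nu2 : probability R R) :
  (forall A B, measurable A -> measurable B -> mu (A `*` B) = (nu1 A * nu2 B)%E) ->
  independent_components mu.
Proof.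
move=> muE A B mA mB; rewrite !muE//.
by rewrite [X in (_ * X * _)%E]probability_setT [X in (_ * (X * _))%E]probability_setT mule1 mul1e.
Qed.

(** The boolean selects the axis carrying the normal factor. Product form is checked on rectangles
    and extended by uniqueness of the product measure. *)
Lemma line_normal_axis sigma (b : bool) : 0 < sigma ->
  normal_times_degenerate (line_normal sigma b%:R (~~ b)%:R) /\
  independent_components (line_normal sigma b%:R (~~ b)%:R).
Proof.
move=> s0; have n1 := is_normal1_normal1 0 s0; have d0 := degenerate_dirac 0.
case: b => /=; split.
- exists (normal1 0 sigma), (\d_(0 : R)); split; first by left.
  by move=> A mA; apply/esym/product_measure_unique => // B D mB mD; exact: line_normal10.
- exact: independent_of_product (line_normal10 sigma).
- exists (\d_(0 : R)), (normal1 0 sigma); split; first by right.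
  by move=> A mA; apply/esym/product_measure_unique => // B D mB mD; exact: line_normal01.
- exact: independent_of_product (line_normal01 sigma).
Qed.

Lemma line_normal_slanted sigma (b : R) : 0 < sigma -> b != 0 ->
  (exists nu, normal_times_degenerate nu /\ linear_image nu (line_normal sigma 1 b)) /\
  linearly_related (line_normal sigma 1 b).
Proof.
move=> s0 b0; split.
  exists (line_normal sigma 1 0); split; first by case: (@line_normal_axis sigma true s0).
  (* A shear of determinant 1 sending the first axis to the line of slope [b]. *)
  exists (\matrix_(i, j) if i == j then 1 else if i == 0 then 0 else b); split.
    by rewrite unitmxE det2 !mxE/= mulr1 mul0r subr0 unitr1.
  move=> A mA; rewrite line_normalE /pushforward line_normalE; congr (normal_prob _ _ _).
  apply/funext => x; rewrite /preimage /line_map /mulmx2 !mxE/=; congr A.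
  by congr pair; ring.
exists b; split => //; rewrite line_normalE -[RHS](@probability_setT _ _ _ (normal_prob 0 sigma)).
congr (normal_prob _ _ _); apply/seteqP; split => // x _ /=.
by rewrite mul1r.
Qed.

Lemma degenerate_dirac2 (c : R * R) : degenerate (\d_c : probability (R * R)%type R).
Proof. by exists c; rewrite /= diracE in_set1 eqxx. Qed.

Lemma dirac_mgf S : S = 0 -> gaussian_mgf S (\d_(0 : R * R) : probability (R * R)%type R).
Proof.
move=> -> s t; have mE : measurable_fun setT (fun x : R * R => expR (s * x.1 + t * x.2)).
  by apply: measurableT_comp => //; exact: measurable_lin.
apply: ge0_integral_meanR => //.
rewrite integral_dirac//; last exact/measurable_EFinP.
by rewrite diracT mul1e /quad_form !mxE/=; congr (expR _)%:E; ring.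
Qed.

End GaussianPlane.

Section NonDegenerateNormal.
Context (R : realType).
Variable S : 'M[R]_2.
Hypotheses (symS : S 1 0 = S 0 1) (S00 : 0 < S 0 0) (detS : 0 < \det S).
Local Notation leb := (@lebesgue_measure R).

(** [b] is the regression coefficient of the second coordinate on the first, [s1] the standard
    deviation of the first, and [s2] the conditional standard deviation of the second, its square
    being the Schur complement of [S 0 0]. *)
Let b := S 0 1 / S 0 0.
Let s1 := Num.sqrt (S 0 0).
Let s2 := Num.sqrt (\det S / S 0 0).

Let s1_neq0 : s1 != 0.
Proof. by rewrite gt_eqF// sqrtr_gt0. Qed.

Let s2_neq0 : s2 != 0.
Proof. by rewrite gt_eqF// sqrtr_gt0 divr_gt0. Qed.

Let s1E : s1 ^+ 2 = S 0 0.
Proof. by rewrite sqr_sqrtr// ltW. Qed.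

Let s2E : s2 ^+ 2 = S 1 1 - b * S 0 1.
Proof.
rewrite sqr_sqrtr; last by rewrite divr_ge0// ltW.
by rewrite det2 symS /b; field; rewrite gt_eqF.
Qed.

(* The second factor is the density of [y] conditionally on [x]. *)
Lemma normal2_pdf_factor x y :
  normal2_pdf S (x, y) = normal_pdf 0 s1 x * normal_pdf (b * x) s2 y.
Proof.
rewrite !normal_pdfE//= /normal2_pdf mulNr quad_invmx2 ?gt_eqF// !mxE/= /normal_peak.
rewrite /normal_fun mulrACA -expRD -invfM -sqrtrM; last first.
  by rewrite mulrn_wge0// mulr_ge0 ?sqr_ge0// pi_ge0.
have s2D : s2 ^+ 2 = \det S / S 0 0 by rewrite sqr_sqrtr// divr_ge0// ltW.
have S00n : S 0 0 != 0 by rewrite gt_eqF.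
have Dn : \det S != 0 by rewrite gt_eqF.
congr (_^-1 * expR _).
  rewrite s1E s2D; have -> : S 0 0 * pi *+ 2 * (\det S / S 0 0 * pi *+ 2) = (2 * pi) ^+ 2 * \det S.
    by move: (S 0 0) (\det S) pi S00n => u D p u0; field.
  by rewrite sqrtrM ?sqr_ge0// sqrtr_sqr ger0_norm// mulr_ge0// pi_ge0.
rewrite s1E s2D subr0 /b symS.
rewrite (_ : S 1 1 = (\det S + S 0 1 ^+ 2) / S 0 0); last first.
  by rewrite det2 symS; field.
by move: (S 0 0) (S 0 1) (\det S) S00n Dn => u v D u0 D0; field; rewrite u0.
Qed.

Lemma normal2_pdf_ge0 z : 0 <= normal2_pdf S z.
Proof.
by case: z => x y; rewrite normal2_pdf_factor mulr_ge0// normal_pdf_ge0.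
Qed.

Let mfst : measurable_fun [set: measurableTypeR R * measurableTypeR R] (fun z => z.1 : R).
Proof. exact: measurable_fst. Qed.

Let msnd : measurable_fun [set: measurableTypeR R * measurableTypeR R] (fun z => z.2 : R).
Proof. exact: measurable_snd. Qed.

Lemma measurable_normal2_pdf :
  measurable_fun [set: measurableTypeR R * measurableTypeR R] (normal2_pdf S).
Proof.
rewrite (_ : normal2_pdf S = fun z => (2 * pi * Num.sqrt (\det S))^-1 *
  expR (- ((S 1 1 * z.1 ^+ 2 - (S 0 1 + S 1 0) * (z.1 * z.2) + S 0 0 * z.2 ^+ 2) / \det S) / 2)).
  apply: measurable_funM => //; apply: measurableT_comp => //.
  apply: measurable_funM => //; apply: measurableT_comp => //; apply: measurable_funM => //.
  apply: measurable_funD; last by apply: measurable_funM => //; exact: measurable_funX.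
  apply: measurable_funB; apply: measurable_funM => //; first exact: measurable_funX.
  exact: measurable_funM.
by apply/funext => -[x y]; rewrite /normal2_pdf/= quad_invmx2 ?gt_eqF// !mxE.
Qed.

(** By Tonelli, [y] is integrated first: its conditional mean [b * x] turns the exponent [s] of [x]
    into [s + t * b], and a one-dimensional Gaussian integral remains. *)
Lemma integral_normal2_mgf (s t : R) :
  (\int[leb \x leb]_z (expR (s * z.1 + t * z.2) * normal2_pdf S z)%:E =
   (expR (quad_form S s t / 2))%:E)%E.
Proof.
have me : measurable_fun [set: measurableTypeR R * measurableTypeR R]
    (fun z => (expR (s * z.1 + t * z.2) * normal2_pdf S z)%:E).
  apply/measurable_EFinP/measurable_funM; last exact: measurable_normal2_pdf.
  apply: measurableT_comp => //; apply: measurable_funD; exact: measurable_funM.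
rewrite fubini_tonelli1//; last first.
  by move=> z; rewrite lee_fin mulr_ge0 ?expR_ge0 ?normal2_pdf_ge0.
transitivity (\int[leb]_x ((expR (s2 ^+ 2 * t ^+ 2 / 2))%:E *
    (expR ((s + t * b) * x) * normal_pdf 0 s1 x)%:E))%E.
  apply: eq_integral => x _; rewrite /fubini_F.
  transitivity (\int[leb]_y ((expR (s * x) * normal_pdf 0 s1 x)%:E *
      (expR (t * y) * normal_pdf (b * x) s2 y)%:E))%E.
    apply: eq_integral => y _; rewrite normal2_pdf_factor expRD/= -EFinM; congr _%:E.
    by rewrite mulrACA.
  rewrite ge0_integralZl//.
  - rewrite integral_normal_mgf// -!EFinM; congr _%:E.
    rewrite [RHS]mulrA mulrAC -!expRD; congr (expR _ * _).
    by move: (x : R) => x'; ring.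
  - apply/measurable_EFinP/measurable_funM; last exact: measurable_normal_pdf.
    by apply: measurableT_comp => //; exact: measurable_funM.
  - by move=> y _; rewrite lee_fin mulr_ge0 ?expR_ge0 ?normal_pdf_ge0.
  - by rewrite lee_fin mulr_ge0 ?expR_ge0 ?normal_pdf_ge0.
rewrite ge0_integralZl//.
- rewrite integral_normal_mgf// -EFinM -expRD; congr (expR _)%:E.
  by rewrite s1E s2E /quad_form /b; field; rewrite gt_eqF.
- apply/measurable_EFinP/measurable_funM; last exact: measurable_normal_pdf.
  by apply: measurableT_comp => //; exact: measurable_funM.
- by move=> y _; rewrite lee_fin mulr_ge0 ?expR_ge0 ?normal_pdf_ge0.
Qed.

Definition normal2_prob : set (measurableTypeR R * measurableTypeR R) -> \bar R :=
  fun A => (\int[leb \x leb]_(z in A) (normal2_pdf S z)%:E)%E.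

Let normal2_0 : normal2_prob set0 = 0%E.
Proof. by rewrite /normal2_prob integral_set0. Qed.

Let normal2_ge0 A : (0 <= normal2_prob A)%E.
Proof. by apply: integral_ge0 => z _; rewrite lee_fin normal2_pdf_ge0. Qed.

Let normal2_sigma_additive : semi_sigma_additive normal2_prob.
Proof.
move=> /= F mF tF mUF; rewrite /normal2_prob; apply: cvg_toP.
  apply: ereal_nondecreasing_is_cvgn => m n mn.
  apply: lee_sum_nneg_natr => // k _ _.
  by apply: integral_ge0 => z _; rewrite lee_fin normal2_pdf_ge0.
rewrite ge0_integral_bigcup//=.
- apply: measurable_funTS; apply/measurable_EFinP; exact: measurable_normal2_pdf.
- by move=> x _; rewrite lee_fin normal2_pdf_ge0.
Qed.

HB.instance Definition _ := isMeasure.Build _ _ _ normal2_prob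
  normal2_0 normal2_ge0 normal2_sigma_additive.

Let normal2_setT : normal2_prob [set: _] = 1%E.
Proof.
have := integral_normal2_mgf 0 0; rewrite /quad_form !(expr0n, mulr0, mul0r, addr0) expR0 => <-.
by apply: eq_integral => z _; rewrite !mul0r addr0 expR0 mul1r.
Qed.

HB.instance Definition _ :=
  @Measure_isProbability.Build _ _ R normal2_prob normal2_setT.

Let measurable_id2 : measurable_fun [set: measurableTypeR R * measurableTypeR R]
  (fun z => z : R * R).
Proof. by move=> _ Y mY; rewrite setTI preimage_id. Qed.

(** The measure lives on the product of two copies of [measurableTypeR R]; the identity carries it
    to [R * R], changing only the display. *)
Definition id2_rv : {RV normal2_prob >-> (R * R)%type} :=
  HB.pack (fun z : measurableTypeR R * measurableTypeR R => z : R * R)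
    (isMeasurableFun.Build _ _ _ _ _ measurable_id2).

Definition normal2 : probability (R * R)%type R := distribution normal2_prob id2_rv.

Lemma is_normal2_normal2 : is_normal2 S normal2.
Proof. by []. Qed.

Lemma normal2_mgf : gaussian_mgf S normal2.
Proof.
move=> s t; have mE : measurable_fun setT (fun x : R * R => expR (s * x.1 + t * x.2)).
  by apply: measurableT_comp => //; exact: measurable_lin.
apply: ge0_integral_meanR => //.
rewrite ge0_integral_distribution//; last exact/measurable_EFinP.
rewrite (@ge0_integral_density _ _ _ (leb \x leb)%E _ (normal2_pdf S))//.
- exact: integral_normal2_mgf.
- exact: measurable_normal2_pdf.
- exact: normal2_pdf_ge0.
- exact/measurable_EFinP.
- by move=> z; rewrite lee_fin expR_ge0.
Qed.

End NonDegenerateNormal.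

(** * Quasi-powers in two dimensions *)

Section QuasiPowerTheorem.
Variables (R : realType) (d : nat -> measure_display)
  (T : forall n, measurableType (d n)) (P : forall n, probability (T n) R)
  (Omega : forall n, 'I_2 -> {RV (P n) >-> R})
  (u v : 'cV[Cplx R]_2 -> Cplx R) (Phi kappa : nat -> R) (tau : R)
  (err : nat -> 'cV[Cplx R]_2 -> Cplx R) (K : R).
Local Notation C := (Cplx R).
Hypotheses (tau_gt0 : 0 < tau)
  (u_analytic : forall s : 'cV[C]_2, `|s| <= (tau%:C : C) -> analytic_at u s)
  (v_analytic : forall s : 'cV[C]_2, `|s| <= (tau%:C : C) -> analytic_at v s)
  (Phi_infty : Phi n @[n --> \oo] --> +oo)
  (kappa_infty : kappa n @[n --> \oo] --> +oo)
  (mgf_exists : forall n (s : 'cV[C]_2), `|s| <= (tau%:C : C) ->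
    integrableC (P n) (exp_pairing (Omega n) s))
  (mgfE : forall n (s : 'cV[C]_2), `|s| <= (tau%:C : C) ->
    expectationC (P n) (exp_pairing (Omega n) s) =
    cexp (u s * (Phi n)%:C + v s) * (1 + err n s))
  (errK : \forall n \near \oo, forall s : 'cV[C]_2, `|s| <= (tau%:C : C) ->
    `|err n s| <= ((K * (kappa n)^-1)%:C : C)).
Variables (cu cv : nat -> nat -> C) (rhou rhov Mu Mv : R).
Hypotheses (psu : power_series2 (fun x y => u (vec2 x y + 0)) cu rhou Mu)
  (psv : power_series2 (fun x y => v (vec2 x y + 0)) cv rhov Mv).
Implicit Types (n : nat) (a b : R) (z : C) (c : nat -> nat -> C).

Let X n a b (w : T n) : R := a * Omega n 0 w + b * Omega n 1 w.

Let mX n a b : measurable_fun setT (@X n a b).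
Proof. by apply: measurable_funD; apply: measurable_funM. Qed.

Let exp_pairing_line n a b z w :
  exp_pairing (Omega n) (z *: vec2 a%:C b%:C) w = cexp (z * (X a b w)%:C).
Proof.
rewrite /exp_pairing !big_ord_recl big_ord0 !mxE/= addr0 /X rmorphD !rmorphM/=.
by rewrite (_ : lift 0 0 = 1 :> 'I_2); [congr cexp; ring | exact/val_inj].
Qed.

Let line_norm a b z (h : R) : 0 <= h -> cabs z * (`|a| + `|b| + 1) <= h ->
  `|z *: vec2 a%:C b%:C| <= (h%:C : C).
Proof.
move=> h0 zh; rewrite vec2Z vec2_norm_le// !cabsM !cabs_real.
by split; apply: le_trans zh; rewrite ler_wpM2l ?cabs_ge0// -addrA ?lerDl ?lerDr ?addr_ge0//
  addrCA lerDl addr_ge0.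
Qed.

(** The exponential of an absolute value is at most the sum of the exponentials with both signs, and
    these are real instances of [mgf_exists]. *)
Let integrable_expR n a b (h : R) : h * (`|a| + `|b| + 1) <= tau -> 0 <= h ->
  integrableR (P n) (fun w => expR (h * `|X a b w|)).
Proof.
move=> htau h0.
have int (x : R) : `|x| = h -> integrableR (P n) (fun w => expR (x * X a b w)).
  move=> xh; have [] := @mgf_exists n (x%:C *: vec2 a%:C b%:C) _.
    by apply: line_norm; [exact: ltW | rewrite cabs_real xh].
  move=> + _; apply: eq_integrableR => w.
  by rewrite exp_pairing_line -rmorphM cexp_real.
apply: le_integrableR (integrableRD (int h _) (int (- h) _)).
- by apply: measurableT_comp => //; apply: measurable_funM => //; exact: measurableT_comp.
- move=> w; rewrite ger0_norm ?expR_ge0//.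
  case: (ger0P (X a b w)) => _; first by rewrite lerDl expR_ge0.
  by rewrite mulrN mulNr lerDr expR_ge0.
- by rewrite ger0_norm.
- by rewrite normrN ger0_norm.
Qed.

Let err' n (s : 'cV[C]_2) : C := (1 + err n s) / (1 + err n 0) - 1.

(** At [s = 0] the expectation is 1, so [1 + err n 0] is the inverse of
    [cexp (u 0 * (Phi n)%:C + v 0)]. It is thus nonzero for every [n], and [u 0] and [v 0] cancel
    whatever their values. *)
Let mgf_normalized n (s : 'cV[C]_2) : `|s| <= (tau%:C : C) ->
  expectationC (P n) (exp_pairing (Omega n) s) =
  cexp ((Phi n)%:C * (u s - u 0) + (v s - v 0)) * (1 + err' n s).
Proof.
move=> stau; rewrite mgfE//.
have : expectationC (P n) (exp_pairing (Omega n) 0) = 1.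
  rewrite (eq_expectationC _ (W := fun=> 1%:C)); last first.
    by move=> w; rewrite /exp_pairing big1 ?cexp0// => i _; rewrite mxE mulr0.
  by rewrite expectationC_real meanR_cst.
rewrite mgfE; last by rewrite normr0 ler0c ltW.
move=> e1; have e0 : 1 + err n 0 != 0.
  by apply: contra_eq_neq e1 => ->; rewrite mulr0 eq_sym oner_eq0.
have -> : cexp ((Phi n)%:C * (u s - u 0) + (v s - v 0)) =
    cexp (u s * (Phi n)%:C + v s) * (1 + err n 0).
  have c0 : cexp (u 0 * (Phi n)%:C + v 0) != 0.
    by rewrite -cabs_eq0 cabs_cexp gt_eqF ?expR_gt0.
  have <- : (cexp (u 0 * (Phi n)%:C + v 0))^-1 = 1 + err n 0.
    by apply: (mulfI c0); rewrite e1 mulfV.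
  by rewrite -cexpN -cexpD; congr cexp; ring.
by rewrite /err' addrCA subrr addr0 -mulrA (mulrCA (1 + err n 0)) divff// mulr1.
Qed.

Let err'_le : exists2 K', 0 <= K' & \forall n \near \oo, 1 <= kappa n /\
  forall s : 'cV[C]_2, `|s| <= (tau%:C : C) -> cabs (err' n s) <= K' / kappa n.
Proof.
(* Once [kappa n] is at least twice the absolute value of [K], the error at 0 is at most 1/2, so
   division by [1 + err n 0] costs a factor 2; the difference of two errors costs another. *)
exists (4 * `|K|); first by rewrite mulr_ge0.
have k1 : \forall n \near \oo, Num.max 1 (2 * `|K|) <= kappa n.
  by move/cvgryPge : kappa_infty; exact.
near=> n.
have : Num.max 1 (2 * `|K|) <= kappa n by near: n.
rewrite ge_max => /andP[kn1 knK]; split => // s stau.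
have kn0 : 0 < kappa n := lt_le_trans ltr01 kn1.
have bd s' : `|s'| <= (tau%:C : C) -> cabs (err n s') <= `|K| / kappa n.
  move=> s'tau; have : `|err n s'| <= ((K * (kappa n)^-1)%:C : C).
    by move: s' s'tau; near: n.
  rewrite cabsE lecR => /le_trans; apply.
  by rewrite ler_wpM2r ?ler_norm// invr_ge0 ltW.
have b0 : cabs (err n 0) <= `|K| / kappa n by apply: bd; rewrite normr0 ler0c ltW.
have half : `|K| / kappa n <= 2^-1.
  by rewrite ler_pdivrMr// mulrC ler_pdivlMr// mulrC.
have e0 : 2^-1 <= cabs (1 + err n 0).
  have := cabsB (1 + err n 0) (err n 0); rewrite addrK cabs1 => h.
  by have := le_trans b0 half; lra.
have e00 : 1 + err n 0 != 0 by rewrite -cabs_eq0 gt_eqF// (lt_le_trans _ e0)// invr_gt0.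
rewrite (_ : err' n s = (err n s - err n 0) / (1 + err n 0)); last first.
  by rewrite /err'; field.
rewrite cabsM cabsV.
apply: (@le_trans _ _ ((`|K| / kappa n + `|K| / kappa n) * 2)).
  apply: ler_pM; rewrite ?cabs_ge0 ?invr_ge0 ?cabs_ge0//.
    by apply: le_trans (cabsB _ _) _; apply: lerD => //; exact: bd.
  by rewrite -[leRHS]invrK lef_pV2// posrE ?invr_gt0// (lt_le_trans _ e0)// invr_gt0.
by rewrite le_eqVlt; apply/orP; left; apply/eqP; ring.
Unshelve. all: by end_near. Qed.

Let lin c a b : C := c 1%N 0%N * a%:C + c 0%N 1%N * b%:C.

Let quad c a b : C :=
  2 * (c 2%N 0%N * a%:C ^+ 2 + c 1%N 1%N * (a%:C * b%:C) + c 0%N 2%N * b%:C ^+ 2).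

(** The halves of [rhou] and [rhov] serve uniform convergence of the two series on the line;
    [tau / 4] leaves room for the exponential moment with [4 * r] asked by [quasi_power_moments]. *)
Let r a b : R := Num.min (Num.min (rhou / 2) (rhov / 2)) (tau / 4) / (`|a| + `|b| + 1).

Let m_gt0 a b : 0 < `|a| + `|b| + 1.
Proof. by rewrite ltr_wpDl// addr_ge0. Qed.

Let r_gt0 a b : 0 < r a b.
Proof.
have [rhou0 _ _] := psu; have [rhov0 _ _] := psv.
by rewrite divr_gt0// !lt_min !divr_gt0.
Qed.

Let rE a b : r a b * (`|a| + `|b| + 1) = Num.min (Num.min (rhou / 2) (rhov / 2)) (tau / 4).
Proof. by rewrite divfK// gt_eqF. Qed.

Let r_rho a b (rho : R) : r a b * (`|a| + `|b| + 1) <= rho ->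
  r a b * cabs (a%:C : C) <= rho /\ r a b * cabs (b%:C : C) <= rho.
Proof.
move=> h; rewrite !cabs_real; split; apply: le_trans h; rewrite ler_wpM2l ?(ltW (r_gt0 a b))//.
  by rewrite -addrA lerDl addr_ge0.
by rewrite -addrA addrCA lerDl addr_ge0.
Qed.

Let line_tau a b z : cabs z <= r a b -> `|z *: vec2 a%:C b%:C| <= (tau%:C : C).
Proof.
move=> zr; apply: line_norm; first exact: ltW.
apply: le_trans (_ : r a b * (`|a| + `|b| + 1) <= _); first by rewrite ler_wpM2r// ltW.
rewrite rE; apply: le_trans (_ : tau / 4 <= _); first by rewrite ge_min lexx orbT.
by rewrite ler_pdivrMr// ler_peMr ?(ltW tau_gt0)// ler1n.
Qed.

Let line_mgf n a b z : cabs z <= r a b ->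
  expectationC (P n) (fun w => cexp (z * (X a b w)%:C)) =
  cexp ((Phi n)%:C * (u (z *: vec2 a%:C b%:C) + - u 0) + (v (z *: vec2 a%:C b%:C) + - v 0))
    * (1 + err' n (z *: vec2 a%:C b%:C)).
Proof.
move=> zr; rewrite -mgf_normalized; last exact: line_tau.
by apply: eq_expectationC => w; rewrite exp_pairing_line.
Qed.

Let line_jet f c rho M a b : power_series2 (fun x y => f (vec2 x y + 0)) c rho M ->
  jet2 (fun z => f (z *: vec2 a%:C b%:C) + - f 0) 0 (lin c a b) (quad c a b / 2).
Proof.
move=> ps; have := jet2D (jet2_line a%:C b%:C ps) (jet2_cst (- f 0)).
by rewrite subrr !addr0 /quad [2 * _]mulrC mulfK.
Qed.

Let line_expR n a b : integrableR (P n) (fun w => expR (4 * r a b * `|X a b w|)).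
Proof.
apply: integrable_expR; last by rewrite mulr_ge0// ltW.
rewrite -mulrA rE; apply: le_trans (_ : 4 * (tau / 4) <= _).
  by rewrite ler_wpM2l// ge_min lexx orbT.
by rewrite mulrCA divff// mulr1.
Qed.

Let integrable_line_pow n a b k : integrableR (P n) (fun w => X a b w ^+ k).
Proof.
have r40 : 0 < 4 * r a b by rewrite mulr_gt0.
exact: integrableR_pow (@mX n a b) r40 (line_expR n a b).
Qed.

Let line_moments a b : exists2 B, 0 <= B & \forall n \near \oo,
  cabs ((meanR (P n) (X a b))%:C - ((Phi n)%:C * lin cu a b + lin cv a b)) <= B / kappa n /\
  cabs ((meanR (P n) (fun w => X a b w ^+ 2) - meanR (P n) (X a b) ^+ 2)%:C -
    ((Phi n)%:C * quad cu a b + quad cv a b)) <= B / kappa n.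
Proof.
have [K' K'0 errn] := err'_le; have r0 := r_gt0 a b.
exists (K' / r a b + (2 * (K' / r a b ^+ 2) + (K' / r a b) ^+ 2)).
  by rewrite !addr_ge0 ?mulr_ge0 ?sqr_ge0 ?invr_ge0 ?exprn_ge0 ?(ltW r0).
near=> n.
have [k1 errn'] : 1 <= kappa n /\
  forall s : 'cV[C]_2, `|s| <= (tau%:C : C) -> cabs (err' n s) <= K' / kappa n by near: n.
have k0 : 0 < kappa n := lt_le_trans ltr01 k1.
have [ru rv] : r a b * (`|a| + `|b| + 1) <= rhou / 2 /\ r a b * (`|a| + `|b| + 1) <= rhov / 2.
  by rewrite rE !ge_min !lexx ?orbT.
have [ru1 ru2] := r_rho ru; have [rv1 rv2] := r_rho rv.
have [] := quasi_power_moments (@mX n a b) r0 (line_expR n a b) (@line_mgf n a b)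
  (fun z zr => errn' _ (line_tau zr))
  (disc_approxD (disc_approx_line (ltW r0) psu ru1 ru2) (disc_approx_cst _ _))
  (disc_approxD (disc_approx_line (ltW r0) psv rv1 rv2) (disc_approx_cst _ _))
  (line_jet a b psu) (line_jet a b psv).
rewrite !(mulrC 2 (_ / 2)) !divfK// => h1 h2; split.
  apply: le_trans h1 _; rewrite mulrAC ler_wpM2r ?invr_ge0 ?(ltW k0)// lerDl.
  by rewrite !addr_ge0 ?mulr_ge0 ?sqr_ge0 ?invr_ge0 ?exprn_ge0 ?(ltW r0).
apply: le_trans h2 _; rewrite [leRHS]mulrDl; apply: ler_wpDl.
  by apply: divr_ge0 (ltW k0); exact: divr_ge0 (ltW r0).
rewrite [leRHS]mulrDl; apply: lerD.
  by rewrite le_eqVlt; apply/orP; left; apply/eqP; ring.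
(* The squared error of the mean is of order [kappa n ^- 2], and [kappa n] is at least 1. *)
rewrite [K' / _ / _]mulrAC exprMn ler_wpM2l ?sqr_ge0//.
by rewrite expr2 ler_piMr ?invr_ge0 ?(ltW k0)// invf_le1.
Unshelve. all: by end_near. Qed.

(** A negative [x] would drive [Phi n * x + y] to minus infinity. Used with both signs it shows that
    imaginary parts vanish; used on variances it gives the positivity of the Hessian. *)
Let Phi_coef_ge0 (x y B : R) : (\forall n \near \oo, - B <= Phi n * x + y) -> 0 <= x.
Proof.
move=> h; rewrite leNgt; apply/negP => x0.
have [N] : exists n, - B <= Phi n * x + y /\ (y + B + 1) / - x <= Phi n.
  have h' : \forall n \near \oo, (y + B + 1) / - x <= Phi n by move/cvgryPge : Phi_infty; exact.
  by have [N _ /(_ N (leqnn N))] := filterI h h'; exists N.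
by rewrite ler_pdivrMr ?oppr_gt0// => -[h1 h2]; lra.
Qed.

Let kappa_ge1 : \forall n \near \oo, 1 <= kappa n.
Proof. by move/cvgryPge : kappa_infty; exact. Qed.

Let Im_coef_eq0 (x : nat -> R) (l h : C) (B : R) : 0 <= B ->
  (\forall n \near \oo, cabs ((x n)%:C - ((Phi n)%:C * l + h)) <= B / kappa n) ->
  complex.Im l = 0.
Proof.
move=> B0 hx.
have hI : \forall n \near \oo, `|Phi n * complex.Im l + complex.Im h| <= B.
  near=> n; have k1 : 1 <= kappa n by near: n.
  have : cabs ((x n)%:C - ((Phi n)%:C * l + h)) <= B / kappa n by near: n.
  move=> /(le_trans (Im_le_cabs _)); rewrite ImB ImD ImZ sub0r normrN => /le_trans; apply.
  by rewrite ler_pdivrMr ?(lt_le_trans ltr01)// ler_peMr.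
apply/eqP; rewrite eq_le -oppr_ge0; apply/andP; split.
  apply: (@Phi_coef_ge0 _ (- complex.Im h) B); apply: filterS hI => n.
  by rewrite ler_norml => /andP[_ h2]; lra.
apply: (@Phi_coef_ge0 _ (complex.Im h) B); apply: filterS hI => n.
by rewrite ler_norml => /andP[].
Unshelve. all: by end_near. Qed.

(** Real parts are taken before reality is established; [gradE] and [hessE] show that nothing is
    lost. *)
Let S : 'M[R]_2 := map_mx (@complex.Re R) (hessian u 0).
Let g : 'cV[R]_2 := map_mx (@complex.Re R) (gradient u 0).

Let Im0_eq (z : C) : complex.Im z = 0 -> z = (complex.Re z)%:C.
Proof. by case: z => x y /= ->. Qed.

Let Im_lin a b : complex.Im (lin cu a b) = 0.
Proof.
have [B B0 h] := line_moments a b; apply: Im_coef_eq0 B0 _.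
by apply: filterS h => n [h _]; exact: h.
Qed.

Let Im_quad a b : complex.Im (quad cu a b) = 0.
Proof.
have [B B0 h] := line_moments a b; apply: Im_coef_eq0 B0 _.
by apply: filterS h => n [_ h]; exact: h.
Qed.

Let hess c (f : 'cV[C]_2 -> C) rho M : power_series2 (fun x y => f (vec2 x y + 0)) c rho M ->
  (forall s : 'cV[C]_2, `|s| <= (tau%:C : C) -> analytic_at f s) ->
  [/\ hessian f 0 0 0 = quad c 1 0, hessian f 0 1 1 = quad c 0 1,
    hessian f 0 0 1 = (quad c 1 1 - quad c 1 0 - quad c 0 1) / 2 &
    hessian f 0 1 0 = (quad c 1 1 - quad c 1 0 - quad c 0 1) / 2].
Proof.
move=> ps fa; rewrite (hessian_power_series ps tau_gt0 fa) /quad !mxE/=; split; rewrite ?mxE//; by field.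
Qed.

Let grad c (f : 'cV[C]_2 -> C) rho M : power_series2 (fun x y => f (vec2 x y + 0)) c rho M ->
  gradient f 0 0 0 = lin c 1 0 /\ gradient f 0 1 0 = lin c 0 1.
Proof.
by move=> ps; rewrite (gradient_power_series ps) !mxE/= /lin; split; ring.
Qed.

Let SE i j : S i j = complex.Re (hessian u 0 i j).
Proof. by rewrite mxE. Qed.

Let gE i : g i 0 = complex.Re (gradient u 0 i 0).
Proof. by rewrite mxE. Qed.

Let gradE : gradient u 0 = map_mx (real_complex R) g.
Proof.
have [g0 g1] := grad psu; apply/colP => i; rewrite [RHS]mxE gE; apply: Im0_eq.
by case: (ord2P i) => ->; rewrite ?g0 ?g1 Im_lin.
Qed.

Let hessE : hessian u 0 = map_mx (real_complex R) S.
Proof.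
have [h00 h11 h01 h10] := hess psu u_analytic.
have I01 : complex.Im (hessian u 0 0 1) = 0.
  have := h01; rewrite (Im0_eq (Im_quad 1 1)) (Im0_eq (Im_quad 1 0)) (Im0_eq (Im_quad 0 1)) => ->.
  have -> : (2 : C)^-1 = (2^-1)%:C by rewrite fmorphV rmorph_nat.
  by rewrite mulrC ImZ !ImB/= !subrr mulr0.
by apply: matrix2P; rewrite [RHS]mxE SE; apply: Im0_eq; rewrite ?h10 -?h01 ?I01// ?h00 ?h11 Im_quad.
Qed.

Let linE a b : lin cu a b = (a * g 0 0 + b * g 1 0)%:C.
Proof.
have [g0 g1] := grad psu; move: g0 g1; rewrite gradE ![map_mx _ _ _ _]mxE /lin rmorphD !rmorphM/= => -> ->.
by ring.
Qed.

Let quadE a b : quad cu a b = (quad_form S a b)%:C.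
Proof.
have [h00 h11 h01 _] := hess psu u_analytic.
rewrite /quad_form !rmorphD !rmorphM/=.
move: h00 h11 h01; rewrite hessE ![map_mx _ _ _ _]mxE => -> -> ->; rewrite /quad.
by rewrite rmorph_nat; field.
Qed.

Let S_sym : S 1 0 = S 0 1.
Proof. by have [_ _ h01 h10] := hess psu u_analytic; rewrite !SE h01 h10. Qed.

Let mean n i := meanR (P n) (Omega n i).

Let cov n i j := meanR (P n) (fun w => Omega n i w * Omega n j w) - mean n i * mean n j.

Let Omega_line n i : Omega n i = X (i == 0)%:R (i == 1)%:R :> (T n -> R).
Proof.
by apply/funext => w; case: (ord2P i) => ->; rewrite /X/= ?mul1r ?mul0r ?addr0 ?add0r.
Qed.

Let integrable_Omega n i : integrableR (P n) (Omega n i).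
Proof.
rewrite Omega_line; apply: eq_integrableR (integrable_line_pow n _ _ 1) => w.
exact: expr1.
Qed.

Let integrable_mul n i j : integrableR (P n) (fun w => Omega n i w * Omega n j w).
Proof.
have sq k : integrableR (P n) (fun w => Omega n k w ^+ 2).
  by rewrite Omega_line; exact: integrable_line_pow.
apply: le_integrableR (integrableRD (sq i) (sq j)); first exact: measurable_funM.
move=> w; move: (Omega n i w) (Omega n j w) => x y.
by rewrite ler_norml; apply/andP; split; nra.
Qed.

Let mean_line n a b : meanR (P n) (X a b) = a * mean n 0 + b * mean n 1.
Proof. by rewrite /X meanRD ?meanRZ//; exact: integrableRZ. Qed.

Let var_line n a b : meanR (P n) (fun w => X a b w ^+ 2) - meanR (P n) (X a b) ^+ 2 =
  a ^+ 2 * cov n 0 0 + 2 * (a * b) * cov n 0 1 + b ^+ 2 * cov n 1 1.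
Proof.
rewrite mean_line (eq_meanR _ (g := fun w => a ^+ 2 * (Omega n 0 w * Omega n 0 w) +
  (2 * (a * b) * (Omega n 0 w * Omega n 1 w) + b ^+ 2 * (Omega n 1 w * Omega n 1 w)))); last first.
  by move=> w; rewrite /X; ring.
have i1 := integrableRZ (a ^+ 2) (integrable_mul n 0 0).
have i2 := integrableRZ (2 * (a * b)) (integrable_mul n 0 1).
have i3 := integrableRZ (b ^+ 2) (integrable_mul n 1 1).
rewrite meanRD//; last exact: integrableRD.
by rewrite meanRD// !meanRZ// /cov; ring.
Qed.

Let cov_sym n : cov n 1 0 = cov n 0 1.
Proof. by rewrite /cov (mulrC (mean n 1)); congr (_ - _); apply: eq_meanR => w; exact: mulrC. Qed.

Let mean_estimate i : exists2 B, 0 <= B & \forall n \near \oo,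
  cabs ((mean n i)%:C - ((Phi n)%:C * gradient u 0 i 0 + gradient v 0 i 0)) <= B / kappa n.
Proof.
have [gu0 gu1] := grad psu; have [gv0 gv1] := grad psv.
case: (ord2P i) => ->.
  have [B B0 h] := line_moments 1 0; exists B => //; apply: filterS h => n [h _].
  by move: h; rewrite mean_line mul1r mul0r addr0 -gu0 -gv0.
have [B B0 h] := line_moments 0 1; exists B => //; apply: filterS h => n [h _].
by move: h; rewrite mean_line mul1r mul0r add0r -gu1 -gv1.
Qed.

Let cov_estimate i j : exists2 B, 0 <= B & \forall n \near \oo,
  cabs ((cov n i j)%:C - ((Phi n)%:C * hessian u 0 i j + hessian v 0 i j)) <= B / kappa n.
Proof.
have [hu00 hu11 hu01 hu10] := hess psu u_analytic.
have [hv00 hv11 hv01 hv10] := hess psv v_analytic.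
have e00 : exists2 B, 0 <= B & \forall n \near \oo,
    cabs ((cov n 0 0)%:C - ((Phi n)%:C * quad cu 1 0 + quad cv 1 0)) <= B / kappa n.
  have [B B0 h] := line_moments 1 0; exists B => //; apply: filterS h => n [_].
  by rewrite var_line expr1n expr0n/= !(mulr0, mul0r, mul1r, addr0).
have e11 : exists2 B, 0 <= B & \forall n \near \oo,
    cabs ((cov n 1 1)%:C - ((Phi n)%:C * quad cu 0 1 + quad cv 0 1)) <= B / kappa n.
  have [B B0 h] := line_moments 0 1; exists B => //; apply: filterS h => n [_].
  by rewrite var_line expr1n expr0n/= !(mulr0, mul0r, mul1r, add0r).
have e01 : exists2 B, 0 <= B & \forall n \near \oo,
    cabs ((cov n 0 1)%:C - ((Phi n)%:C * ((quad cu 1 1 - quad cu 1 0 - quad cu 0 1) / 2) +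
      (quad cv 1 1 - quad cv 1 0 - quad cv 0 1) / 2)) <= B / kappa n.
  have [B1 B10 h1] := e00; have [B2 B20 h2] := e11; have [B3 B30 h3] := line_moments 1 1.
  exists (B3 + B1 + B2); first by rewrite !addr_ge0.
  near=> n.
  have k0 : 0 < kappa n by apply: lt_le_trans (ltr01) _; near: n.
  have g1 : cabs ((cov n 0 0)%:C - ((Phi n)%:C * quad cu 1 0 + quad cv 1 0)) <= B1 / kappa n.
    by near: n.
  have g2 : cabs ((cov n 1 1)%:C - ((Phi n)%:C * quad cu 0 1 + quad cv 0 1)) <= B2 / kappa n.
    by near: n.
  have [_] : cabs ((meanR (P n) (X 1 1))%:C - ((Phi n)%:C * lin cu 1 1 + lin cv 1 1)) <= B3 / kappa n /\
    cabs ((meanR (P n) (fun w => X 1 1 w ^+ 2) - meanR (P n) (X 1 1) ^+ 2)%:C -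
    ((Phi n)%:C * quad cu 1 1 + quad cv 1 1)) <= B3 / kappa n by near: n.
  rewrite var_line expr1n !mul1r mulr1.
  move: (quad cu 1 1) (quad cu 1 0) (quad cu 0 1) (quad cv 1 1) (quad cv 1 0) (quad cv 0 1) g1 g2.
  move: (cov n 0 0) (cov n 0 1) (cov n 1 1) (Phi n) => c0 c1 c2 phi qu1 qu2 qu3 qv1 qv2 qv3 g1 g2 g3.
  rewrite (_ : _ - _ = ((c0 + 2 * c1 + c2)%:C - (phi%:C * qu1 + qv1) -
    (c0%:C - (phi%:C * qu2 + qv2)) - (c2%:C - (phi%:C * qu3 + qv3))) / 2); last first.
    by rewrite !rmorphD rmorphM rmorph_nat; field.
  rewrite cabsM cabsV (cabs_nat _ 2) ler_pdivrMr//.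
  apply: le_trans (cabsB _ _) _; apply: le_trans (lerD (cabsB _ _) (lexx _)) _.
  apply: le_trans (lerD (lerD g3 g1) g2) _; rewrite -!mulrDl ler_peMr// ?ler1n//.
  by rewrite divr_ge0 ?(ltW k0)// !addr_ge0.
case: (ord2P i) => ->; case: (ord2P j) => ->.
- by have [B B0 h] := e00; exists B => //; apply: filterS h => n; rewrite -hu00 -hv00.
- by have [B B0 h] := e01; exists B => //; apply: filterS h => n; rewrite -hu01 -hv01.
- by have [B B0 h] := e01; exists B => //; apply: filterS h => n; rewrite cov_sym -hu10 -hv10.
- by have [B B0 h] := e11; exists B => //; apply: filterS h => n; rewrite -hu11 -hv11.
Unshelve. all: by end_near. Qed.

Let var_estimate i : exists2 B, 0 <= B & \forall n \near \oo,
  `|cov n i i - Phi n * S i i| <= B.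
Proof.
have [B B0 h] := cov_estimate i i.
exists (B + cabs (hessian v 0 i i)); first by rewrite addr_ge0 ?cabs_ge0.
near=> n; have k1 : 1 <= kappa n by near: n.
have : cabs ((cov n i i)%:C - ((Phi n)%:C * hessian u 0 i i + hessian v 0 i i)) <= B / kappa n.
  by near: n.
rewrite hessE [map_mx _ _ _ _]mxE => hn.
rewrite -cabs_real -(subrK (hessian v 0 i i) (_%:C)).
apply: le_trans (cabsD _ _) _; rewrite lerD2r rmorphB rmorphM/= -addrA -opprD.
by apply: le_trans hn _; rewrite ler_pdivrMr ?(lt_le_trans ltr01)// ler_peMr.
Unshelve. all: by end_near. Qed.

Let quad_form_ge0 a b : 0 <= quad_form S a b.
Proof.
have [B B0 h] := line_moments a b.
apply: (@Phi_coef_ge0 _ (complex.Re (quad cv a b)) B).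
near=> n; have k1 : 1 <= kappa n by near: n.
have [_] : cabs ((meanR (P n) (X a b))%:C - ((Phi n)%:C * lin cu a b + lin cv a b)) <= B / kappa n /\
  cabs ((meanR (P n) (fun w => X a b w ^+ 2) - meanR (P n) (X a b) ^+ 2)%:C -
    ((Phi n)%:C * quad cu a b + quad cv a b)) <= B / kappa n by near: n.
rewrite quadE => /(le_trans (Re_le_cabs _)).
rewrite ReB ReD ReZ/= => hn.
have var0 : 0 <= meanR (P n) (fun w => X a b w ^+ 2) - meanR (P n) (X a b) ^+ 2.
  set m := meanR (P n) (X a b).
  have -> : meanR (P n) (fun w => X a b w ^+ 2) - m ^+ 2 = meanR (P n) (fun w => (X a b w - m) ^+ 2).
    rewrite [RHS](eq_meanR _ (g := fun w => X a b w ^+ 2 + (- 2 * m * X a b w + m ^+ 2))); last first.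
      by move=> w; ring.
    have i2 : integrableR (P n) (X a b).
      by apply: eq_integrableR (integrable_line_pow n a b 1) => w; exact: expr1.
    have i3 := integrableRZ (- 2 * m) i2.
    have i4 := integrableR_cst (P n) (m ^+ 2); have i5 := integrableRD i3 i4.
    by rewrite meanRD// meanRD// meanRZ// meanR_cst -/m; ring.
  by apply: meanR_ge0 => w; exact: sqr_ge0.
have kB : B / kappa n <= B by rewrite ler_pdivrMr ?(lt_le_trans ltr01)// ler_peMr.
by move: hn; rewrite ler_norml => /andP[_ hn]; lra.
Unshelve. all: by end_near. Qed.

Let Y n := standardize (Phi n) g (Omega n).

Let mY n : measurable_fun setT (@Y n).
Proof.
by apply: measurable_fun_pair; apply: measurable_funM => //; exact: measurable_funB.
Qed.

Let charfun_limit t1 t2 (e : R) : 0 < e -> \forall n \near \oo,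
  cabs (expectationC (P n) (fun w => cis (t1 * (@Y n w).1 + t2 * (@Y n w).2)) -
    cexp (- (quad_form S t1 t2 / 2)%:C)) <= e.
Proof.
move=> e0; have [K' K'0 errn] := err'_le.
have := line_jet t1 t2 psu; rewrite linE quadE => ju.
have [L [eps0 [L0 eps00 h]]] := quasi_power_charfun (r_gt0 t1 t2) ju (line_jet t1 t2 psv) e0.
have LPhi : \forall n \near \oo, L <= Phi n by move/cvgryPge : Phi_infty; exact.
have keps : \forall n \near \oo, K' / eps0 <= kappa n by move/cvgryPge : kappa_infty; exact.
near=> n.
have [k1 errn'] : 1 <= kappa n /\
  forall s : 'cV[C]_2, `|s| <= (tau%:C : C) -> cabs (err' n s) <= K' / kappa n by near: n.
have k0 : 0 < kappa n := lt_le_trans ltr01 k1.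
have := h _ _ (P n) _ _ _ _ (@mX n t1 t2) (@line_mgf n t1 t2)
  (fun z zr => errn' _ (line_tau zr)).
have -> : (quad_form S t1 t2 / 2)%:C = (quad_form S t1 t2)%:C / 2.
  by rewrite rmorphM fmorphV rmorph_nat.
have Ln : L <= Phi n by near: n.
have epsn : K' / kappa n <= eps0.
  by rewrite ler_pdivrMr// mulrC -ler_pdivrMr//; near: n.
move=> /(_ Ln epsn); apply: le_trans; rewrite le_eqVlt; apply/orP; left; apply/eqP.
congr (cabs (_ - _)); apply: eq_expectationC => w; rewrite /cis /Y /standardize/= /X.
by congr (cexp (_ * _%:C)); ring.
Unshelve. all: by end_near. Qed.

Let mean_sqr_standardized n i : 0 < Phi n ->
  integrableR (P n) (fun w => ((Omega n i w - Phi n * g i 0) / Num.sqrt (Phi n)) ^+ 2) /\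
  meanR (P n) (fun w => ((Omega n i w - Phi n * g i 0) / Num.sqrt (Phi n)) ^+ 2) =
    (cov n i i + (mean n i - Phi n * g i 0) ^+ 2) / Phi n.
Proof.
move=> Phi0; set c := Phi n * g i 0.
have E w : ((Omega n i w - c) / Num.sqrt (Phi n)) ^+ 2 =
    (Phi n)^-1 * (Omega n i w * Omega n i w + (- 2 * c * Omega n i w + c ^+ 2)).
  by rewrite expr_div_n sqr_sqrtr ?(ltW Phi0)// mulrC; congr (_ * _); ring.
have i1 := integrable_mul n i i; have i2 := integrableRZ (- 2 * c) (integrable_Omega n i).
have i3 := integrableRD i2 (integrableR_cst (P n) (c ^+ 2)).
have i4 := integrableRD i1 i3.
split; first by apply: eq_integrableR (integrableRZ (Phi n)^-1 i4) => w; rewrite E.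
rewrite (eq_meanR _ E) meanRZ// meanRD// meanRD//; last exact: integrableR_cst.
by rewrite meanRZ// meanR_cst /cov -/(mean n i); ring.
Qed.

(** The second moment around [Phi n * g i 0] is the variance, of order [Phi n], plus the squared
    bias, which is bounded; division by [Phi n] leaves a bounded quantity. *)
Let second_moment i : exists2 D, 0 <= D & \forall n \near \oo,
  integrableR (P n) (fun w => ((Omega n i w - Phi n * g i 0) / Num.sqrt (Phi n)) ^+ 2) /\
  meanR (P n) (fun w => ((Omega n i w - Phi n * g i 0) / Num.sqrt (Phi n)) ^+ 2) <= D.
Proof.
have [B1 B10 h1] := var_estimate i; have [B2 B20 h2] := mean_estimate i.
pose B3 := B2 + cabs (gradient v 0 i 0).
have Phi1 : \forall n \near \oo, 1 <= Phi n by move/cvgryPge : Phi_infty; exact.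
exists (`|S i i| + B1 + B3 ^+ 2); first by rewrite !addr_ge0 ?sqr_ge0.
near=> n.
have Ph1 : 1 <= Phi n by near: n.
have Ph0 : 0 < Phi n := lt_le_trans ltr01 Ph1.
have [int ->] := mean_sqr_standardized i Ph0; split => //.
have k1 : 1 <= kappa n by near: n.
have g1 : `|cov n i i - Phi n * S i i| <= B1 by near: n.
have g2 : `|mean n i - Phi n * g i 0| <= B3.
  have : cabs ((mean n i)%:C - ((Phi n)%:C * gradient u 0 i 0 + gradient v 0 i 0)) <= B2 / kappa n.
    by near: n.
  rewrite gradE [map_mx _ _ _ _]mxE => hn.
  rewrite -cabs_real -(subrK (gradient v 0 i 0) (_%:C)).
  apply: le_trans (cabsD _ _) _; rewrite lerD2r rmorphB rmorphM/= -addrA -opprD.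
  by apply: le_trans hn _; rewrite ler_pdivrMr ?(lt_le_trans ltr01)// ler_peMr.
have g3 : (mean n i - Phi n * g i 0) ^+ 2 <= B3 ^+ 2 by rewrite -real_normK ?num_real// expr_le.
rewrite ler_pdivrMr//; apply: (@le_trans _ _ (Phi n * `|S i i| + B1 + B3 ^+ 2)).
  apply: lerD => //; have := ler_norm (S i i); move: g1; rewrite ler_norml => /andP[_ g1] g4.
  have : Phi n * S i i <= Phi n * `|S i i| by rewrite (ler_wpM2l (ltW Ph0)).
  by move: (Phi n * S i i) (Phi n * `|S i i|) g1 => p q; lra.
rewrite -addrA [leRHS]mulrC -addrA [leRHS]mulrDr lerD2l ler_peMl//.
by rewrite addr_ge0 ?sqr_ge0.
Unshelve. all: by end_near. Qed.

(** The step shared by all ranks: what remains in each case is to exhibit a law with moment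
    generating function exp(Q/2). *)
Let cvg_gaussian mu : gaussian_mgf S mu -> cvg_in_distribution P Y mu.
Proof.
move=> muS; apply: cvg_in_distribution_of_charfun => //.
  move=> t1 t2 e e0; have := charfun_limit t1 t2 e0; apply: filterS => n.
  by rewrite (gaussian_charfun muS (quad_form_ge0 t1 t2)).
have [D0 D00 h0] := second_moment 0; have [D1 D10 h1] := second_moment 1.
exists (D0 + D1 + meanR mu (fun x => x.1 ^+ 2 + x.2 ^+ 2)); split; last first.
  by split; [exact: gaussian_second_moment muS | rewrite lerDr addr_ge0].
near=> n.
have [i0 m0] : integrableR (P n) (fun w => ((Omega n 0 w - Phi n * g 0 0) / Num.sqrt (Phi n)) ^+ 2) /\
  meanR (P n) (fun w => ((Omega n 0 w - Phi n * g 0 0) / Num.sqrt (Phi n)) ^+ 2) <= D0 by near: n.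
have [i1 m1] : integrableR (P n) (fun w => ((Omega n 1 w - Phi n * g 1 0) / Num.sqrt (Phi n)) ^+ 2) /\
  meanR (P n) (fun w => ((Omega n 1 w - Phi n * g 1 0) / Num.sqrt (Phi n)) ^+ 2) <= D1 by near: n.
split; first exact: integrableRD i0 i1.
rewrite -[leLHS]/(meanR (P n) (fun w => ((Omega n 0 w - Phi n * g 0 0) / Num.sqrt (Phi n)) ^+ 2 +
  ((Omega n 1 w - Phi n * g 1 0) / Num.sqrt (Phi n)) ^+ 2)) meanRD//.
apply: le_trans (lerD m0 m1) _; rewrite lerDl.
by apply: meanR_ge0 => x; rewrite addr_ge0 ?sqr_ge0.
Unshelve. all: by end_near. Qed.

Let expectation_Omega n i : expectation (P n) (Omega n i) = (mean n i)%:E.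
Proof. exact: expectationE. Qed.

Let covariance_Omega n i j : covariance (P n) (Omega n i) (Omega n j) = (cov n i j)%:E.
Proof.
have L1 k : (Omega n k : T n -> R) \in Lfun (P n) 1 by apply/Lfun1_integrable/integrable_Omega.
rewrite covarianceE//; last exact/Lfun1_integrable/integrable_mul.
rewrite !expectation_Omega -EFinM /cov EFinB.
by rewrite -(expectationE (integrable_mul n i j)).
Qed.

Lemma quasi_power_expectation_fin_num n i : expectation (P n) (Omega n i) \is a fin_num.
Proof. by rewrite expectation_Omega. Qed.

Lemma quasi_power_covariance_fin_num n i j :
  covariance (P n) (Omega n i) (Omega n j) \is a fin_num.
Proof. by rewrite covariance_Omega. Qed.

Let mx_bigO p q (F : nat -> 'M[C]_(p, q)) (B : 'I_p -> 'I_q -> R) :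
  (forall i j, 0 <= B i j /\ \forall n \near \oo, cabs (F n i j) <= B i j / kappa n) ->
  F =O_\oo (fun n => ((kappa n)^-1)%:C : C).
Proof.
move=> FB; pose D := \sum_i \sum_j B i j + 1.
have BD i j : B i j <= D.
  apply: le_trans (_ : \sum_i \sum_j B i j <= _); last by rewrite lerDl.
  rewrite (bigD1 i)//= (bigD1 j)//= -addrA lerDl addr_ge0// ?sumr_ge0// => k _.
    by have [] := FB i k.
  by apply: sumr_ge0 => l _; have [] := FB k l.
have D0 : 0 < D.
  rewrite ltr_wpDl// sumr_ge0// => i _; rewrite sumr_ge0// => j _.
  by have [] := FB i j.
apply/eqO_exP; exists D%:C; first by rewrite ltcR.
have all_near : \forall n \near \oo, forall i j, cabs (F n i j) <= B i j / kappa n.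
  apply: filter_forall => i; apply: filter_forall => j.
  by have [] := FB i j.
near=> n.
have k0 : 0 < kappa n by apply: lt_le_trans (ltr01) _; near: n.
rewrite cabsE cabs_real ger0_norm ?invr_ge0 ?(ltW k0)// -rmorphM/=.
apply/mx_norm_leP => [|i j]; first by rewrite mulr_ge0 ?invr_ge0 ?(ltW k0) ?(ltW D0).
apply: (@le_trans _ _ (B i j / kappa n)); last by rewrite ler_wpM2r ?invr_ge0 ?(ltW k0).
by move: i j; near: n.
Unshelve. all: by end_near. Qed.

Lemma quasi_power_mean : (fun n => map_mx (real_complex R) (mean_vector (P n) (Omega n))
      - ((Phi n)%:C *: gradient u 0 + gradient v 0) : 'cV[C]_2)
    =O_\oo (fun n => ((kappa n)^-1)%:C : C).
Proof.
have /choice[B BE] : forall i, exists B, 0 <= B /\ \forall n \near \oo,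
    cabs ((mean n i)%:C - ((Phi n)%:C * gradient u 0 i 0 + gradient v 0 i 0)) <= B / kappa n.
  by move=> i; have [B B0 h] := mean_estimate i; exists B.
apply: (@mx_bigO _ _ _ (fun i _ => B i)) => i j; have [B0 h] := BE i; split => //.
apply: filterS h => n; rewrite ord1 [fun_of_matrix (_ - _) _ _]mxE
  [map_mx _ _ _ _]mxE [mean_vector _ _ _ _]mxE.
by rewrite [fun_of_matrix (- _) _ _]mxE [fun_of_matrix (_ + _) _ _]mxE [fun_of_matrix (_ *: _) _ _]mxE
  expectation_Omega.
Qed.

Lemma quasi_power_covariance : (fun n => map_mx (real_complex R) (covariance_matrix (P n) (Omega n))
      - ((Phi n)%:C *: hessian u 0 + hessian v 0) : 'M[C]_2)
    =O_\oo (fun n => ((kappa n)^-1)%:C : C).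
Proof.
have /choice[B BE] : forall ij : 'I_2 * 'I_2, exists B, 0 <= B /\ \forall n \near \oo,
    cabs ((cov n ij.1 ij.2)%:C - ((Phi n)%:C * hessian u 0 ij.1 ij.2 + hessian v 0 ij.1 ij.2))
      <= B / kappa n.
  by move=> [i j]; have [B B0 h] := cov_estimate i j; exists B.
apply: (@mx_bigO _ _ _ (fun i j => B (i, j))) => i j; have [B0 h] := BE (i, j); split => //.
apply: filterS h => n; rewrite [fun_of_matrix (_ - _) _ _]mxE
  [map_mx _ _ _ _]mxE [covariance_matrix _ _ _ _]mxE.
by rewrite [fun_of_matrix (- _) _ _]mxE [fun_of_matrix (_ + _) _ _]mxE [fun_of_matrix (_ *: _) _ _]mxE
  covariance_Omega.
Qed.

(** The variance is [Phi n * S i i] up to a bounded term and [Phi n] tends to infinity. This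
    translates the case distinction on variances into one on the diagonal of the Hessian. *)
Lemma quasi_power_variance_bounded i : (fun n => fine (variance (P n) (Omega n i))) =O_\oo (fun=> 1 : R) <->
  S i i = 0.
Proof.
have [B B0 h] := var_estimate i.
have Sii0 : 0 <= S i i.
  case: (ord2P i) => ->; [have := quad_form_ge0 1 0 | have := quad_form_ge0 0 1];
  by rewrite /quad_form !(expr1n, expr0n, mulr0, mul0r, mulr1, addr0, add0r).
split=> [/eqO_exP[k k0 hk]|S0].
  apply/eqP; rewrite eq_le Sii0 andbT -oppr_ge0.
  apply: (@Phi_coef_ge0 _ 0 (k + B)); near=> n.
  have g1 : `|cov n i i - Phi n * S i i| <= B by near: n.
  have : `|fine (variance (P n) (Omega n i))| <= k * `|1| by near: n.
  rewrite /variance covariance_Omega/= normr1 mulr1.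
  move: g1; rewrite !ler_norml => /andP[h1 h2] /andP[h3 h4].
  by move: (Phi n * S i i) (mulrN (Phi n) (S i i)) h1 h2 => p -> h1 h2; lra.
apply/eqO_exP; exists (B + 1); first by rewrite ltr_wpDl.
apply: filterS h => n; rewrite S0 mulr0 subr0 /variance covariance_Omega/= normr1 mulr1.
by move=> /le_trans; apply; rewrite lerDl.
Unshelve. all: by end_near. Qed.

Let S_ge0 i : 0 <= S i i.
Proof.
case: (ord2P i) => ->; [have := quad_form_ge0 1 0 | have := quad_form_ge0 0 1];
by rewrite /quad_form !(expr1n, expr0n, mulr0, mul0r, mulr1, addr0, add0r).
Qed.

(** A positive semidefinite form with a zero diagonal entry has zero off-diagonal entry. The test
    vectors avoid division: with [S 0 0 = 0] the first one gives [- (S 1 1 + 2) * S 0 1 ^+ 4], which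
    must be nonnegative. *)
Let S01_eq0 i : S i i = 0 -> S 0 1 = 0.
Proof.
move=> Sii; have := quad_form_ge0 (- (S 1 1 + 1) * S 0 1) (S 0 1 ^+ 2).
have := quad_form_ge0 (S 0 1 ^+ 2) (- (S 0 0 + 1) * S 0 1).
have S0 := S_ge0 0; have S1 := S_ge0 1; rewrite /quad_form => q1 q2.
have : S 0 1 ^+ 4 <= 0 -> S 0 1 = 0.
  by move=> h; apply/eqP; have := eq_le (S 0 1 ^+ 4) 0; rewrite h exprn_even_ge0// expf_eq0.
apply; move: q1 q2 S0 S1 Sii; case: (ord2P i) => ->;
  move: (S 0 0) (S 0 1) (S 1 1) => x y z q1 q2 x0 z0 e0; subst.
  have : 0 <= - (z + 2) * y ^+ 4 by apply: le_trans q2 _; rewrite le_eqVlt; apply/orP; left; apply/eqP; ring.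
  by rewrite mulNr oppr_ge0 pmulr_rle0// ltr_wpDl.
have : 0 <= - (x + 2) * y ^+ 4 by apply: le_trans q1 _; rewrite le_eqVlt; apply/orP; left; apply/eqP; ring.
by rewrite mulNr oppr_ge0 pmulr_rle0// ltr_wpDl.
Qed.

(** At the vector [(- S 0 1, S 0 0)] the form takes the value [S 0 0 * \det S]. *)
Let det_ge0 : 0 < S 0 0 -> 0 <= \det S.
Proof.
move=> S0; rewrite -(pmulr_rge0 _ S0) det2 S_sym.
apply: le_trans (quad_form_ge0 (- S 0 1) (S 0 0)) _.
by rewrite /quad_form le_eqVlt; apply/orP; left; apply/eqP; ring.
Qed.

Lemma quasi_power_regular : hessian u 0 \in unitmx ->
  exists mu, cvg_in_distribution P Y mu /\ is_normal2 S mu.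
Proof.
rewrite hessE map_unitmx unitmxE unitfE => D0.
have S0 : 0 < S 0 0.
  rewrite lt_neqAle S_ge0 andbT eq_sym; apply: contra_neq D0 => S0.
  by rewrite det2 S_sym (S01_eq0 S0) S0; ring.
have D : 0 < \det S by rewrite lt_neqAle det_ge0// andbT eq_sym.
exists (normal2 S_sym S0 D); split; last exact: is_normal2_normal2.
exact/cvg_gaussian/normal2_mgf.
Qed.

(** If [S 0 0] is zero, the limit lives on the second axis. Otherwise it is the law of a centred
    normal variable of variance [S 0 0] on the line of slope [S 0 1 / S 0 0]; as the determinant
    vanishes, this slope is zero exactly when [S 1 1] is. *)
Lemma quasi_power_rank1 : \rank (hessian u 0) = 1%N ->
  exists mu, cvg_in_distribution P Y mu /\
    ((exists i, S i i = 0) -> normal_times_degenerate mu /\ independent_components mu) /\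
    (~ (exists i, S i i = 0) ->
      (exists nu, normal_times_degenerate nu /\ linear_image nu mu) /\ linearly_related mu).
Proof.
rewrite hessE mxrank_map => r1.
have D0 : \det S = 0.
  apply/eqP; rewrite -[_ == 0]negbK -unitfE -unitmxE; apply/negP => /mxrank_unit.
  by rewrite r1.
have Snz : S != 0 by rewrite -mxrank_eq0 r1.
move: D0; rewrite det2 S_sym => D0.
have [S0|S0] := eqVneq (S 0 0) 0.
  have S01 := S01_eq0 S0.
  have S1 : 0 < S 1 1.
    rewrite lt_neqAle S_ge0 andbT eq_sym; apply: contra_neq Snz => S1.
    by apply: matrix2P; rewrite ?S_sym ?S0 ?S01 ?S1 mxE.
  have s1 : 0 < Num.sqrt (S 1 1) by rewrite sqrtr_gt0.
  exists (line_normal (Num.sqrt (S 1 1)) 0 1); split; last first.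
    split=> [_|[]]; last by exists 0.
    exact: (line_normal_axis false s1).
  apply: cvg_gaussian; apply: line_normal_mgf; rewrite ?gt_eqF//.
  - by rewrite S0 expr0n mulr0.
  - by rewrite S01 mul0r mulr0.
  - by rewrite sqr_sqrtr ?(ltW S1)// expr1n mulr1.
have S0p : 0 < S 0 0 by rewrite lt_neqAle S_ge0 andbT eq_sym.
have s0 : 0 < Num.sqrt (S 0 0) by rewrite sqrtr_gt0.
have S11 : S 1 1 = S 0 1 ^+ 2 / S 0 0.
  by apply: (mulfI S0); rewrite mulrCA divff// mulr1 expr2; apply/eqP; rewrite -subr_eq0 D0.
exists (line_normal (Num.sqrt (S 0 0)) 1 (S 0 1 / S 0 0)); split.
  apply: cvg_gaussian; apply: line_normal_mgf; rewrite ?gt_eqF//.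
  - by rewrite sqr_sqrtr ?(ltW S0p)// expr1n mulr1.
  - by rewrite sqr_sqrtr ?(ltW S0p)// mul1r mulrCA divff// mulr1.
  - by rewrite sqr_sqrtr ?(ltW S0p)// S11; field.
split=> [[i Sii]|nS].
  by rewrite (S01_eq0 Sii) mul0r; exact: (line_normal_axis true s0).
apply: line_normal_slanted => //; rewrite mulf_neq0 ?invr_eq0//.
by apply: contra_notN nS => /eqP S01; exists 1; rewrite S11 S01 expr0n mul0r.
Qed.

Lemma quasi_power_rank0 : \rank (hessian u 0) = 0%N ->
  exists mu, cvg_in_distribution P Y mu /\ degenerate mu.
Proof.
rewrite hessE mxrank_map => /eqP; rewrite mxrank_eq0 => /eqP S0.
exists \d_(0 : R * R); split; last exact: degenerate_dirac2.
exact/cvg_gaussian/dirac_mgf.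
Qed.

End QuasiPowerTheorem.

(** The assumption [mgf_exists] makes the expectations in the quasi-power hypothesis genuine
    integrals. Finiteness of the first and second moments is part of the conclusion because
    [mean_vector] and [covariance_matrix] are defined through [fine], which would hide infinite
    values. *)
Theorem theorem5p1 (R : realType) (d : nat -> measure_display)
    (T : forall n, measurableType (d n)) (P : forall n, probability (T n) R)
    (Omega : forall n, 'I_2 -> {RV (P n) >-> R})
    (u v : 'cV[Cplx R]_2 -> Cplx R) (Phi kappa : nat -> R) (tau : R)
    (tau_gt0 : 0 < tau)
    (u_analytic : forall s : 'cV[Cplx R]_2,
      `|s| <= (tau%:C : Cplx R) -> analytic_at u s)
    (v_analytic : forall s : 'cV[Cplx R]_2,
      `|s| <= (tau%:C : Cplx R) -> analytic_at v s)
    (Phi_infty : Phi n @[n --> \oo] --> +oo)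
    (kappa_infty : kappa n @[n --> \oo] --> +oo)
    (mgf_exists : forall n (s : 'cV[Cplx R]_2), `|s| <= (tau%:C : Cplx R) ->
      integrableC (P n) (exp_pairing (Omega n) s))
    (mgf_quasi_power : exists err : nat -> 'cV[Cplx R]_2 -> Cplx R,
      (forall n (s : 'cV[Cplx R]_2), `|s| <= (tau%:C : Cplx R) ->
        expectationC (P n) (exp_pairing (Omega n) s) =
        cexp (u s * (Phi n)%:C + v s) * (1 + err n s)) /\
      (exists K : R, \forall n \near \oo, forall s : 'cV[Cplx R]_2,
        `|s| <= (tau%:C : Cplx R) ->
        `|err n s| <= ((K * (kappa n)^-1)%:C : Cplx R))) :
  let Sigma : 'M[R]_2 := map_mx (@complex.Re R) (hessian u 0) in
  let Omega_star n := standardize (Phi n)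
    (map_mx (@complex.Re R) (gradient u 0)) (Omega n) in
  (forall n i, expectation (P n) (Omega n i) \is a fin_num) /\
  (forall n i j, covariance (P n) (Omega n i) (Omega n j) \is a fin_num) /\
  ((fun n => map_mx (real_complex R) (mean_vector (P n) (Omega n))
      - ((Phi n)%:C *: gradient u 0 + gradient v 0) : 'cV[Cplx R]_2)
    =O_\oo (fun n => ((kappa n)^-1)%:C : Cplx R)) /\
  ((fun n => map_mx (real_complex R) (covariance_matrix (P n) (Omega n))
      - ((Phi n)%:C *: hessian u 0 + hessian v 0) : 'M[Cplx R]_2)
    =O_\oo (fun n => ((kappa n)^-1)%:C : Cplx R)) /\
  (hessian u 0 \in unitmx ->
    exists mu, cvg_in_distribution P Omega_star mu /\ is_normal2 Sigma mu) /\
  (\rank (hessian u 0) = 1%N ->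
    exists mu, cvg_in_distribution P Omega_star mu /\
    ((exists i, (fun n => fine (variance (P n) (Omega n i))) =O_\oo (fun=> 1 : R)) ->
      normal_times_degenerate mu /\ independent_components mu) /\
    (~ (exists i, (fun n => fine (variance (P n) (Omega n i))) =O_\oo (fun=> 1 : R)) ->
      (exists nu, normal_times_degenerate nu /\ linear_image nu mu) /\
      linearly_related mu)) /\
  (\rank (hessian u 0) = 0%N ->
    exists mu, cvg_in_distribution P Omega_star mu /\ degenerate mu).
Proof.
have [err [mgfE [K errK]]] := mgf_quasi_power.
have origin : `|0 : 'cV[Cplx R]_2| <= (tau%:C : Cplx R) by rewrite normr0 ler0c ltW.
have [cu [rhou [Mu psu]]] := analytic_power_series (u_analytic _ origin).
have [cv [rhov [Mv psv]]] := analytic_power_series (v_analytic _ origin).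
split.
  by move=> n i; exact: (quasi_power_expectation_fin_num tau_gt0 mgf_exists psu psv).
split.
  by move=> n i j; exact: (quasi_power_covariance_fin_num tau_gt0 mgf_exists psu psv).
split; first exact: (quasi_power_mean tau_gt0 kappa_infty mgf_exists mgfE errK psu psv).
split.
  exact: (quasi_power_covariance tau_gt0 u_analytic v_analytic kappa_infty mgf_exists mgfE errK psu psv).
split.
  exact: (quasi_power_regular tau_gt0 u_analytic v_analytic Phi_infty kappa_infty mgf_exists mgfE errK psu psv).
split; last first.
  exact: (quasi_power_rank0 tau_gt0 u_analytic v_analytic Phi_infty kappa_infty mgf_exists mgfE errK psu psv).
have varP := quasi_power_variance_bounded tau_gt0 u_analytic v_analytic Phi_infty kappa_infty
  mgf_exists mgfE errK psu psv.
move=> /(quasi_power_rank1 tau_gt0 u_analytic v_analytic Phi_infty kappa_infty mgf_exists mgfE errK psu psv).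
move=> [mu [muY [mu1 mu2]]]; exists mu; split=> //; split=> h.
  by apply: mu1; have [i hi] := h; exists i; exact/varP.
by apply: mu2; apply: contra_not h => -[i Sii]; exists i; exact/varP.
Qed.
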